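(* Let $\mathscr X$ be a rigid $C^*$-tensor category with simple unit object such that $Irr(\mathscr X)$ is finite. Let $p=2m\ge 1$ be an even integer, let $A$ be a (trivially $\mathbb Z_2$-graded) algebra over $\mathbb C$, and let $\mathbf H=\mathbf H^+\oplus\mathbf H^-$ be a $\mathbb Z_2$-graded object in $\mathbf{Hilb}(\mathscr X)$. Let $\{(\mathbf H,\mathbf F_t):t\in[0,1]\}$ be a family of $p$-summable Fredholm modules over $A$, where for each $t\in[0,1]$ $$\mathbf F_t=\begin{bmatrix}0&\mathbf Q_t\\ \mathbf P_t&0\end{bmatrix},\qquad \mathbf P_t:\mathbf H^+\to\mathbf H^-,\quad \mathbf Q_t:\mathbf H^-\to\mathbf H^+.$$ For each $t$, let $\rho_t:A\to\mathbf{Hilb}(\mathscr X)(\mathbf H,\mathbf H)$ be the corresponding graded homomorphism of degree $0$, with components $\rho_t^{\pm}$ acting on $\mathbf H^{\pm}$. Assume that for every $a\in A$: (1) $t\mapsto\rho_t^+(a)-\mathbf Q_t\rho_t^-(a)\mathbf P_t$ is a continuous map $[0,1]\to\mathcal S_p(\mathbf H^+)$; (2) $t\mapsto\rho_t^+(a)$ and $t\mapsto\mathbf Q_t\rho_t^-(a)\mathbf P_t$ are piecewise strongly $C^1$ maps. Then the $(p+2)$-dimensional character $ch^{p+2}(\mathbf H,\mathbf F_t)\in H^{p+2}_\lambda(A)$ is independent of $t\in[0,1]$.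
   Context: **Rigid $C^*$-tensor category.** $\mathscr X$ is an abelian $\mathbb C$-linear strict monoidal category $(\mathscr X,\otimes,1)$ with finite-dimensional hom-spaces, equipped with antilinear maps $(\cdot)^*:\mathscr X(a,b)\to\mathscr X(b,a)$ with $f^{**}=f$, $(g\circ f)^*=f^*\circ g^*$, $(g\otimes f)^*=g^*\otimes f^*$ (structure isomorphisms unitary), such that (i) for each $f\in\mathscr X(a,b)$ there is $g\in\mathscr X(a,a)$ with $f^*\circ f=g^*\circ g$; (ii) $\|f\|^2:=\sup\{|\xi|: f^*\circ f-\xi 1_a \text{ not invertible}\}$ defines complete submultiplicative norms with $\|f^*\circ f\|=\|f\|^2$. Every object has a dual and a predual, and the unit object $1$ is simple. (Then $\mathscr X$ is semisimple: each object is a finite direct sum of simple objects.) $Irr(\mathscr X)$ is a fixed set of representatives of isomorphism classes of simple objects. **$\mathbf{Hilb}(\mathscr X)$.** $\mathbf{Hilb}$ is the category of separable complex Hilbert spaces and bounded operators. Objects of $\mathbf{Hilb}(\mathscr X)$ are linear dagger functors $\mathbf H:\mathscr X^{op}\to\mathbf{Hilb}$; morphisms $\mathbf H\to\mathbf K$ are natural transformations $\theta=(\theta_c)_c$ with $\sup_{c\in\mathscr X}|\theta_c|<\infty$, $|\cdot|$ the operator norm. **Schatten classes.** For $p\in[1,\infty)$, $\mathcal S_p(\mathbf H)$ is the set of $\theta\in\mathbf{Hilb}(\mathscr X)(\mathbf H,\mathbf H)$ with $\theta_c$ compact for all $c\in\mathscr X$ and $\sup_{c\in Irr(\mathscr X)}\|\theta_c\|_p<\infty$,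 where $\|T\|_p=(\sum_n s_n(T)^p)^{1/p}$ with $s_n(T)$ the singular values of $T$. $\mathcal S_p(\mathbf H)$ carries the norm $\theta\mapsto\sup_{c\in Irr(\mathscr X)}\|\theta_c\|_p$. **Strongly $C^1$.** A map $t\mapsto\theta_t$, $[0,1]\to\mathbf{Hilb}(\mathscr X)(\mathbf H,\mathbf K)$, is strongly $C^1$ if it is continuously differentiable for the strong operator topology: for every $c\in\mathscr X$ and $h\in\mathbf H(c)$, $t\mapsto(\theta_t)_c(h)\in\mathbf K(c)$ is $C^1$. It is piecewise strongly $C^1$ if it is strongly continuous and $[0,1]$ is a finite union of consecutive closed intervals on each of which it is strongly $C^1$. **Fredholm modules.** A $p$-summable Fredholm module $(\mathbf H,\mathbf F)$ over an algebra $A$ consists of: a $\mathbb Z_2$-graded object $\mathbf H=\mathbf H^+\oplus\mathbf H^-$ of $\mathbf{Hilb}(\mathscr X)$ with grading operator $\varepsilon$ ($\varepsilon=\pm1$ on $\mathbf H^\pm$); an algebra homomorphism $\rho:A\to\mathbf{Hilb}(\mathscr X)(\mathbf H,\mathbf H)$ of degree zero ($A$ concentrated in degree zero, i.e. each $\rho(a)$ commutes with $\varepsilon$); and $\mathbf F\in\mathbf{Hilb}(\mathscr X)(\mathbf H,\mathbf H)$ with $\mathbf F^2=id$, $\mathbf F\varepsilon=-\varepsilon\mathbf F$, and $\mathbf F\rho(a)-\rho(a)\mathbf F\in\mathcal S_p(\mathbf H)$ for all $a\in A$. **Character.** An element $\theta\in\mathbf{Hilb}(\mathscr X)(\mathbf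 H,\mathbf H)$ is even (resp. odd) if it commutes (resp. anticommutes) with $\varepsilon$. The graded commutator is $[\mathbf F,\theta]=\mathbf F\theta-(-1)^{\deg\theta}\theta\mathbf F$ for homogeneous $\theta$, extended linearly, and $d\theta:=i[\mathbf F,\theta]$. For $\theta\in\mathcal S_1(\mathbf H)$, $Trace(\theta):=\sum_{c\in Irr(\mathscr X)}trace(\theta_c)$. If $[\mathbf F,\theta]\in\mathcal S_1(\mathbf H)$, $Tr_s(\theta):=\frac12Trace(\varepsilon\mathbf F[\mathbf F,\theta])$. For an even integer $n=2k\ge p-1$, the $n$-dimensional character of $(\mathbf H,\mathbf F)$ is the linear map $\tau^n:A^{\otimes(n+1)}\to\mathbb C$, $$\tau^n(a_0\otimes\dots\otimes a_n)=(2i\pi)^k\,k!\,Tr_s\big(\rho(a_0)d\rho(a_1)\cdots d\rho(a_n)\big).$$ It is a cyclic cocycle, $\tau^n\in Z^n_\lambda(A)$, and $ch^n(\mathbf H,\mathbf F):=[\tau^n]\in H^n_\lambda(A)$. **Cyclic cohomology.** $C^k(A)$ is the space of linear maps $A^{\otimes(k+1)}\to\mathbb C$; $C^k_\lambda(A)$ is the subspace of $\psi$ with $\psi(x_0,\dots,x_k)=(-1)^k\psi(x_1,\dots,x_k,x_0)$; the differential is $(b\psi)(x_0,\dots,x_{k+1})=\sum_{i=0}^k(-1)^i\psi(x_0,\dots,x_ix_{i+1},\dots,x_{k+1})+(-1)^{k+1}\psi(x_{k+1}x_0,x_1,\dots,x_k)$. $Z^\bullet_\lambda(A)$ and $H^\bullet_\lambda(A)$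 are the cocycles and cohomology of $(C^\bullet_\lambda(A),b)$. *)

(* Defs.v *)
From HB Require Import structures.
From mathcomp Require Import all_boot all_order all_algebra.
From mathcomp Require Import sesquilinear.
From mathcomp Require Import all_classical all_reals all_analysis.
From mathcomp Require Import complex.

Set Implicit Arguments.
Unset Strict Implicit.
Unset Printing Implicit Defensive.

Import Order.TTheory GRing.Theory Num.Theory.
Import numFieldNormedType.Exports.

Local Open Scope classical_set_scope.
Local Open Scope ring_scope.

(* Norms over R[i] take values in R[i]; [rnorm] is the same norm in R. *)
Definition rnorm (R : realType) (V : normedZmodType R[i]) (x : V) : R :=
  complex.Re `|x|.

(* [inner] is linear in its first argument. *)
HB.mixin Record isSeparableHilbert (R : realType) T
    & CompleteNormedModule R[i] T := {
  inner : {dot T for @Num.conj R[i]} ;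
  inner_norm : forall x : T, `|x| ^+ 2 = inner x x ;
  hilbert_separable : exists2 D : set T, countable D & dense D
}.

#[short(type="hilbertType")]
HB.structure Definition Hilbert (R : realType) :=
  {T of isSeparableHilbert R T & CompleteNormedModule R[i] T}.

Section OperatorNorm.
Variable R : realType.
Implicit Types V W : normedModType R[i].

Definition opnorm V W (f : V -> W) : \bar R :=
  ereal_sup [set (rnorm (f x))%:E | x in [set x : V | rnorm x <= 1]].

Lemma rnormE (V : normedZmodType R[i]) (x : V) : `|x| = ((rnorm x)%:C)%C.
Proof. by rewrite /rnorm RRe_real // normr_real. Qed.

Lemma rnorm_ge0 (V : normedZmodType R[i]) (x : V) : 0 <= rnorm x.
Proof. by have := normr_ge0 x; rewrite rnormE lecR. Qed.

Lemma rnormD (V : normedZmodType R[i]) (x y : V) :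
  rnorm (x + y) <= rnorm x + rnorm y.
Proof. by rewrite -lecR rmorphD /= -!rnormE ler_normD. Qed.

Lemma rnormN (V : normedZmodType R[i]) (x : V) : rnorm (- x) = rnorm x.
Proof. by rewrite /rnorm normrN. Qed.

Lemma rnorm0 (V : normedZmodType R[i]) : rnorm (0 : V) = 0.
Proof. by rewrite /rnorm normr0. Qed.

Lemma rnorm_eq0 (V : normedZmodType R[i]) (x : V) : (rnorm x == 0) = (x == 0).
Proof. by rewrite -(normr_eq0 x) rnormE fmorph_eq0. Qed.

Lemma rnormZ V (z : R[i]) (x : V) : rnorm (z *: x) = rnorm z * rnorm x.
Proof.
apply: (@fmorph_inj _ _ (real_complex R)).
by rewrite rmorphM /= -!rnormE normrZ.
Qed.

Lemma rnormR (r : R) : rnorm ((r%:C)%C : R[i]) = `|r|.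
Proof. by rewrite /rnorm normc_def /= expr0n /= addr0 sqrtr_sqr. Qed.

Lemma opnorm_leP V W (f : V -> W) (M : R) : linear f -> 0 <= M ->
  (opnorm f <= M%:E)%E <-> (forall x, rnorm (f x) <= M * rnorm x).
Proof.
move=> lf M0; pose g : {linear V -> W} := HB.pack f (GRing.isLinear.Build _ _ _ _ f lf).
have fZ z x : f (z *: x) = z *: f x by exact: (linearZ_LR g).
have f0 : f 0 = 0 by exact: (raddf0 g).
split=> [fM x|fM]; last first.
  apply: ge_ereal_sup => _ [x /= x1 <-]; rewrite lee_fin.
  by rewrite (le_trans (fM x))// ler_piMr.
have [->|x0] := eqVneq x 0; first by rewrite f0 !rnorm0 mulr0.
have nx : 0 < rnorm x by rewrite lt_def rnorm_eq0 x0 rnorm_ge0.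
have zE : rnorm (((rnorm x)^-1)%:C : R[i])%C = (rnorm x)^-1.
  by rewrite rnormR ger0_norm// invr_ge0 ltW.
have : ((rnorm (f (((rnorm x)^-1)%:C%C *: x)))%:E <= M%:E)%E.
  apply: le_trans fM; apply: ereal_sup_ubound; exists (((rnorm x)^-1)%:C%C *: x) => //=.
  by rewrite rnormZ zE mulVf// gt_eqF.
by rewrite lee_fin fZ rnormZ zE mulrC ler_pdivrMr.
Qed.

Lemma opnorm_lty V W (f : V -> W) : linear f ->
  (opnorm f < +oo)%E <-> exists M, 0 <= M /\ forall x, rnorm (f x) <= M * rnorm x.
Proof.
move=> lf; split=> [foo|[M [M0 /(opnorm_leP lf M0) fM]]]; last first.
  by rewrite (le_lt_trans fM) ?ltry.
have f0 : (0 <= opnorm f)%E.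
  apply: le_trans (_ : ((rnorm (f 0))%:E <= _)%E); first by rewrite lee_fin rnorm_ge0.
  by apply: ereal_sup_ubound; exists 0; rewrite //= rnorm0.
exists (fine (opnorm f)); split; first exact: fine_ge0.
by apply/opnorm_leP; rewrite ?fine_ge0 // fineK // ge0_fin_numE.
Qed.

End OperatorNorm.

(* The morphisms of Hilb. *)
Record bop (R : realType) (V W : hilbertType R) := Bop {
  bop_fun :> V -> W ;
  bop_linear : linear bop_fun ;
  bop_bounded : (opnorm bop_fun < +oo)%E
}.

Section BoundedOperators.
Variable R : realType.

Lemma bopP (V W : hilbertType R) (S T : bop V W) : S =1 T -> S = T.
Proof.
case: S T => [S lS bS] [T lT bT] /= /funext ST; subst T.
by congr Bop; exact: Prop_irrelevance.
Qed.

Section Lmodule.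
Variables V W : hilbertType R.
Implicit Types S T : bop V W.

HB.instance Definition _ T := GRing.isLinear.Build R[i] V W *:%R T (bop_linear T).

Lemma bop_bnd T : exists M, 0 <= M /\ forall x, rnorm (T x) <= M * rnorm x.
Proof. by apply/opnorm_lty; [exact: bop_linear|exact: bop_bounded]. Qed.

HB.instance Definition _ := gen_eqMixin (bop V W).
HB.instance Definition _ := gen_choiceMixin (bop V W).

Lemma bop0_linear : linear (fun _ : V => 0 : W).
Proof. by move=> z x y; rewrite scaler0 addr0. Qed.
Lemma bop0_bounded : (opnorm (fun _ : V => 0%R : W) < +oo)%E.
Proof.
apply/opnorm_lty; first exact: bop0_linear.
by exists 0; split=> // x; rewrite mul0r rnorm0.
Qed.
Definition bop0 := Bop bop0_linear bop0_bounded.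

Lemma bopD_linear S T : linear (fun x => S x + T x).
Proof. by move=> z x y; rewrite !linearP scalerDr addrACA. Qed.
Lemma bopD_bounded S T : (opnorm (fun x => S x + T x)%R < +oo)%E.
Proof.
apply/opnorm_lty; first exact: bopD_linear.
have [[M [M0 SM]] [N [N0 TN]]] := (bop_bnd S, bop_bnd T).
exists (M + N); split=> [|x]; first exact: addr_ge0.
by rewrite mulrDl (le_trans (rnormD _ _))// lerD.
Qed.
Definition bopD S T := Bop (bopD_linear S T) (bopD_bounded S T).

Lemma bopZ_linear (z : R[i]) T : linear (fun x => z *: T x).
Proof. by move=> w x y; rewrite linearP scalerDr !scalerA mulrC. Qed.
Lemma bopZ_bounded (z : R[i]) T : (opnorm (fun x => z *: T x)%R < +oo)%E.
Proof.
apply/opnorm_lty; first exact: bopZ_linear.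
have [M [M0 TM]] := bop_bnd T.
exists (rnorm z * M); split=> [|x]; first by rewrite mulr_ge0// rnorm_ge0.
by rewrite rnormZ -mulrA ler_wpM2l// rnorm_ge0.
Qed.
Definition bopZ z T := Bop (bopZ_linear z T) (bopZ_bounded z T).

Lemma bopN_linear T : linear (fun x => - T x).
Proof. by move=> w x y; rewrite linearP opprD scalerN. Qed.
Lemma bopN_bounded T : (opnorm (fun x => - T x)%R < +oo)%E.
Proof.
apply/opnorm_lty; first exact: bopN_linear.
have [M [M0 TM]] := bop_bnd T.
by exists M; split=> // x; rewrite rnormN.
Qed.
Definition bopN T := Bop (bopN_linear T) (bopN_bounded T).

Fact bopDA : associative bopD.
Proof. by move=> S T U; apply/bopP => x /=; rewrite addrA. Qed.
Fact bopDC : commutative bopD.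
Proof. by move=> S T; apply/bopP => x /=; rewrite addrC. Qed.
Fact bop0D : left_id bop0 bopD.
Proof. by move=> T; apply/bopP => x /=; rewrite add0r. Qed.
Fact bopND : left_inverse bop0 bopN bopD.
Proof. by move=> T; apply/bopP => x /=; rewrite addNr. Qed.
HB.instance Definition _ := GRing.isZmodule.Build (bop V W) bopDA bopDC bop0D bopND.

Fact bopZA z w T : bopZ z (bopZ w T) = bopZ (z * w) T.
Proof. by apply/bopP => x /=; rewrite scalerA. Qed.
Fact bop1Z : left_id 1 bopZ.
Proof. by move=> T; apply/bopP => x /=; rewrite scale1r. Qed.
Fact bopZDr : right_distributive bopZ +%R.
Proof. by move=> z S T; apply/bopP => x /=; rewrite scalerDr. Qed.
Fact bopZDl T : {morph bopZ^~ T : z w / z + w}.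
Proof. by move=> z w; apply/bopP => x /=; rewrite scalerDl. Qed.
HB.instance Definition _ :=
  GRing.Zmodule_isLmodule.Build R[i] (bop V W) bopZA bop1Z bopZDr bopZDl.

End Lmodule.

Lemma bop1_linear (V : hilbertType R) : linear (@id V).
Proof. by []. Qed.
Lemma bop1_bounded (V : hilbertType R) : (opnorm (@id V) < +oo)%E.
Proof.
apply/opnorm_lty; first exact: bop1_linear.
by exists 1; split=> // x; rewrite mul1r.
Qed.
Definition bop1 (V : hilbertType R) := Bop (@bop1_linear V) (bop1_bounded V).

Section Composition.
Variables (U V W : hilbertType R) (S : bop V W) (T : bop U V).
Lemma bopM_linear : linear (fun x => S (T x)).
Proof. by move=> z x y; rewrite !linearP. Qed.
Lemma bopM_bounded : (opnorm (fun x => S (T x)) < +oo)%E.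
Proof.
apply/opnorm_lty; first exact: bopM_linear.
have [[M [M0 SM]] [N [N0 TN]]] := (bop_bnd S, bop_bnd T).
exists (M * N); split=> [|x]; first exact: mulr_ge0.
by rewrite (le_trans (SM _))// -mulrA ler_wpM2l.
Qed.
Definition bopM := Bop bopM_linear bopM_bounded.
End Composition.

Definition is_adjoint (V W : hilbertType R) (T : bop V W) (S : bop W V) : Prop :=
  forall x y, inner (T x) y = inner x (S y).

Definition compact_op (V W : hilbertType R) (T : bop V W) : Prop :=
  precompact (T @` [set x | rnorm x <= 1]).

(* [s] lists in nonincreasing order, with multiplicities, the square roots of
   the nonzero eigenvalues of T^* T, and is padded with zeros when there are
   finitely many of them. When s n = 0 the vector [e n] is irrelevant. *)
Definition singular_values (V W : hilbertType R) (T : bop V W) (s : nat -> R) :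
    Prop :=
  [/\ forall n, 0 <= s n,
      {homo s : m n / (m <= n)%N >-> n <= m} &
      exists S : bop W V, exists e : nat -> V,
      [/\ is_adjoint T S,
          forall m n, 0 < s m -> 0 < s n -> inner (e m) (e n) = (m == n)%:R,
          forall n, 0 < s n -> S (T (e n)) = ((s n ^+ 2)%:C)%C *: e n &
          forall x, (forall n, 0 < s n -> inner x (e n) = 0) -> S (T x) = 0]].

(* Compact operators have exactly one such list; the norms below are only used
   on compact operators. *)
Definition singular_value (V W : hilbertType R) (T : bop V W) : nat -> R :=
  xget (fun=> 0) [set s | singular_values T s].

Definition schatten_norm (p : R) (V W : hilbertType R) (T : bop V W) : \bar R :=
  ((\sum_(0 <= n <oo) ((singular_value T n) `^ p)%:E) `^ p^-1)%E.

(* A basis indexed by a set D of natural numbers, to allow any dimension. *)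
Definition orthonormal_basis (V : hilbertType R) (D : set nat) (e : nat -> V) :
    Prop :=
  {in D &, forall m n, inner (e m) (e n) = (m == n)%:R} /\
  forall x, {in D, forall n, inner x (e n) = 0} -> x = 0.

(* The value common to all orthonormal bases, for T of trace class. *)
Definition op_trace (V : hilbertType R) (T : bop V V) : R[i] :=
  xget 0 [set z | forall D (e : nat -> V), orthonormal_basis D e ->
    rnorm (\sum_(0 <= n < N | n \in D) inner (T (e n)) (e n) - z)
      @[N --> \oo] --> (0 : R)].

End BoundedOperators.

(* C-linear categories with finite-dimensional hom-spaces. *)
Record linCat (R : realType) := LinCat {
  ob :> Type ;
  hom : ob -> ob -> vectType R[i] ;
  idm : forall a, hom a a ;
  comp : forall a b c, hom b c -> hom a b -> hom a c ;
  comp1m : forall a b (f : hom a b), comp (idm b) f = f ;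
  compm1 : forall a b (f : hom a b), comp f (idm a) = f ;
  compA : forall a b c d (h : hom c d) (g : hom b c) (f : hom a b),
    comp h (comp g f) = comp (comp h g) f ;
  comp_linearl : forall a b c (f : hom a b), linear (fun g : hom b c => comp g f) ;
  comp_linearr : forall a b c (g : hom b c), linear (fun f : hom a b => comp g f)
}.

Arguments idm {R l} a.
Arguments comp {R l a b c} g f.

Declare Scope cat_scope.
Delimit Scope cat_scope with cat.
Local Open Scope cat_scope.
Notation "g ∘ f" := (comp g f) (at level 40, left associativity) : cat_scope.

Section LinearCategory.
Variables (R : realType) (X : linCat R).

Definition is_iso (a b : X) (f : hom a b) : Prop :=
  exists g : hom b a, g ∘ f = idm a /\ f ∘ g = idm b.

Definition isomorphic (a b : X) : Prop := exists f : hom a b, is_iso f.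

Definition is_zero (a : X) : Prop := idm a = 0.

Definition is_mono (a b : X) (f : hom a b) : Prop :=
  forall c (u v : hom c a), f ∘ u = f ∘ v -> u = v.

Definition is_epi (a b : X) (f : hom a b) : Prop :=
  forall c (u v : hom b c), u ∘ f = v ∘ f -> u = v.

Definition is_kernel (a b k : X) (f : hom a b) (i : hom k a) : Prop :=
  f ∘ i = 0 /\
  forall c (u : hom c a), f ∘ u = 0 -> exists! v : hom c k, i ∘ v = u.

Definition is_cokernel (a b q : X) (f : hom a b) (j : hom b q) : Prop :=
  j ∘ f = 0 /\
  forall c (u : hom b c), u ∘ f = 0 -> exists! v : hom q c, v ∘ j = u.

Definition has_biproduct (a b : X) : Prop :=
  exists s (i : hom a s) (j : hom b s) (p : hom s a) (q : hom s b),
    [/\ p ∘ i = idm a, q ∘ j = idm b, p ∘ j = 0, q ∘ i = 0 &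
        i ∘ p + j ∘ q = idm s].

Definition is_abelian : Prop :=
  [/\ exists z : X, is_zero z,
      forall a b : X, has_biproduct a b,
      forall (a b : X) (f : hom a b),
        (exists k (i : hom k a), is_kernel f i) /\
        (exists q (j : hom b q), is_cokernel f j),
      forall (a b : X) (f : hom a b), is_mono f ->
        exists c (g : hom b c), is_kernel g f &
      forall (a b : X) (f : hom a b), is_epi f ->
        exists c (g : hom c a), is_cokernel g f].

Definition is_simple (a : X) : Prop :=
  ~ is_zero a /\
  forall b (f : hom b a), is_mono f -> is_zero b \/ is_iso f.

(* [irr] enumerates a set of representatives of the isomorphism classes of
   simple objects, indexed by I. *)
Definition irr_representatives (I : Type) (irr : I -> X) : Prop :=
  [/\ forall i, is_simple (irr i),
      forall i j, isomorphic (irr i) (irr j) -> i = j &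
      forall a, is_simple a -> exists i, isomorphic a (irr i)].

(* The identity of a, seen as a morphism to b along an equality of objects: the
   structure isomorphisms of a strict monoidal category are of this form. *)
Definition idm_eq (a b : X) (e : a = b) : hom a b :=
  match e in _ = c return hom a c with erefl => idm a end.

End LinearCategory.

(* Since the category is strict, its structure isomorphisms are the [idm_eq],
   so that they satisfy the coherence conditions and are unitary; what remains
   to be required is their naturality. *)
Record strictTensorCat (R : realType) := StrictTensorCat {
  tc_cat :> linCat R ;
  tc_abelian : is_abelian tc_cat ;
  tob : tc_cat -> tc_cat -> tc_cat ;
  tunit : tc_cat ;
  thom : forall a b a' b' : tc_cat, hom a b -> hom a' b' ->
    hom (tob a a') (tob b b') ;
  thom1 : forall a b : tc_cat, thom (idm a) (idm b) = idm (tob a b) ;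
  thom_comp : forall (a b c a' b' c' : tc_cat) (g : hom b c) (f : hom a b)
    (g' : hom b' c') (f' : hom a' b'),
    thom (g ∘ f) (g' ∘ f') = thom g g' ∘ thom f f' ;
  thom_linearl : forall (a b a' b' : tc_cat) (g : hom a' b'),
    linear (fun f : hom a b => thom f g) ;
  thom_linearr : forall (a b a' b' : tc_cat) (f : hom a b),
    linear (fun g : hom a' b' => thom f g) ;
  tobA : forall a b c, tob (tob a b) c = tob a (tob b c) ;
  tob1l : forall a, tob tunit a = a ;
  tob1r : forall a, tob a tunit = a ;
  thomA : forall (a b c a' b' c' : tc_cat)
    (f : hom a a') (g : hom b b') (h : hom c c'),
    idm_eq (tobA a' b' c') ∘ thom (thom f g) h =
    thom f (thom g h) ∘ idm_eq (tobA a b c) ;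
  thom1l : forall (a b : tc_cat) (f : hom a b),
    idm_eq (tob1l b) ∘ thom (idm tunit) f = f ∘ idm_eq (tob1l a) ;
  thom1r : forall (a b : tc_cat) (f : hom a b),
    idm_eq (tob1r b) ∘ thom f (idm tunit) = f ∘ idm_eq (tob1r a)
}.

(* [b] is a dual of [a], and [a] is a predual of [b]. *)
Definition is_dual (R : realType) (X : strictTensorCat R) (a b : X) : Prop :=
  exists (ev : hom (tob b a) (tunit X)) (coev : hom (tunit X) (tob a b)),
    idm_eq (tob1r a) ∘ thom (idm a) ev ∘ idm_eq (tobA a b a)
      ∘ thom coev (idm a) ∘ idm_eq (esym (tob1l a)) = idm a /\
    idm_eq (tob1l b) ∘ thom ev (idm b) ∘ idm_eq (esym (tobA b a b))
      ∘ thom (idm b) coev ∘ idm_eq (esym (tob1r b)) = idm b.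

(* The square root of the supremum of the moduli of the spectrum of f^* f, the
   involution being given as a parameter. *)
Definition cstar_norm (R : realType) (X : linCat R)
    (star : forall a b : X, hom a b -> hom b a) (a b : X) (f : hom a b) : R :=
  Num.sqrt (sup [set rnorm xi |
    xi in [set xi : R[i] | ~ is_iso (star a b f ∘ f - xi *: idm a)]]).

Record rigidCstarTensorCat (R : realType) := RigidCstarTensorCat {
  rc_cat :> strictTensorCat R ;
  star : forall a b : rc_cat, hom a b -> hom b a ;
  star_antilinear : forall (a b : rc_cat) (z : R[i]) (f g : hom a b),
    star (z *: f + g) = Num.conj z *: star f + star g ;
  starK : forall (a b : rc_cat) (f : hom a b), star (star f) = f ;
  star_comp : forall (a b c : rc_cat) (g : hom b c) (f : hom a b),
    star (g ∘ f) = star f ∘ star g ;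
  star_thom : forall (a b a' b' : rc_cat) (g : hom a b) (f : hom a' b'),
    star (thom g f) = thom (star g) (star f) ;
  star_square : forall (a b : rc_cat) (f : hom a b),
    exists g : hom a a, star f ∘ f = star g ∘ g ;
  cnormD : forall (a b : rc_cat) (f g : hom a b),
    cstar_norm star (f + g) <= cstar_norm star f + cstar_norm star g ;
  cnormZ : forall (a b : rc_cat) (z : R[i]) (f : hom a b),
    cstar_norm star (z *: f) = rnorm z * cstar_norm star f ;
  cnorm_eq0 : forall (a b : rc_cat) (f : hom a b),
    cstar_norm star f = 0 -> f = 0 ;
  cnorm_complete : forall (a b : rc_cat) (u : nat -> hom a b),
    (forall e : R, 0 < e -> exists N, forall m n, (N <= m)%N -> (N <= n)%N ->
       cstar_norm star (u m - u n) < e) ->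
    exists l : hom a b, cstar_norm star (u n - l) @[n --> \oo] --> (0 : R) ;
  cnorm_comp : forall (a b c : rc_cat) (g : hom b c) (f : hom a b),
    cstar_norm star (g ∘ f) <= cstar_norm star g * cstar_norm star f ;
  cnorm_star : forall (a b : rc_cat) (f : hom a b),
    cstar_norm star (star f ∘ f) = cstar_norm star f ^+ 2 ;
  has_dual : forall a : rc_cat, exists b, is_dual a b ;
  has_predual : forall a : rc_cat, exists b, is_dual b a ;
  tunit_simple : is_simple (tunit rc_cat)
}.

(* Linear dagger functors from X^op to Hilb, i.e. objects of Hilb(X). *)
Record hilbX (R : realType) (X : rigidCstarTensorCat R) := HilbX {
  hx_ob :> X -> hilbertType R ;
  hx_map : forall a b : X, hom a b -> bop (hx_ob b) (hx_ob a) ;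
  hx_linear : forall a b : X, linear (@hx_map a b) ;
  hx_id : forall a : X, hx_map (idm a) = bop1 (hx_ob a) ;
  hx_comp : forall (a b c : X) (g : hom b c) (f : hom a b),
    hx_map (g ∘ f) = bopM (hx_map f) (hx_map g) ;
  hx_star : forall (a b : X) (f : hom a b),
    is_adjoint (hx_map f) (hx_map (star f))
}.

Record hilbX_hom (R : realType) (X : rigidCstarTensorCat R) (H K : hilbX X) :=
  HilbXHom {
    hx_comp_at :> forall c : X, bop (H c) (K c) ;
    hx_natural : forall (a b : X) (f : hom a b),
      bopM (hx_comp_at a) (hx_map H f) = bopM (hx_map K f) (hx_comp_at b) ;
    hx_bounded : (ereal_sup (range (fun c => opnorm (hx_comp_at c))) < +oo)%E
  }.

Section HilbXHom.
Variables (R : realType) (X : rigidCstarTensorCat R).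
Implicit Types H K L : hilbX X.

Lemma hx_homP H K (s t : hilbX_hom H K) : (forall c, s c = t c) -> s = t.
Proof.
case: s t => [s ns bs] [t nt bt] /= st.
have {}st : s = t by apply: functional_extensionality_dep.
by subst t; congr HilbXHom; exact: Prop_irrelevance.
Qed.

Lemma hx_boundedP H K (s : forall c, bop (H c) (K c)) :
  (ereal_sup (range (fun c => opnorm (s c))) < +oo)%E <->
  exists M, 0 <= M /\ forall c x, rnorm (s c x) <= M * rnorm x.
Proof.
split=> [soo|[M [M0 sM]]]; last first.
  rewrite (@le_lt_trans _ _ M%:E) ?ltry//; apply: ge_ereal_sup => _ [c _ <-].
  by apply/(opnorm_leP (@bop_linear _ _ _ (s c)) M0) => x; exact: sM.
set m := ereal_sup _ in soo.
have sm c : (opnorm (s c) <= m)%E by apply: ereal_sup_ubound; exists c.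
exists (fine (Order.max m 0%E)); have m0 : (0 <= Order.max m 0)%E.
  by rewrite le_max lexx orbT.
have mfin : Order.max m 0%E \is a fin_num.
  by rewrite ge0_fin_numE// gt_max soo ltry.
split=> [|c x]; first exact: fine_ge0.
move: x; apply/(opnorm_leP (@bop_linear _ _ _ (s c)) (fine_ge0 m0)).
by rewrite fineK// le_max sm.
Qed.

Section Lmodule.
Variables H K : hilbX X.
Implicit Types s t : hilbX_hom H K.

HB.instance Definition _ := gen_eqMixin (hilbX_hom H K).
HB.instance Definition _ := gen_choiceMixin (hilbX_hom H K).

Lemma hx_bnd s : exists M, 0 <= M /\ forall c x, rnorm (s c x) <= M * rnorm x.
Proof. by apply/hx_boundedP; exact: hx_bounded. Qed.

Lemma hx_nat s (a b : X) (f : hom a b) x :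
  s a (hx_map H f x) = hx_map K f (s b x).
Proof. by have /(congr1 (fun S : bop _ _ => S x)) := hx_natural s f. Qed.

Lemma hx0_natural (a b : X) (f : hom a b) :
  bopM (0 : bop (H a) (K a)) (hx_map H f) =
  bopM (hx_map K f) (0 : bop (H b) (K b)).
Proof. by apply/bopP => x /=; rewrite linear0. Qed.
Lemma hx0_bounded :
  (ereal_sup (range (fun c => opnorm (0%R : bop (H c) (K c)))) < +oo)%E.
Proof.
by apply/hx_boundedP; exists 0; split=> // c x; rewrite mul0r rnorm0.
Qed.
Definition hx0 := HilbXHom hx0_natural hx0_bounded.

Lemma hxD_natural s t (a b : X) (f : hom a b) :
  bopM (s a + t a) (hx_map H f) = bopM (hx_map K f) (s b + t b).
Proof. by apply/bopP => x /=; rewrite linearD !hx_nat. Qed.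
Lemma hxD_bounded s t :
  (ereal_sup (range (fun c => opnorm (s c + t c)%R)) < +oo)%E.
Proof.
apply/hx_boundedP; have [[M [M0 sM]] [N [N0 tN]]] := (hx_bnd s, hx_bnd t).
exists (M + N); split=> [|c x]; first exact: addr_ge0.
by rewrite mulrDl (le_trans (rnormD _ _))// lerD.
Qed.
Definition hxD s t := HilbXHom (hxD_natural s t) (hxD_bounded s t).

Lemma hxN_natural s (a b : X) (f : hom a b) :
  bopM (- s a) (hx_map H f) = bopM (hx_map K f) (- s b).
Proof. by apply/bopP => x /=; rewrite linearN !hx_nat. Qed.
Lemma hxN_bounded s : (ereal_sup (range (fun c => opnorm (- s c)%R)) < +oo)%E.
Proof.
apply/hx_boundedP; have [M [M0 sM]] := hx_bnd s.
by exists M; split=> // c x; rewrite rnormN.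
Qed.
Definition hxN s := HilbXHom (hxN_natural s) (hxN_bounded s).

Lemma hxZ_natural (z : R[i]) s (a b : X) (f : hom a b) :
  bopM (z *: s a) (hx_map H f) = bopM (hx_map K f) (z *: s b).
Proof. by apply/bopP => x /=; rewrite linearZ !hx_nat. Qed.
Lemma hxZ_bounded (z : R[i]) s :
  (ereal_sup (range (fun c => opnorm (z *: s c)%R)) < +oo)%E.
Proof.
apply/hx_boundedP; have [M [M0 sM]] := hx_bnd s.
exists (rnorm z * M); split=> [|c x]; first by rewrite mulr_ge0// rnorm_ge0.
rewrite rnormZ -mulrA; apply: ler_wpM2l; [exact: rnorm_ge0|exact: sM].
Qed.
Definition hxZ z s := HilbXHom (hxZ_natural z s) (hxZ_bounded z s).

Fact hxDA : associative hxD.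
Proof. by move=> s t u; apply/hx_homP => c; exact: addrA. Qed.
Fact hxDC : commutative hxD.
Proof. by move=> s t; apply/hx_homP => c; exact: addrC. Qed.
Fact hx0D : left_id hx0 hxD.
Proof. by move=> s; apply/hx_homP => c; exact: add0r. Qed.
Fact hxND : left_inverse hx0 hxN hxD.
Proof. by move=> s; apply/hx_homP => c; exact: addNr. Qed.
HB.instance Definition _ :=
  GRing.isZmodule.Build (hilbX_hom H K) hxDA hxDC hx0D hxND.

Fact hxZA z w s : hxZ z (hxZ w s) = hxZ (z * w) s.
Proof. by apply/hx_homP => c; exact: scalerA. Qed.
Fact hx1Z : left_id 1 hxZ.
Proof. by move=> s; apply/hx_homP => c; exact: scale1r. Qed.
Fact hxZDr : right_distributive hxZ +%R.
Proof. by move=> z s t; apply/hx_homP => c; exact: scalerDr. Qed.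
Fact hxZDl s : {morph hxZ^~ s : z w / z + w}.
Proof. by move=> z w; apply/hx_homP => c; exact: scalerDl. Qed.
HB.instance Definition _ :=
  GRing.Zmodule_isLmodule.Build R[i] (hilbX_hom H K) hxZA hx1Z hxZDr hxZDl.

End Lmodule.

Lemma hx1_natural H (a b : X) (f : hom a b) :
  bopM (bop1 (H a)) (hx_map H f) = bopM (hx_map H f) (bop1 (H b)).
Proof. exact/bopP. Qed.
Lemma hx1_bounded H :
  (ereal_sup (range (fun c => opnorm (bop1 (H c)))) < +oo)%E.
Proof. by apply/hx_boundedP; exists 1; split=> // c x; rewrite mul1r. Qed.
Definition hx1 H := HilbXHom (@hx1_natural H) (hx1_bounded H).

Lemma hxM_natural H K L (s : hilbX_hom K L) (t : hilbX_hom H K) (a b : X)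
    (f : hom a b) :
  bopM (bopM (s a) (t a)) (hx_map H f) = bopM (hx_map L f) (bopM (s b) (t b)).
Proof. by apply/bopP => x /=; rewrite !hx_nat. Qed.
Lemma hxM_bounded H K L (s : hilbX_hom K L) (t : hilbX_hom H K) :
  (ereal_sup (range (fun c => opnorm (bopM (s c) (t c)))) < +oo)%E.
Proof.
apply/hx_boundedP; have [[M [M0 sM]] [N [N0 tN]]] := (hx_bnd s, hx_bnd t).
exists (M * N); split=> [|c x]; first exact: mulr_ge0.
by rewrite (le_trans (sM _ _))// -mulrA ler_wpM2l.
Qed.
Definition hxM H K L (s : hilbX_hom K L) (t : hilbX_hom H K) :=
  HilbXHom (hxM_natural s t) (hxM_bounded s t).

End HilbXHom.

Notation "s ⊙ t" := (hxM s t) (at level 40, left associativity) : cat_scope.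

Section Schatten.
Variables (R : realType) (X : rigidCstarTensorCat R) (I : Type) (irr : I -> X).
Variables (p : R) (H : hilbX X).

Definition schatten_class_norm (s : hilbX_hom H H) : \bar R :=
  ereal_sup (range (fun i => schatten_norm p (s (irr i)))).

Definition schatten_class : set (hilbX_hom H H) :=
  [set s : hilbX_hom H H | (forall c : X, compact_op (s c)) /\
           (schatten_class_norm s < +oo)%E].

Definition schatten_continuous (s : R -> hilbX_hom H H) : Prop :=
  (forall t : R, t \in `[0, 1] -> schatten_class (s t)) /\
  (forall t : R, t \in `[0, 1] ->
    schatten_class_norm (s u - s t)
      @[u --> within [set` `[0, 1]] (nbhs t)] --> 0%E).

End Schatten.

Section StronglyC1.
Variable R : realType.

Definition C1_on (V : normedModType R[i]) (a b : R) (f : R -> V) : Prop :=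
  exists2 f' : R -> V,
    {within `[a, b], continuous f'} &
    forall t : R, t \in `[a, b] ->
      (((u - t)^-1)%:C)%C *: (f u - f t)
        @[u --> within [set` `[a, b]] (dnbhs t)] --> f' t.

Variables (X : rigidCstarTensorCat R) (H K : hilbX X).

Definition strongly_continuous (s : R -> hilbX_hom H K) : Prop :=
  forall (c : X) (h : H c), {within `[0, 1], continuous (fun t => s t c h)}.

Definition strongly_C1_on (a b : R) (s : R -> hilbX_hom H K) : Prop :=
  forall (c : X) (h : H c), C1_on a b (fun t => s t c h).

Definition piecewise_strongly_C1 (s : R -> hilbX_hom H K) : Prop :=
  strongly_continuous s /\
  exists2 r : seq R, itv_partition 0 1 r &
    forall j, (j < size r)%N ->
      strongly_C1_on (nth 0 (0 :: r) j) (nth 0 (0 :: r) j.+1) s.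

End StronglyC1.

(* H = H^+ (+) H^- as an orthogonal direct sum, presented by the inclusions of
   the two summands and the adjoint projections. *)
Record gradedHilbX (R : realType) (X : rigidCstarTensorCat R) := GradedHilbX {
  gr_total :> hilbX X ;
  gr_pos : hilbX X ;
  gr_neg : hilbX X ;
  inj_pos : hilbX_hom gr_pos gr_total ;
  inj_neg : hilbX_hom gr_neg gr_total ;
  proj_pos : hilbX_hom gr_total gr_pos ;
  proj_neg : hilbX_hom gr_total gr_neg ;
  proj_pos_adjoint : forall c, is_adjoint (inj_pos c) (proj_pos c) ;
  proj_neg_adjoint : forall c, is_adjoint (inj_neg c) (proj_neg c) ;
  proj_inj_pos : proj_pos ⊙ inj_pos = hx1 gr_pos ;
  proj_inj_neg : proj_neg ⊙ inj_neg = hx1 gr_neg ;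
  proj_pos_inj_neg : proj_pos ⊙ inj_neg = 0 ;
  proj_neg_inj_pos : proj_neg ⊙ inj_pos = 0 ;
  inj_proj_sum : inj_pos ⊙ proj_pos + inj_neg ⊙ proj_neg = hx1 gr_total
}.

(* Associative algebras, not necessarily unital. *)
HB.mixin Record Lmodule_isAssocAlgebra (K : comNzRingType) A
    & GRing.Lmodule K A := {
  amul : A -> A -> A ;
  amulA : associative amul ;
  amul_linearl : forall y, linear (amul^~ y) ;
  amul_linearr : forall x, linear (amul x)
}.

#[short(type="assocAlgType")]
HB.structure Definition AssocAlgebra (K : comNzRingType) :=
  {A of Lmodule_isAssocAlgebra K A & GRing.Lmodule K A}.

Section Fredholm.
Variables (R : realType) (X : rigidCstarTensorCat R) (H : gradedHilbX X).
Implicit Types s t F : hilbX_hom H H.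

Definition grading : hilbX_hom H H :=
  inj_pos H ⊙ proj_pos H - inj_neg H ⊙ proj_neg H.

(* The operator with block matrix [0 Q; P 0]. *)
Definition off_diagonal (P : hilbX_hom (gr_pos H) (gr_neg H))
    (Q : hilbX_hom (gr_neg H) (gr_pos H)) : hilbX_hom H H :=
  inj_pos H ⊙ Q ⊙ proj_neg H + inj_neg H ⊙ P ⊙ proj_pos H.

Definition block_pos s : hilbX_hom (gr_pos H) (gr_pos H) :=
  proj_pos H ⊙ s ⊙ inj_pos H.

Definition block_neg s : hilbX_hom (gr_neg H) (gr_neg H) :=
  proj_neg H ⊙ s ⊙ inj_neg H.

Definition even_part s := 2^-1 *: (s + grading ⊙ s ⊙ grading).
Definition odd_part s := 2^-1 *: (s - grading ⊙ s ⊙ grading).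

(* The graded commutator with the odd operator F. *)
Definition gcomm F s : hilbX_hom H H :=
  (F ⊙ even_part s - even_part s ⊙ F) + (F ⊙ odd_part s + odd_part s ⊙ F).

Definition gdiff F s : hilbX_hom H H := 'i *: gcomm F s.

Definition is_fredholm_module (I : Type) (irr : I -> X) (p : R)
    (A : assocAlgType R[i]) (rho : A -> hilbX_hom H H) (F : hilbX_hom H H) :
    Prop :=
  [/\ linear rho /\ (forall a b, rho (amul a b) = rho a ⊙ rho b),
      forall a, rho a ⊙ grading = grading ⊙ rho a,
      F ⊙ F = hx1 H,
      F ⊙ grading = - (grading ⊙ F) &
      forall a, schatten_class irr p (F ⊙ rho a - rho a ⊙ F)].

Section Character.
Variables (I : finType) (irr : I -> X).

Definition Trace s : R[i] := \sum_(i : I) op_trace (s (irr i)).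

Definition supertrace F s : R[i] := 2^-1 * Trace (grading ⊙ F ⊙ gcomm F s).

End Character.
End Fredholm.

Section CyclicCohomology.
Variables (R : realType) (A : assocAlgType R[i]).

(* A linear map on the (n+1)-st tensor power of A is given as a multilinear
   function of n+1 variables. *)
Definition cochain (n : nat) : Type := ('I_n.+1 -> A) -> R[i].

Definition multilinear n (psi : cochain n) : Prop :=
  forall (i : 'I_n.+1) (x : 'I_n.+1 -> A),
    scalar (fun y : A => psi (@dfwith _ (fun=> A) x i y)).

(* C^n_lambda(A); [x \o ordS] is (x_1, ..., x_n, x_0). *)
Definition cyclic_cochain n : set (cochain n) :=
  [set psi | multilinear psi /\
    forall x, psi x = (-1) ^+ n * psi (fun j => x (ordS j))].

(* (x_0, ..., x_i x_(i+1), ..., x_(k+1)) *)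
Definition face k (i : 'I_k.+1) (x : 'I_k.+2 -> A) : 'I_k.+1 -> A :=
  fun j => let xj := x (widen_ord (leqnSn _) j) in
           let xj1 := x (lift ord0 j) in
           if (j < i)%N then xj else if j == i then amul xj xj1 else xj1.

(* (x_(k+1) x_0, x_1, ..., x_k) *)
Definition last_face k (x : 'I_k.+2 -> A) : 'I_k.+1 -> A :=
  fun j => if j == ord0 then amul (x ord_max) (x ord0)
           else x (widen_ord (leqnSn _) j).

Definition hochschild k (psi : cochain k) : cochain k.+1 := fun x =>
  \sum_(i < k.+1) (-1) ^+ i * psi (face i x) +
  (-1) ^+ k.+1 * psi (last_face x).

Definition cyclic_cocycle n : set (cochain n) :=
  [set psi | cyclic_cochain psi /\ forall x, hochschild psi x = 0].

Definition cyclic_coboundary n : set (cochain n) :=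
  match n with
  | 0 => [set fun=> 0]
  | k.+1 => (@hochschild k) @` @cyclic_cochain k
  end.

Definition cyclic_class n (psi : cochain n) : set (cochain n) :=
  [set phi | cyclic_coboundary (fun x => phi x - psi x)].

(* H^n_lambda(A) as the set of cosets of the coboundaries in the cocycles. *)
Definition cyclic_cohomology n : set (set (cochain n)) :=
  [set cyclic_class psi | psi in @cyclic_cocycle n].

End CyclicCohomology.

Section CyclicCharacter.
Variables (R : realType) (X : rigidCstarTensorCat R) (H : gradedHilbX X).
Variables (I : finType) (irr : I -> X) (A : assocAlgType R[i]).

(* The n-dimensional character, n being even. *)
Definition character (n : nat) (rho : A -> hilbX_hom H H) (F : hilbX_hom H H) :
    cochain A n := fun x =>
  (2 * 'i * (pi%:C)%C) ^+ n./2 * (n./2)`!%:R *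
  supertrace irr F
    (rho (x ord0) ⊙
     \big[@hxM R X H H H/hx1 H]_(j < n) gdiff F (rho (x (lift ord0 j)))).

Definition chern_character (n : nat) (rho : A -> hilbX_hom H H)
    (F : hilbX_hom H H) : set (cochain A n) :=
  cyclic_class (@character n rho F).

End CyclicCharacter.

Arguments cyclic_cohomology {R} A n.
Arguments character {R X H I} irr {A} n rho F.
Arguments chern_character {R X H I} irr {A} n rho F.

(* Main.v *)
From HB Require Import structures.
Require Import Defs.
From mathcomp Require Import all_boot all_order all_algebra.
From mathcomp Require Import sesquilinear.
From mathcomp Require Import all_classical all_reals all_analysis.
From mathcomp Require Import complex.
From mathcomp Require Import ring lra.

Set Implicit Arguments.
Unset Strict Implicit.
Unset Printing Implicit Defensive.

Import Order.TTheory GRing.Theory Num.Theory.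
Import numFieldNormedType.Exports.

Local Open Scope classical_set_scope.
Local Open Scope ring_scope.
Local Open Scope cat_scope.

(** Fix a simple object c and let V be the Hilbert space H^+(c). Since the square
    of F_t is 1, P_t and Q_t are mutually inverse, so a |-> rho_t^+(a) and
    a |-> Q_t rho_t^-(a) P_t are two representations sigma_t and tau_t of A on V.
    By hypothesis their difference delta_t lies in the Schatten class S_p and
    varies continuously for its norm. Transporting H^- to H^+ along Q_t turns F_t
    into the flip of two copies of H^+, and the character becomes a constant times
    the sum over c of the cochains phi_t(a_0,..,a_n) = tr(delta_t(a_0)..delta_t(a_n))
    with n = p + 2 ([character_formula]). So everything happens on one Hilbert
    space, for two representations that differ by Schatten operators.

    Formally the derivative of phi_t is the Hochschild coboundary of
      psi_t(a_0,..,a_(n-1))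
        = sum_j (-1)^j tr(delta_t(a_0)..(sigma_t' + tau_t')(a_j)..delta_t(a_(n-1))),
    because sigma_t' is a derivation along sigma_t and tau_t' one along tau_t. The
    derivatives only exist strongly, so they are avoided: psi is formed with the
    increments sigma_u - sigma_t and tau_u - tau_t, which satisfy the Leibniz rule
    up to a product of two increments ([transgression_coboundary]). A strongly C^1
    path is Lipschitz in operator norm by uniform boundedness ([piecewise_C1_lip]),
    so this error is O(|u-t|^2). Replacing phi_u - phi_t by its first order part
    leaves words with two increments of delta; one of them is O(|u-t|) in operator
    norm, the other is small in the Schatten norm, uniformly in t, and the error is
    o(|u-t|) ([step_defect]). Summed over a partition of [0,T] into N equal steps,
    the increments of psi give bounded cyclic cochains whose coboundaries tend to
    phi_T - phi_0. A limit along an ultrafilter is a cyclic cochain with coboundary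
    phi_T - phi_0 ([homotopy_coboundary]); it takes the place of the integral of psi_t.

    All traces are taken of words with at least p Schatten letters. For these a
    substitute for the Hoelder inequality is enough. An operator with singular
    values s_k is peeled by rank one operators, the remainder after k steps having
    norm at most s_k ([singular_values_telescopes]). The product of two operators
    peeled in this way is peeled too, its remainders being the products of the
    remainders ([telescopes_mul]). Hence a product of p Schatten operators is a
    series of finite rank operators with summable weights ([gauge_nuclear]), and
    linearity, cyclicity and the bounds of the trace are read off such a series. *)

(** * Complex norms, inner products and sequential limits *)

Notation Re := complex.Re.

Section ComplexNorm.
Variable R : realType.
Implicit Types z w : R[i].

Lemma rnorm_sqr z : ((rnorm z ^+ 2)%:C)%C = z * Num.conj z.
Proof. by rewrite rmorphXn /= -rnormE sqr_normc. Qed.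

Lemma rnormM z w : rnorm (z * w) = rnorm z * rnorm w.
Proof.
by apply: (@complexI R); rewrite rmorphM /= -!rnormE normrM.
Qed.

Lemma rnorm_conj z : rnorm (Num.conj z) = rnorm z.
Proof. by rewrite /rnorm normcJ. Qed.

Lemma conjCR (r : R) : Num.conj (r%:C%C : R[i]) = r%:C%C.
Proof. exact: conjc_real. Qed.

Lemma conjCM z w : Num.conj (z * w) = Num.conj z * Num.conj w.
Proof. exact: rmorphM. Qed.

Lemma conjCK z : Num.conj (Num.conj z) = z.
Proof. exact: conjcK. Qed.

Lemma rnorm1 : rnorm (1 : R[i]) = 1.
Proof. by rewrite /rnorm normr1. Qed.

Lemma rnormX z n : rnorm (z ^+ n) = rnorm z ^+ n.
Proof. by elim: n => [|n IHn]; rewrite ?expr0 ?rnorm1// !exprS rnormM IHn. Qed.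

Lemma ler_Re_rnorm z : `|Re z| <= rnorm z.
Proof. by rewrite -lecR -rnormE normc_ge_Re. Qed.

Lemma ler_Im_rnorm z : `|complex.Im z| <= rnorm z.
Proof.
rewrite -lecR -rnormE normc_def lecR -sqrtr_sqr ler_sqrt ?addr_ge0 ?sqr_ge0//.
by rewrite lerDr sqr_ge0.
Qed.

Lemma ReD z w : Re (z + w) = Re z + Re w. Proof. by case: z w => [? ?] []. Qed.
Lemma ReN z : Re (- z) = - Re z. Proof. by case: z. Qed.
Lemma ImD z w : complex.Im (z + w) = complex.Im z + complex.Im w.
Proof. by case: z w => [? ?] []. Qed.
Lemma ImN z : complex.Im (- z) = - complex.Im z. Proof. by case: z. Qed.
Lemma Re_conj z : Re (Num.conj z) = Re z. Proof. by case: z. Qed.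
Lemma ReMr (r : R) z : Re (r%:C%C * z) = r * Re z.
Proof. by case: z => a b /=; rewrite mul0r subr0. Qed.

Lemma rnorm_ReIm z : rnorm z <= `|Re z| + `|complex.Im z|.
Proof.
rewrite -(@ler_pXn2r _ 2) ?nnegrE ?rnorm_ge0 ?addr_ge0//.
have -> : rnorm z ^+ 2 = `|Re z| ^+ 2 + `|complex.Im z| ^+ 2.
  by apply: (@complexI R); rewrite rmorphXn /= -rnormE -add_Re2_Im2 !real_normK ?num_real.
by rewrite sqrrD -addrA [X in _ <= _ + X]addrC addrA lerDl mulrn_wge0// mulr_ge0.
Qed.

Lemma rnorm_sum (V : normedZmodType R[i]) I (s : seq I) (P : pred I) (F : I -> V) :
  rnorm (\sum_(i <- s | P i) F i) <= \sum_(i <- s | P i) rnorm (F i).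
Proof.
elim/big_ind2: _ => [|x a y b xa yb|//]; first by rewrite rnorm0.
by apply: le_trans (rnormD _ _) _; rewrite lerD.
Qed.

Lemma rnormBC (V : normedZmodType R[i]) (x y : V) : rnorm (x - y) = rnorm (y - x).
Proof. by rewrite -rnormN opprB. Qed.

Lemma rnormB (V : normedZmodType R[i]) (x y : V) : rnorm (x - y) <= rnorm x + rnorm y.
Proof. by rewrite -(rnormN y) rnormD. Qed.

Lemma rnorm_triB (V : normedZmodType R[i]) (y x z : V) :
  rnorm (x - z) <= rnorm (x - y) + rnorm (y - z).
Proof. by rewrite -(subrKA y) rnormD. Qed.

End ComplexNorm.

Section InnerProduct.
Variables (R : realType) (V : hilbertType R).
Implicit Types (x y w : V) (z : R[i]).

Lemma innerC x y : inner x y = Num.conj (inner y x).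
Proof. by rewrite hermC expr0 mul1r. Qed.
Lemma innerDl x y w : inner (x + y) w = inner x w + inner y w.
Proof. exact: linearDl. Qed.
Lemma innerDr x y w : inner w (x + y) = inner w x + inner w y.
Proof. exact: linearDr. Qed.
Lemma innerNl x w : inner (- x) w = - inner x w.
Proof. exact: linearNl. Qed.
Lemma innerNr x w : inner w (- x) = - inner w x.
Proof. exact: linearNr. Qed.
Lemma innerBl x y w : inner (x - y) w = inner x w - inner y w.
Proof. by rewrite innerDl innerNl. Qed.
Lemma innerBr x y w : inner w (x - y) = inner w x - inner w y.
Proof. by rewrite innerDr innerNr. Qed.
Lemma inner0l w : inner (0 : V) w = 0.
Proof. exact: linear0l. Qed.
Lemma inner0r w : inner w (0 : V) = 0.
Proof. exact: linear0r. Qed.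
Lemma innerZl z x y : inner (z *: x) y = z * inner x y.
Proof. exact: linearZl_LR. Qed.
Lemma innerZr z x y : inner x (z *: y) = Num.conj z * inner x y.
Proof. by rewrite innerC innerZl conjCM -innerC. Qed.
Lemma inner_suml I (s : seq I) (P : pred I) (F : I -> V) y :
  inner (\sum_(i <- s | P i) F i) y = \sum_(i <- s | P i) inner (F i) y.
Proof. exact: linear_sumlz. Qed.
Lemma inner_sumr I (s : seq I) (P : pred I) (F : I -> V) y :
  inner y (\sum_(i <- s | P i) F i) = \sum_(i <- s | P i) inner y (F i).
Proof. exact: linear_sumr. Qed.

Lemma inner_sq x : inner x x = ((rnorm x ^+ 2)%:C)%C.
Proof. by rewrite -inner_norm rnormE rmorphXn. Qed.

Lemma Re_inner_sq x : Re (inner x x) = rnorm x ^+ 2.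
Proof. by rewrite inner_sq. Qed.

Lemma inner_eq0 x : (inner x x == 0) = (x == 0).
Proof. by rewrite -inner_norm expf_eq0 normr_eq0. Qed.

Lemma rnorm_sqD x y :
  rnorm (x + y) ^+ 2 = rnorm x ^+ 2 + rnorm y ^+ 2 + 2 * Re (inner x y).
Proof.
rewrite -!Re_inner_sq innerDl !innerDr !ReD [inner y x]innerC Re_conj; ring.
Qed.

Lemma rnorm_sqB x y :
  rnorm (x - y) ^+ 2 = rnorm x ^+ 2 + rnorm y ^+ 2 - 2 * Re (inner x y).
Proof. by rewrite rnorm_sqD rnormN innerNr ReN mulrN. Qed.

Lemma pythagoras x y : inner x y = 0 ->
  rnorm (x + y) ^+ 2 = rnorm x ^+ 2 + rnorm y ^+ 2.
Proof. by move=> xy; rewrite rnorm_sqD xy mulr0 addr0. Qed.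

Lemma rnorm_sqBZ z x y : rnorm (x - z *: y) ^+ 2 =
  rnorm x ^+ 2 + rnorm z ^+ 2 * rnorm y ^+ 2 - 2 * Re (Num.conj z * inner x y).
Proof. by rewrite rnorm_sqB innerZr rnormZ exprMn. Qed.

Lemma cauchy_schwarz x y : rnorm (inner x y) <= rnorm x * rnorm y.
Proof.
have [->|y0] := eqVneq y 0; first by rewrite inner0r !rnorm0 mulr0.
have ny : 0 < rnorm y by rewrite lt_def rnorm_eq0 y0 rnorm_ge0.
rewrite -(@ler_pXn2r _ 2) ?nnegrE ?mulr_ge0 ?rnorm_ge0//.
have := rnorm_sqBZ (((rnorm y ^+ 2)^-1)%:C%C * inner x y) x y.
rewrite rnormM rnormR conjCM conjCR -mulrA ReMr [Num.conj _ * _]mulrC -rnorm_sqr /=.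
move=> E; have := sqr_ge0 (rnorm (x - (((rnorm y ^+ 2)^-1)%:C%C * inner x y) *: y)).
rewrite E ger0_norm ?invr_ge0 ?sqr_ge0// exprMn.
have -> : rnorm x ^+ 2 + (rnorm y ^+ 2)^-1 ^+ 2 * rnorm (inner x y) ^+ 2 * rnorm y ^+ 2 -
  2 * ((rnorm y ^+ 2)^-1 * rnorm (inner x y) ^+ 2) =
  (rnorm x ^+ 2 * rnorm y ^+ 2 - rnorm (inner x y) ^+ 2) / rnorm y ^+ 2.
  by field; rewrite gt_eqF.
by rewrite pmulr_lge0 ?invr_gt0 ?exprn_gt0// subr_ge0 exprMn.
Qed.

Lemma inner_eqr x y : (forall w, inner w x = inner w y) -> x = y.
Proof.
by move=> xy; apply/eqP; rewrite -subr_eq0 -inner_eq0 innerBr !xy subrr.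
Qed.

Lemma rnorm_le_inner x (M : R) : 0 <= M ->
  (forall y, Re (inner x y) <= M * rnorm y) -> rnorm x <= M.
Proof.
move=> M0 /(_ x); rewrite Re_inner_sq expr2.
have [/eqP|x0] := boolP (rnorm x == 0); first by move=> ->.
by rewrite ler_pM2r// lt_def x0 rnorm_ge0.
Qed.

End InnerProduct.

(** The norm is turned into a real number, so that order and limits in R apply. *)
Definition cvs (R : realType) (V : normedZmodType R[i]) (u : nat -> V) (l : V) :=
  (rnorm (u n - l) : R) @[n --> \oo] --> (0 : R).

Section SequentialConvergence.
Variable R : realType.
Implicit Types V W : normedZmodType R[i].

Lemma cvg0P (r : nat -> R) : (forall n, 0 <= r n) ->
  r n @[n --> \oo] --> (0 : R) <->
  forall e, 0 < e -> exists N, forall n, (N <= n)%N -> r n < e.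
Proof.
move=> r0; split=> [/cvgrPdist_lt rc e e0|h].
  have [N _ Nr] := rc e e0; exists N => n /Nr /=.
  by rewrite sub0r normrN ger0_norm.
apply/cvgrPdist_lt => e /h [N Nr]; exists N => // n /= /Nr.
by rewrite sub0r normrN ger0_norm.
Qed.

Lemma cvsP V (u : nat -> V) l : cvs u l <->
  forall e, 0 < e -> exists N, forall n, (N <= n)%N -> rnorm (u n - l) < e.
Proof. by apply: cvg0P => n; exact: rnorm_ge0. Qed.

Lemma cvs_le V (u : nat -> V) l (r : nat -> R) :
  (forall n, rnorm (u n - l) <= r n) -> r n @[n --> \oo] --> (0 : R) -> cvs u l.
Proof.
move=> ur; apply: (@squeeze_cvgr _ _ _ _ (fun=> 0)); last exact: cvg_cst.
by near=> n; rewrite ur rnorm_ge0.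
Unshelve. all: by end_near. Qed.

Lemma cvs_cst V (l : V) : cvs (fun=> l) l.
Proof. by rewrite /cvs subrr rnorm0; exact: cvg_cst. Qed.

Lemma cvsD V (u v : nat -> V) l m : cvs u l -> cvs v m ->
  cvs (fun n => u n + v n) (l + m).
Proof.
move=> ul vm; apply: (@cvs_le _ _ _ (fun n => rnorm (u n - l) + rnorm (v n - m))).
  by move=> n; rewrite opprD addrACA rnormD.
by rewrite -[X in _ --> X](addr0 0); exact: cvgD.
Qed.

Lemma cvs_lip V W (f : V -> W) (M : R) (u : nat -> V) l :
  (forall n, rnorm (f (u n) - f l) <= M * rnorm (u n - l)) ->
  cvs u l -> cvs (fun n => f (u n)) (f l).
Proof.
move=> fM ul; apply: (@cvs_le _ _ _ (fun n => M * rnorm (u n - l))) => //.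
by rewrite -[X in _ --> X](mulr0 M); exact: cvgMr.
Qed.

Lemma cvsN V (u : nat -> V) l : cvs u l -> cvs (fun n => - u n) (- l).
Proof. by apply: (@cvs_lip _ _ -%R 1) => n; rewrite mul1r -opprD rnormN. Qed.

Lemma cvsB V (u v : nat -> V) l m : cvs u l -> cvs v m ->
  cvs (fun n => u n - v n) (l - m).
Proof. by move=> ul /cvsN; exact: cvsD. Qed.

Lemma cvs_sum V I (s : seq I) (u : I -> nat -> V) l : (forall i, cvs (u i) (l i)) ->
  cvs (fun n => \sum_(i <- s) u i n) (\sum_(i <- s) l i).
Proof.
move=> ul; elim: s => [|i s IHs].
  rewrite big_nil; under [X in cvs X]eq_fun do rewrite big_nil.
  exact: cvs_cst.
rewrite big_cons; under [X in cvs X]eq_fun do rewrite big_cons.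
exact: cvsD.
Qed.

Lemma cvsM (z : R[i]) (u : nat -> R[i]) l : cvs u l -> cvs (fun n => z * u n) (z * l).
Proof. by apply: (@cvs_lip _ _ ( *%R z) (rnorm z)) => n; rewrite -mulrBr rnormM. Qed.

Lemma cvs_unique V (u : nat -> V) l m : cvs u l -> cvs u m -> l = m.
Proof.
move=> ul um; have /cvsB/(_ um) := ul.
under [X in cvs X]eq_fun do rewrite subrr.
rewrite /cvs sub0r => /cvg_unique; rewrite rnormN => /(_ (@norm_hausdorff _ _) _ (@cvg_cst _ _ _ _ _)).
by move=> h; apply/eqP; rewrite -subr_eq0 -rnorm_eq0 h.
Qed.

Lemma cvs_bound V (u : nat -> V) l (M : R) :
  cvs u l -> (forall n, rnorm (u n) <= M) -> rnorm l <= M.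
Proof.
move=> /cvsP ul uM; apply/ler_addgt0Pr => e /ul [N /(_ N (leqnn N)) uN].
rewrite -[l](subrK (u N)) addrC; apply: le_trans (rnormD _ _) _.
by rewrite lerD// rnormBC ltW.
Qed.

Lemma nbhs_rnormP (V : normedModType R[i]) (x : V) (A : set V) : nbhs x A <->
  exists2 e : R, 0 < e & forall y, rnorm (y - x) < e -> A y.
Proof.
rewrite -nbhs_ballE; split=> [[e /= e0 eA]|[e e0 eA]].
  move: (e0) => /gtr0_real/RRe_real eE; exists (Re e).
    by rewrite -ltcR eE.
  by move=> y xy; apply: eA; rewrite -ball_normE /= distrC rnormE -eE ltcR.
exists (e%:C)%C => /=; first by rewrite ltcR.
by move=> y; rewrite -ball_normE /= distrC rnormE ltcR => /eA.
Qed.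

Lemma cvs_complete (V : completeNormedModType R[i]) (u : nat -> V) :
  (forall e : R, 0 < e -> exists N, forall m n, (N <= m)%N -> (N <= n)%N ->
     rnorm (u m - u n) < e) -> exists l, cvs u l.
Proof.
move=> uC; have /cauchy_cvg uc : cauchy (u n @[n --> \oo]).
  apply/cauchy_ballP => e e0.
  move: (e0) => /gtr0_real/RRe_real eE.
  have [|N Nu] := uC (Re e); first by rewrite -ltcR eE.
  exists ([set u n | n in [set n | (N <= n)%N]], [set u n | n in [set n | (N <= n)%N]]).
    by split; exists N => // n /= Nn; exists n.
  move=> [_ _] [[m /= Nm <-] [n /= Nn <-]] /=.
  by rewrite -ball_normE /= rnormE -eE ltcR Nu.
exists (lim (u n @[n --> \oo])); apply/cvsP => e e0.
have /uc [N _ NP] : nbhs (lim (u n @[n --> \oo])) [set y | rnorm (y - lim (u n @[n --> \oo])) < e].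
  by apply/nbhs_rnormP; exists e.
by exists N => n /NP.
Qed.

Lemma real_complete (u : nat -> R) :
  (forall e : R, 0 < e -> exists N, forall m n, (N <= m)%N -> (N <= n)%N ->
     `|u m - u n| < e) -> cvgn u.
Proof.
move=> uC; apply/cauchy_cvgP/cauchy_ballP => e e0.
have [N Nu] := uC e e0.
exists ([set u n | n in [set n | (N <= n)%N]], [set u n | n in [set n | (N <= n)%N]]).
  by split; exists N => // n /= Nn; exists n.
by move=> [_ _] [[m /= Nm <-] [n /= Nn <-]] /=; rewrite -ball_normE /= Nu.
Qed.

Lemma complex_complete (u : nat -> R[i]) :
  (forall e : R, 0 < e -> exists N, forall m n, (N <= m)%N -> (N <= n)%N ->
     rnorm (u m - u n) < e) -> exists l, cvs u l.
Proof.
move=> uC.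
have /cvg_ex [a ua] : cvgn (fun n => Re (u n)).
  apply: real_complete => e /uC [N Nu]; exists N => m n Nm Nn.
  by rewrite -ReN -ReD (le_lt_trans (ler_Re_rnorm _))// Nu.
have /cvg_ex [b ub] : cvgn (fun n => complex.Im (u n)).
  apply: real_complete => e /uC [N Nu]; exists N => m n Nm Nn.
  by rewrite -ImN -ImD (le_lt_trans (ler_Im_rnorm _))// Nu.
exists (Complex a b).
apply: (@cvs_le _ _ _ (fun n => `|Re (u n) - a| + `|complex.Im (u n) - b|)) => [n|].
  by apply: le_trans (rnorm_ReIm _) _; case: (u n).
rewrite -[X in _ --> X](addr0 0); apply: cvgD; apply/cvg0P => // e e0.
  by move/cvgrPdist_lt: ua => /(_ e e0) [N _ NP]; exists N => n /NP /=; rewrite distrC.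
by move/cvgrPdist_lt: ub => /(_ e e0) [N _ NP]; exists N => n /NP /=; rewrite distrC.
Qed.

Lemma cvs_bop (V W : hilbertType R) (T : bop V W) u l : cvs u l -> cvs (fun n => T (u n)) (T l).
Proof.
have [M [M0 TM]] := bop_bnd T.
by apply: (@cvs_lip _ _ T M) => n; rewrite -linearB TM.
Qed.

Lemma cvs_innerl (V : hilbertType R) (y : V) u l :
  cvs u l -> cvs (fun n => inner (u n) y) (inner l y).
Proof.
apply: (@cvs_lip _ _ (fun x => inner x y) (rnorm y)) => n.
by rewrite -innerBl mulrC cauchy_schwarz.
Qed.

Lemma cauchy_le V (u : nat -> V) (e : R) N :
  (forall m n, (N <= m)%N -> (m <= n)%N -> rnorm (u n - u m) < e) ->
  forall m n, (N <= m)%N -> (N <= n)%N -> rnorm (u m - u n) < e.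
Proof.
move=> uC m n Nm Nn; case: (leqP m n) => mn; first by rewrite rnormBC uC.
by rewrite uC// ltnW.
Qed.

Lemma sub_partial_sums (W : zmodType) (f : nat -> W) m n : (m <= n)%N ->
  \sum_(k < n) f k - \sum_(k < m) f k = \sum_(m <= k < n) f k.
Proof.
move=> mn; rewrite -!(big_mkord xpredT f) (@big_cat_nat _ _ _ m 0%N n)//=.
by rewrite addrAC subrr add0r.
Qed.

Lemma summable_tail (w : nat -> R) (B e : R) : (forall n, 0 <= w n) ->
  (forall N, \sum_(n < N) w n <= B) -> 0 < e ->
  exists N, forall m n, (N <= m)%N -> (m <= n)%N -> \sum_(m <= k < n) w k < e.
Proof.
move=> w0 wB e0; pose S N := \sum_(n < N) w n.
have Sn : nondecreasing_seq S.
  by apply/nondecreasing_seqP => n; rewrite /S big_ord_recr /= lerDl.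
have Sc : cvgn S by apply: nondecreasing_is_cvgn => //; exists B => _ [n _ <-]; exact: wB.
have /cvgrPdist_lt/(_ e e0) [N _ NS] : S @ \oo --> limn S by [].
exists N => m n Nm mn; rewrite -sub_partial_sums// -/(S n) -/(S m).
have /= := NS _ Nm; apply: le_lt_trans; apply: le_trans (ler_norm _).
by rewrite lerD2r nondecreasing_cvgn_le.
Qed.

End SequentialConvergence.

(** * Orthonormal systems, the Riesz theorem and adjoints *)

Section Orthosystems.
Variables (R : realType) (V : hilbertType R).
Implicit Types (x y : V) (e f : nat -> V).

(** Zero vectors are allowed in an orthonormal system, so that finite and infinite
    systems are both indexed by nat. *)
Definition orthosys e :=
  forall m n, inner (e m) (e n) = ((m == n) && (e n != 0))%:R.

Definition expand e N x : V := \sum_(n < N) inner x (e n) *: e n.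

Definition total e := forall x, (forall n, inner x (e n) = 0) -> x = 0.

Lemma orthosys_restrict (D : pred nat) e :
  (forall m n, D m -> D n -> inner (e m) (e n) = (m == n)%:R) ->
  orthosys (fun n => if D n then e n else 0).
Proof.
move=> eo m n; case: ifP => mD; case: ifP => nD.
- rewrite eo//; case: eqP => //= _; case: eqP => //= en.
  by have := eo n n nD nD; rewrite eqxx en inner0r => /eqP; rewrite eq_sym oner_eq0.
- by rewrite inner0r eqxx andbF.
- by rewrite inner0l; case: eqP => // mn; rewrite mn nD in mD.
- by rewrite inner0r eqxx andbF.
Qed.

Lemma rnorm_sq_sum f N : (forall m n, m != n -> inner (f m) (f n) = 0) ->
  rnorm (\sum_(n < N) f n) ^+ 2 = \sum_(n < N) rnorm (f n) ^+ 2.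
Proof.
move=> fo; elim: N => [|N IHN]; first by rewrite !big_ord0 rnorm0 expr0n.
rewrite !big_ord_recr /= pythagoras ?IHN// inner_suml big1// => n _.
by rewrite fo// ltn_eqF.
Qed.

(** Square norms of blocks add up by Pythagoras, so bounded partial sums are
    Cauchy. *)
Lemma ortho_series_cvg f (M : R) : (forall m n, m != n -> inner (f m) (f n) = 0) ->
  (forall N, rnorm (\sum_(n < N) f n) <= M) ->
  exists l, cvs (fun N => \sum_(n < N) f n) l.
Proof.
move=> fo fM; apply: cvs_complete => eps eps0.
have fS m n : rnorm (\sum_(m <= k < n) f k) ^+ 2 = \sum_(m <= k < n) rnorm (f k) ^+ 2.
  rewrite -[m]add0n !big_addn !big_mkord (@rnorm_sq_sum (fun k => f (k + m)%N))// => i j ij.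
  by rewrite fo// eqn_add2r.
have fM2 N : \sum_(n < N) rnorm (f n) ^+ 2 <= M ^+ 2.
  by rewrite -rnorm_sq_sum// lerXn2r ?nnegrE ?rnorm_ge0 ?(le_trans _ (fM N))// rnorm_ge0.
have [N NP] := summable_tail (fun n => sqr_ge0 (rnorm (f n))) fM2 (exprn_gt0 2 eps0).
exists N; apply: (cauchy_le (u := fun n => \sum_(k < n) f k)) => m n Nm mn.
by rewrite sub_partial_sums// -(@ltr_pXn2r _ 2)// ?nnegrE ?rnorm_ge0 ?(ltW eps0)// fS NP.
Qed.

Variable e : nat -> V.
Hypothesis eo : orthosys e.

Lemma orthosys_norm n : rnorm (e n) <= 1.
Proof.
have := inner_sq (e n); rewrite eo eqxx /=; case: (_ != 0) => /= /(@complexI R) E.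
  by rewrite -(@ler_pXn2r _ 2) ?nnegrE ?rnorm_ge0// -E expr1n.
by move: E => /esym/eqP; rewrite sqrf_eq0 => /eqP ->.
Qed.

Lemma orthosys_terms (a : nat -> R[i]) m n : m != n ->
  inner (a m *: e m) (a n *: e n) = 0.
Proof. by move=> /negPf mn; rewrite innerZl innerZr eo mn /= !mulr0. Qed.

Lemma inner_expand N n x :
  inner (expand e N x) (e n) = if (n < N)%N then inner x (e n) else 0.
Proof.
rewrite /expand inner_suml; case: ifP => nN; last first.
  rewrite big1// => k _; rewrite innerZl eo.
  by rewrite [_ == n]negbTE ?mulr0//; apply: contraFneq nN => <-; rewrite ltn_ord.
rewrite (bigD1 (Ordinal nN))//= big1 ?addr0 => [|k /eqP kn].
  by rewrite innerZl eo eqxx /=; case: eqP => [->|_]; rewrite ?inner0r ?mulr0 ?mulr1.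
rewrite innerZl eo; case: eqP => [E|]; rewrite ?mulr0//=.
by case: kn; apply: val_inj.
Qed.

Lemma bessel N x : rnorm x ^+ 2 = rnorm (x - expand e N x) ^+ 2 + rnorm (expand e N x) ^+ 2.
Proof.
rewrite -pythagoras ?subrK// innerBl {1 3}/expand !inner_sumr -sumrB big1// => k _.
by rewrite !innerZr inner_expand ltn_ord subrr.
Qed.

Lemma expand_le N x : rnorm (expand e N x) <= rnorm x.
Proof.
by rewrite -(@ler_pXn2r _ 2) ?nnegrE ?rnorm_ge0// (bessel N x) lerDr sqr_ge0.
Qed.

Lemma sub_expand_le N x : rnorm (x - expand e N x) <= rnorm x.
Proof.
by rewrite -(@ler_pXn2r _ 2) ?nnegrE ?rnorm_ge0// (bessel N x) lerDl sqr_ge0.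
Qed.

Lemma expand_cvg x : exists2 l, cvs (fun N => expand e N x) l &
  forall n, inner (x - l) (e n) = 0.
Proof.
have [l xl] := @ortho_series_cvg (fun n => inner x (e n) *: e n) _
  (@orthosys_terms _) (fun N => expand_le N x).
exists l => // n; apply/eqP; rewrite innerBl subr_eq0; apply/eqP.
apply: cvs_unique (cvs_innerl (e n) xl).
apply/cvsP => eps eps0; exists n.+1 => N nN.
by rewrite -/(expand e N x) inner_expand nN subrr rnorm0.
Qed.

Lemma total_expand_cvg x : total e -> cvs (fun N => expand e N x) x.
Proof.
by have [l xl lo] := expand_cvg x; move=> /(_ _ lo)/eqP; rewrite subr_eq0 => /eqP {2}->.
Qed.

End Orthosystems.

Section GramSchmidt.
Variables (R : realType) (V : hilbertType R).
Implicit Types (x y : V) (d e : nat -> V).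

Definition normalize x : V := ((rnorm x)^-1)%:C%C *: x.

Lemma normalizeE x : x = (rnorm x)%:C%C *: normalize x.
Proof.
have [->|x0] := eqVneq x 0; first by rewrite /normalize !scaler0.
by rewrite scalerA -rmorphM /= mulfV ?scale1r// rnorm_eq0.
Qed.

Lemma rnorm_normalize x : normalize x != 0 -> rnorm (normalize x) = 1.
Proof.
move=> nx; have x0 : x != 0 by apply: contraNneq nx => ->; rewrite /normalize scaler0.
by rewrite rnormZ rnormR ger0_norm ?invr_ge0 ?rnorm_ge0// mulVf// rnorm_eq0.
Qed.

(** Stage n holds the first n vectors, the n-th one being built from the previous
    stage. *)
Fixpoint gs_stage d n : nat -> V :=
  if n is m.+1 then fun k =>
    if k == m then normalize (d m - expand (gs_stage d m) m (d m)) else gs_stage d m k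
  else fun=> 0.

Definition gram_schmidt d n := gs_stage d n.+1 n.

Lemma gram_schmidtE d n :
  gram_schmidt d n = normalize (d n - expand (gram_schmidt d) n (d n)).
Proof.
have stE m k : (k < m)%N -> gs_stage d m k = gram_schmidt d k.
  rewrite /gram_schmidt; elim: m => // m IHm; rewrite ltnS leq_eqVlt /=.
  by rewrite eqxx; case: eqP => [->//|_ /= km]; rewrite IHm//= eqxx.
rewrite /gram_schmidt /= eqxx; congr normalize; congr (_ - _).
by apply: eq_bigr => k _; rewrite stE.
Qed.

Lemma gram_schmidt_orthosys d : orthosys (gram_schmidt d).
Proof.
set e := gram_schmidt d.
suff H n m : (m < n)%N -> inner (e n) (e m) = 0.
  move=> m n; case: (ltngtP m n) => [mn|mn|->] /=; [|exact: H|].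
    rewrite innerC H//. by rewrite conjC0.
  case: eqP => [->|/eqP e0]; first by rewrite inner0l.
  rewrite inner_sq /e gram_schmidtE rnorm_normalize ?expr1n//.
  by rewrite -gram_schmidtE.
elim/ltn_ind: n m => n IHn m mn.
suff E : inner (expand e n (d n)) (e m) = inner (d n) (e m).
  by rewrite {1}/e gram_schmidtE innerZl innerBl -/e E subrr mulr0.
rewrite /expand inner_suml (bigD1 (Ordinal mn))//= big1 ?addr0 => [|k /eqP km].
  rewrite innerZl; have [->|em0] := eqVneq (e m) 0; first by rewrite !inner0r !mulr0.
  by rewrite inner_sq {2}/e gram_schmidtE rnorm_normalize -?gram_schmidtE// expr1n mulr1.
rewrite innerZl; case: (ltngtP k m) => [km'|mk|E]; last by case: km; exact: val_inj.
  by rewrite [inner (e k) _]innerC IHn// conjC0 mulr0.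
by rewrite IHn// mulr0.
Qed.

Lemma orthogonal_gram_schmidt d x n :
  (forall k, inner x (gram_schmidt d k) = 0) -> inner x (d n) = 0.
Proof.
move=> xo; have -> : d n = (rnorm (d n - expand (gram_schmidt d) n (d n)))%:C%C *: gram_schmidt d n +
    expand (gram_schmidt d) n (d n).
  by rewrite gram_schmidtE -normalizeE subrK.
rewrite innerDr innerZr xo mulr0 add0r inner_sumr big1// => k _.
by rewrite innerZr xo mulr0.
Qed.

Lemma dense_rnorm (D : set V) x (r : R) : dense D -> 0 < r ->
  exists2 y, D y & rnorm (y - x) < r.
Proof.
move=> dD r0; pose O := [set y | rnorm (y - x) < r].
have [||y [Oy Dy]] := dD O; [|rewrite openE => y yx|by exists y].
  by exists x; rewrite /O /= subrr rnorm0.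
apply/nbhs_rnormP; exists (r - rnorm (y - x)); first by rewrite subr_gt0.
by move=> z zy; rewrite /O /= (le_lt_trans (rnorm_triB y _ _))// -ltrBrDr.
Qed.

(** Gram-Schmidt applied to a dense sequence: a vector x orthogonal to the result
    is orthogonal to the whole sequence, so its distance to each term is at least
    its own norm. *)
Lemma orthobasis_exists : exists2 e : nat -> V, orthosys e & total e.
Proof.
have [D /countable_injP [f fi] dD] := @hilbert_separable R V.
pose d n := xget 0 [set x | D x /\ f x = n].
have dE x : D x -> d (f x) = x.
  move=> Dx; have [Dd fd] : [set y | D y /\ f y = f x] (d (f x)) by apply: (xgetPex 0); exists x.
  by apply: fi => //; rewrite inE.
exists (gram_schmidt d); first exact: gram_schmidt_orthosys.
move=> x xo; apply/eqP; apply/negPn/negP => x0.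
have nx : 0 < rnorm x by rewrite lt_def rnorm_eq0 x0 rnorm_ge0.
have [y Dy] := dense_rnorm x dD nx.
rewrite -(@ltr_pXn2r _ 2) ?nnegrE ?rnorm_ge0// rnormBC rnorm_sqB.
rewrite -(dE y Dy) orthogonal_gram_schmidt// mulr0 subr0 ltNge.
by rewrite lerDl sqr_ge0.
Qed.

End GramSchmidt.

Section Adjoint.
Variable R : realType.
Implicit Types V W : hilbertType R.

(** The representing vector is the sum of the series of conj(f(e_n)) e_n; testing
    its partial sums against x gives f of the partial expansion of x, which bounds
    them. *)
Lemma riesz V (f : V -> R[i]) (M : R) : scalar f -> 0 <= M ->
  (forall x, rnorm (f x) <= M * rnorm x) ->
  exists2 y, (forall x, f x = inner x y) & rnorm y <= M.
Proof.
move=> lf M0 fM; have [e eo et] := orthobasis_exists V.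
pose g : {scalar V} := HB.pack f (GRing.isLinear.Build _ _ _ _ f lf).
pose y N := \sum_(n < N) Num.conj (f (e n)) *: e n.
have fy N x : inner x (y N) = f (expand e N x).
  rewrite /y inner_sumr -[RHS]/(g _) /expand (raddf_sum g); apply: eq_bigr => n _.
  by rewrite innerZr conjCK -[RHS]/(g _) (linearZ_LR g) /= mulrC.
have yM N : rnorm (y N) <= M.
  apply: rnorm_le_inner => // x; rewrite innerC Re_conj fy.
  apply: le_trans (ler_norm _) _; apply: le_trans (ler_Re_rnorm _) _.
  by rewrite (le_trans (fM _))// ler_wpM2l// expand_le.
have [l yl] := ortho_series_cvg (orthosys_terms eo (fun n => Num.conj (f (e n)))) yM.
exists l; last by apply: (cvs_bound yl) => N; exact: yM.
move=> x; have fx : cvs (fun N => f (expand e N x)) (f x).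
  apply: (@cvs_lip _ _ _ f M); last exact: total_expand_cvg.
  by move=> N; rewrite -[f]/(g : _ -> _) -raddfB fM.
apply: (cvs_unique fx); under eq_fun do rewrite -fy innerC.
rewrite innerC; apply: (@cvs_lip _ _ _ Num.conj 1 (fun N => inner (y N) x)).
  by move=> N; rewrite mul1r -rmorphB rnorm_conj.
exact: cvs_innerl.
Qed.

Lemma adjoint_exists V W (T : bop V W) : exists S, is_adjoint T S.
Proof.
have [M [M0 TM]] := bop_bnd T.
have H y : exists2 z, (forall x, inner (T x) y = inner x z) & rnorm z <= M * rnorm y.
  apply: riesz; rewrite ?mulr_ge0 ?rnorm_ge0//.
    by move=> a u v; rewrite linearP innerDl innerZl.
  by move=> x; rewrite (le_trans (cauchy_schwarz _ _))// mulrAC ler_wpM2r ?rnorm_ge0.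
pose S y := projT1 (cid2 (H y)).
have SE x y : inner (T x) y = inner x (S y) by rewrite /S; case: cid2.
have SM y : rnorm (S y) <= M * rnorm y by rewrite /S; case: cid2.
have Sl : linear S.
  by move=> a u v; apply: inner_eqr => w; rewrite innerDr innerZr -!SE innerDr innerZr.
have Sb : (opnorm S < +oo)%E by apply/opnorm_lty => //; exists M.
by exists (Bop Sl Sb) => x y; exact: SE.
Qed.

Definition adj V W (T : bop V W) : bop W V := projT1 (cid (adjoint_exists T)).

Lemma adjP V W (T : bop V W) x y : inner (T x) y = inner x (adj T y).
Proof. by rewrite /adj; case: cid. Qed.

Lemma adjPl V W (T : bop V W) x y : inner (adj T x) y = inner x (T y).
Proof. by rewrite innerC -adjP -innerC. Qed.

End Adjoint.

(** * Nuclear operators and their trace *)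

Section FiniteRank.
Variable R : realType.
Implicit Types U V W : hilbertType R.

Lemma opbound_bopM U V W (S : bop V W) (T : bop U V) (a b : R) : 0 <= a ->
  (forall x, rnorm (S x) <= a * rnorm x) -> (forall x, rnorm (T x) <= b * rnorm x) ->
  forall x, rnorm (bopM S T x) <= a * b * rnorm x.
Proof.
by move=> a0 Sa Tb x; rewrite (le_trans (Sa _))// -mulrA ler_wpM2l.
Qed.

Lemma adj_bound V W (T : bop V W) (M : R) : 0 <= M ->
  (forall x, rnorm (T x) <= M * rnorm x) -> forall y, rnorm (adj T y) <= M * rnorm y.
Proof.
move=> M0 TM y; apply: rnorm_le_inner => [|x]; first by rewrite mulr_ge0 ?rnorm_ge0.
rewrite adjPl; apply: le_trans (ler_norm _) _; apply: le_trans (ler_Re_rnorm _) _.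
apply: le_trans (cauchy_schwarz _ _) _.
by rewrite mulrC mulrAC ler_wpM2r ?rnorm_ge0.
Qed.

Lemma rk1_linear V W (u : V) (w : W) : linear (fun x => inner x u *: w).
Proof. by move=> a x y; rewrite innerDl innerZl scalerDl scalerA. Qed.

Lemma rk1_bound V W (u : V) (w : W) x :
  rnorm (inner x u *: w) <= rnorm u * rnorm w * rnorm x.
Proof.
by rewrite rnormZ mulrC mulrAC mulrC ler_wpM2r ?rnorm_ge0// mulrC cauchy_schwarz.
Qed.

Lemma rk1_bounded V W (u : V) (w : W) : (opnorm (fun x : V => (inner x u *: w)%R) < +oo)%E.
Proof.
apply/opnorm_lty; first exact: rk1_linear.
exists (rnorm u * rnorm w); split; first by rewrite mulr_ge0 ?rnorm_ge0.
by move=> x; exact: rk1_bound.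
Qed.

Definition rk1 V W (p : V * W) : bop V W := Bop (rk1_linear p.1 p.2) (rk1_bounded p.1 p.2).

(** Finite rank operators are handled through lists of pairs, one for each rank one
    summand; [weight] bounds the trace norm of the operator and [rep_trace] is its
    trace. *)
Definition frop V W (l : seq (V * W)) : bop V W := \sum_(p <- l) rk1 p.

Definition weight V W (l : seq (V * W)) : R := \sum_(p <- l) rnorm p.1 * rnorm p.2.

Definition rep_trace V (l : seq (V * V)) : R[i] := \sum_(p <- l) inner p.2 p.1.

Lemma bop_sumE V W I (s : seq I) (P : pred I) (F : I -> bop V W) x :
  (\sum_(i <- s | P i) F i) x = \sum_(i <- s | P i) F i x.
Proof. by elim/big_rec2: _ => // i y T _ <-. Qed.

Lemma fropE V W (l : seq (V * W)) x : frop l x = \sum_(p <- l) inner x p.1 *: p.2.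
Proof. exact: bop_sumE. Qed.

Lemma frop_cat V W (l l' : seq (V * W)) : frop (l ++ l') = frop l + frop l'.
Proof. exact: big_cat. Qed.

Lemma weight_cat V W (l l' : seq (V * W)) : weight (l ++ l') = weight l + weight l'.
Proof. exact: big_cat. Qed.

Lemma rep_trace_cat V (l l' : seq (V * V)) : rep_trace (l ++ l') = rep_trace l + rep_trace l'.
Proof. exact: big_cat. Qed.

Lemma weight_ge0 V W (l : seq (V * W)) : 0 <= weight l.
Proof. by apply: sumr_ge0 => p _; rewrite mulr_ge0 ?rnorm_ge0. Qed.

Lemma rep_trace_le V (l : seq (V * V)) : rnorm (rep_trace l) <= weight l.
Proof.
apply: le_trans (rnorm_sum _ _ _) _; apply: ler_sum => p _.
by rewrite mulrC cauchy_schwarz.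
Qed.

Definition lmap_rep U V W (S : bop V W) (l : seq (U * V)) := [seq (p.1, S p.2) | p <- l].
Definition rmap_rep U V W (T : bop U V) (l : seq (V * W)) := [seq (adj T p.1, p.2) | p <- l].

Lemma frop_lmap U V W (S : bop V W) (l : seq (U * V)) :
  frop (lmap_rep S l) = bopM S (frop l).
Proof.
apply/bopP => x; rewrite /= !fropE big_map linear_sum; apply: eq_bigr => p _.
by rewrite linearZ.
Qed.

Lemma frop_rmap U V W (T : bop U V) (l : seq (V * W)) :
  frop (rmap_rep T l) = bopM (frop l) T.
Proof.
by apply/bopP => x; rewrite /= !fropE big_map; apply: eq_bigr => p _; rewrite adjP.
Qed.

Lemma weight_lmap U V W (S : bop V W) (l : seq (U * V)) (M : R) :
  (forall x, rnorm (S x) <= M * rnorm x) -> weight (lmap_rep S l) <= M * weight l.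
Proof.
move=> SM; rewrite /weight big_map mulr_sumr; apply: ler_sum => p _ /=.
by rewrite mulrCA ler_wpM2l ?rnorm_ge0.
Qed.

Lemma weight_rmap U V W (T : bop U V) (l : seq (V * W)) (M : R) : 0 <= M ->
  (forall x, rnorm (T x) <= M * rnorm x) -> weight (rmap_rep T l) <= M * weight l.
Proof.
move=> M0 TM; rewrite /weight big_map mulr_sumr; apply: ler_sum => p _ /=.
by rewrite mulrA ler_wpM2r ?rnorm_ge0// adj_bound.
Qed.

End FiniteRank.

Section Telescopes.
Variable R : realType.
Implicit Types U V W : hilbertType R.

(** T is peeled by finite rank operators: Q n is the remainder after n steps, of
    norm at most c n, and the n-th piece has weight at most m * c n. For a compact
    operator with singular values c one can take m = 1. *)
Record telescopes V W (T : bop V W) (m : nat) (c : nat -> R) : Prop := Telescopes {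
  tele_ge0 : forall n, 0 <= c n ;
  tele_noninc : forall n, c n.+1 <= c n ;
  tele_rep : exists (Q : nat -> bop V W) (L : nat -> seq (V * W)),
    [/\ Q 0%N = T, forall n x, rnorm (Q n x) <= c n * rnorm x,
        forall n, Q n = Q n.+1 + frop (L n) & forall n, weight (L n) <= m%:R * c n]
}.

Lemma telescopes_cst V W (T : bop V W) (M : R) : 0 <= M ->
  (forall x, rnorm (T x) <= M * rnorm x) -> telescopes T 0 (fun=> M).
Proof.
move=> M0 TM; split=> //; exists (fun=> T), (fun=> [::]); split=> // n.
  by rewrite /frop big_nil addr0.
by rewrite /weight big_nil mul0r.
Qed.

(** Q_n Q'_n - Q_(n+1) Q'_(n+1) = (Q_n - Q_(n+1)) Q'_n + Q_(n+1) (Q'_n - Q'_(n+1)),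
    and a finite rank factor times a bounded one has weight at most the product. *)
Lemma telescopes_mul U V W (S : bop V W) (T : bop U V) m m' c c' :
  telescopes S m c -> telescopes T m' c' ->
  telescopes (bopM S T) (m + m') (fun n => c n * c' n).
Proof.
move=> [c0 ci [Q [L [Q0 Qc QL Lc]]]] [c'0 c'i [Q' [L' [Q'0 Qc' QL' Lc']]]].
split=> [n|n|]; [by rewrite mulr_ge0|by rewrite ler_pM|].
exists (fun n => bopM (Q n) (Q' n)), (fun n => rmap_rep (Q' n) (L n) ++ lmap_rep (Q n.+1) (L' n)).
split=> [|n|n|n]; first by rewrite Q0 Q'0.
- exact: opbound_bopM.
- apply/bopP => x; rewrite frop_cat frop_rmap frop_lmap /=.
  have -> : Q n (Q' n x) = Q n.+1 (Q' n x) + frop (L n) (Q' n x) by rewrite {1}QL.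
  have -> : Q n.+1 (Q' n x) = Q n.+1 (Q' n.+1 x) + Q n.+1 (frop (L' n) x).
    by rewrite QL' -linearD.
  by rewrite -addrA [X in _ + X]addrC.
- rewrite weight_cat natrD mulrDl lerD//.
    apply: le_trans (weight_rmap _ _ (Qc' n)) _ => //.
    by rewrite mulrA [leRHS]mulrC ler_wpM2l.
  apply: le_trans (weight_lmap _ (Qc n.+1)) _.
  by rewrite mulrCA ler_pM ?weight_ge0.
Qed.

Lemma telescopes_add V W (S T : bop V W) m m' c c' :
  telescopes S m c -> telescopes T m' c' ->
  telescopes (S + T) (m + m') (fun n => c n + c' n).
Proof.
move=> [c0 ci [Q [L [Q0 Qc QL Lc]]]] [c'0 c'i [Q' [L' [Q'0 Qc' QL' Lc']]]].
split=> [n|n|]; [by rewrite addr_ge0|by rewrite lerD|].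
exists (fun n => Q n + Q' n), (fun n => L n ++ L' n); split=> [|n x|n|n].
- by rewrite Q0 Q'0.
- by rewrite (le_trans (rnormD _ _))// mulrDl lerD.
- by rewrite frop_cat {1}QL {1}QL' addrACA.
- rewrite weight_cat natrD mulrDl lerD// (le_trans (Lc _), le_trans (Lc' _))// ler_wpM2l//.
    by rewrite lerDl.
  by rewrite lerDr.
Qed.

Lemma telescopes_le V W (S : bop V W) m c c' : (forall n, c n <= c' n) ->
  (forall n, c' n.+1 <= c' n) -> telescopes S m c -> telescopes S m c'.
Proof.
move=> cc' ci' [c0 ci [Q [L [Q0 Qc QL Lc]]]]; split=> [n|//|].
  exact: le_trans (cc' n).
exists Q, L; split=> // n => [x|]; first by rewrite (le_trans (Qc n x))// ler_wpM2r ?rnorm_ge0.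
by rewrite (le_trans (Lc n))// ler_wpM2l.
Qed.

End Telescopes.

Section Nuclear.
Variable R : realType.
Implicit Types U V W : hilbertType R.

(** The series need only converge strongly; blocks of finite rank operators, rather
    than single rank one operators, avoid reindexing sums and products. *)
Definition nuclear_rep V W (T : bop V W) (L : nat -> seq (V * W)) (B : R) :=
  (forall N, \sum_(n < N) weight (L n) <= B) /\
  (forall x, cvs (fun N => \sum_(n < N) frop (L n) x) (T x)).

Definition nuclear V W (T : bop V W) (B : R) := exists L, nuclear_rep T L B.

(** The remainders tend to zero: a nonincreasing summable sequence is O(1/n). *)
Lemma telescopes_nuclear V W (T : bop V W) m c (B : R) : telescopes T m c ->
  (forall N, \sum_(n < N) c n <= B) -> nuclear T (m%:R * B).
Proof.
move=> [c0 ci [Q [L [Q0 Qc QL Lc]]]] cB; exists L; split=> [N|x].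
  apply: le_trans (_ : m%:R * \sum_(n < N) c n <= _); last by rewrite ler_wpM2l.
  by rewrite mulr_sumr; apply: ler_sum => n _.
have cN N : c N <= B * N.+1%:R^-1.
  rewrite ler_pdivlMr ?ltr0Sn// (le_trans _ (cB N.+1))//.
  have ch k : (k <= N)%N -> c N <= c k.
    by move: k N; exact: (nonincreasing_seqP c).1.
  have -> : c N * N.+1%:R = \sum_(n < N.+1) c N by rewrite sumr_const card_ord mulr_natr.
  by apply: ler_sum => n _; rewrite ch// -ltnS.
have E N : T x - \sum_(n < N) frop (L n) x = Q N x.
  elim: N => [|N IHN]; first by rewrite big_ord0 subr0 Q0.
  by rewrite big_ord_recr /= opprD addrA IHN QL /= addrK.
apply: (@cvs_le _ _ _ _ (fun N => B * rnorm x * N.+1%:R^-1)).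
  by move=> N; rewrite rnormBC E mulrAC (le_trans (Qc _ _))// ler_wpM2r ?rnorm_ge0.
by rewrite -[X in _ --> X](mulr0 (B * rnorm x)); apply: cvgMr; exact: cvg_harmonic.
Qed.

Lemma summable_cvg (a : nat -> R[i]) (w : nat -> R) (B : R) :
  (forall n, rnorm (a n) <= w n) -> (forall N, \sum_(n < N) w n <= B) ->
  exists2 z, cvs (fun N => \sum_(n < N) a n) z & rnorm z <= B.
Proof.
move=> aw wB; have w0 n : 0 <= w n := le_trans (rnorm_ge0 _) (aw n).
suff [z za] : exists z, cvs (fun N => \sum_(n < N) a n) z.
  exists z => //; apply: (cvs_bound za) => N.
  by rewrite (le_trans (rnorm_sum _ _ _))// (le_trans _ (wB N))// ler_sum.
apply: complex_complete => e e0; have [N NP] := summable_tail w0 wB e0.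
exists N; apply: (cauchy_le (u := fun n => \sum_(k < n) a k)) => m n Nm mn.
rewrite sub_partial_sums//; apply: le_lt_trans (NP m n Nm mn).
by rewrite (le_trans (rnorm_sum _ _ _))// ler_sum.
Qed.

Lemma cvs_tail (a : nat -> R[i]) (w : nat -> R) (N : nat) (e : R) z :
  (forall n, rnorm (a n) <= w n) ->
  (forall M, (N <= M)%N -> \sum_(N <= n < M) w n <= e) ->
  cvs (fun M => \sum_(n < M) a n) z -> rnorm (z - \sum_(n < N) a n) <= e.
Proof.
move=> aw we /cvsP za; apply/ler_addgt0Pr => d /za [M ZM].
have := ZM (maxn N M) (leq_maxr _ _).
rewrite -!(big_mkord xpredT) (@big_cat_nat _ _ _ N 0%N)//= ?leq_maxl//.
set s := \sum_(0 <= i < N) a i; set s' := \sum_(N <= i < _) a i => ZM'.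
rewrite (_ : z - s = s' - (s + s' - z)); last by ring.
apply: le_trans (rnormB _ _) _; rewrite lerD// ?(ltW ZM')//.
by rewrite (le_trans (rnorm_sum _ _ _))// (le_trans _ (we _ (leq_maxl N M)))// ler_sum.
Qed.

(** Dominated convergence for series, which exchanges the sum over an orthonormal
    basis with the sum over a nuclear representation. *)
Lemma tannery (a : nat -> nat -> R[i]) b (w : nat -> R) (B : R) (A : nat -> R[i]) z :
  (forall K n, rnorm (a K n) <= w n) -> (forall N, \sum_(n < N) w n <= B) ->
  (forall n, cvs (a ^~ n) (b n)) -> (forall K, cvs (fun N => \sum_(n < N) a K n) (A K)) ->
  cvs (fun N => \sum_(n < N) b n) z -> cvs A z.
Proof.
move=> aw wB ab aA bz; apply/cvsP => e e0.
have w0 n : 0 <= w n := le_trans (rnorm_ge0 _) (aw 0%N n).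
have bw n : rnorm (b n) <= w n by apply: (cvs_bound (ab n)) => K.
have e40 : 0 < e / 4 by rewrite divr_gt0.
have [N NP] := summable_tail w0 wB e40.
have tail M : (N <= M)%N -> \sum_(N <= n < M) w n <= e / 4.
  by move=> NM; rewrite ltW// NP.
have [K0 KP] : exists K0, forall K, (K0 <= K)%N ->
    rnorm (\sum_(n < N) a K n - \sum_(n < N) b n) < e / 4.
  by move: (e / 4) e40; apply/cvsP; apply: cvs_sum => i; exact: ab.
exists K0 => K /KP KK.
have A1 := cvs_tail (aw K) tail (aA K); have A2 := cvs_tail bw tail bz.
have T1 := rnorm_triB (\sum_(n < N) a K n) (A K) z.
have T2 := rnorm_triB (\sum_(n < N) b n) (\sum_(n < N) a K n) z.
rewrite rnormBC in A2; lra.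
Qed.

Lemma nuclear_trace V (T : bop V V) L B e z : orthosys e -> total e ->
  nuclear_rep T L B -> cvs (fun N => \sum_(n < N) rep_trace (L n)) z ->
  cvs (fun K => \sum_(k < K) inner (T (e k)) (e k)) z.
Proof.
move=> eo et [LB LT] Lz.
pose a K n := \sum_(p <- L n) inner (expand e K p.2) p.1.
have aE K n : a K n = \sum_(k < K) inner (frop (L n) (e k)) (e k).
  under eq_bigr do rewrite fropE inner_suml; rewrite exchange_big /=; apply: eq_bigr => p _.
  by rewrite inner_suml; apply: eq_bigr => k _; rewrite !innerZl mulrC.
apply: (@tannery a (fun n => rep_trace (L n)) (fun n => weight (L n)) B) => // [K n|n|K].
- apply: le_trans (rnorm_sum _ _ _) _; apply: ler_sum => p _.
  apply: le_trans (cauchy_schwarz _ _) _; rewrite mulrC ler_wpM2l ?rnorm_ge0//.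
  exact: expand_le.
- by apply: cvs_sum => p; apply: cvs_innerl; exact: total_expand_cvg.
- under eq_fun do under eq_bigr do rewrite aE.
  under eq_fun do rewrite exchange_big /=.
  apply: cvs_sum => k; under eq_fun do rewrite -inner_suml.
  exact: cvs_innerl.
Qed.

Lemma orthobasis_system V D (e : nat -> V) : orthonormal_basis D e ->
  let e' n := if n \in D then e n else 0 in orthosys e' /\ total e'.
Proof.
move=> [eo et] e'; split=> [|x xo].
  by apply: (@orthosys_restrict _ _ (fun n => n \in D)) => m n mD nD; exact: eo.
by apply: et => n nD; have := xo n; rewrite /e' nD.
Qed.

(** The trace of the representation does not depend on the basis, and the trace of
    T along a basis does not depend on the representation. *)
Lemma op_traceE V (T : bop V V) L B z : nuclear_rep T L B ->
  cvs (fun N => \sum_(n < N) rep_trace (L n)) z -> op_trace T = z.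
Proof.
move=> TL Lz; rewrite /op_trace; set A := (X in xget 0 X).
have sumE D (e : nat -> V) N : \sum_(0 <= n < N | n \in D) inner (T (e n)) (e n) =
    \sum_(n < N) inner (T (if (n : nat) \in D then e n else 0)) (if (n : nat) \in D then e n else 0).
  rewrite big_mkord big_mkcond /=; apply: eq_bigr => k _.
  by case: ifP => //; rewrite inner0r.
have Az : A z.
  move=> D e /orthobasis_system [eo et].
  under eq_fun do rewrite sumE.
  exact: nuclear_trace eo et TL Lz.
have [e eo et] := orthobasis_exists V.
have eB : orthonormal_basis [set n | e n != 0] e.
  split=> [m n _|x xo]; first by rewrite inE eo => ->; rewrite andbT.
  apply: et => n; have [->|en] := eqVneq (e n) 0; first exact: inner0r.
  by apply: xo; rewrite inE.
have Ax : A (xget 0 A) by apply: (xgetPex 0); exists z.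
exact: cvs_unique (Ax _ _ eB) (Az _ _ eB).
Qed.

Lemma nuclear_op_trace V (T : bop V V) L B : nuclear_rep T L B ->
  cvs (fun N => \sum_(n < N) rep_trace (L n)) (op_trace T) /\ rnorm (op_trace T) <= B.
Proof.
move=> TL; have [z Lz zB] := summable_cvg (fun n => rep_trace_le (L n)) TL.1.
by rewrite (op_traceE TL Lz).
Qed.

Lemma op_trace_le V (T : bop V V) B : nuclear T B -> rnorm (op_trace T) <= B.
Proof. by case=> L /nuclear_op_trace []. Qed.

Lemma nuclear_repD V W (S T : bop V W) L L' B B' :
  nuclear_rep S L B -> nuclear_rep T L' B' ->
  nuclear_rep (S + T) (fun n => L n ++ L' n) (B + B').
Proof.
move=> [LB LS] [LB' LT]; split=> [N|x].
  by under eq_bigr do rewrite weight_cat; rewrite big_split lerD.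
under eq_fun do under eq_bigr do rewrite frop_cat /=.
by under eq_fun do rewrite big_split /=; exact: cvsD.
Qed.

Lemma nuclearD V W (S T : bop V W) B B' :
  nuclear S B -> nuclear T B' -> nuclear (S + T) (B + B').
Proof. by move=> [L LS] [L' LT]; eexists; exact: nuclear_repD LS LT. Qed.

Lemma op_traceD V (S T : bop V V) B B' : nuclear S B -> nuclear T B' ->
  op_trace (S + T) = op_trace S + op_trace T.
Proof.
move=> [L LS] [L' LT]; apply: (op_traceE (nuclear_repD LS LT)).
under eq_fun do under eq_bigr do rewrite rep_trace_cat.
under eq_fun do rewrite big_split /=.
by apply: cvsD; [case: (nuclear_op_trace LS)|case: (nuclear_op_trace LT)].
Qed.

Lemma nuclear_rep_lmap U V W (S : bop V W) (T : bop U V) L B (M : R) : 0 <= M ->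
  (forall x, rnorm (S x) <= M * rnorm x) ->
  nuclear_rep T L B -> nuclear_rep (bopM S T) (fun n => lmap_rep S (L n)) (M * B).
Proof.
move=> M0 SM [LB LT]; split=> [N|x].
  apply: le_trans (_ : M * \sum_(n < N) weight (L n) <= _); last by rewrite ler_wpM2l.
  by rewrite mulr_sumr; apply: ler_sum => n _; exact: weight_lmap.
under eq_fun do under eq_bigr do rewrite frop_lmap /=.
under eq_fun do rewrite -linear_sum.
exact: cvs_bop.
Qed.

Lemma nuclear_rep_rmap U V W (T : bop V W) (S : bop U V) L B (M : R) : 0 <= M ->
  (forall x, rnorm (S x) <= M * rnorm x) ->
  nuclear_rep T L B -> nuclear_rep (bopM T S) (fun n => rmap_rep S (L n)) (M * B).
Proof.
move=> M0 SM [LB LT]; split=> [N|x].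
  apply: le_trans (_ : M * \sum_(n < N) weight (L n) <= _); last by rewrite ler_wpM2l.
  by rewrite mulr_sumr; apply: ler_sum => n _; exact: weight_rmap.
by under eq_fun do under eq_bigr do rewrite frop_rmap /=; exact: LT.
Qed.

Lemma nuclear_lmap U V W (S : bop V W) (T : bop U V) B :
  nuclear T B -> exists B', nuclear (bopM S T) B'.
Proof.
move=> [L LT]; have [M [M0 SM]] := bop_bnd S.
by exists (M * B); eexists; exact: nuclear_rep_lmap SM LT.
Qed.

Lemma nuclear_rmap U V W (T : bop V W) (S : bop U V) B :
  nuclear T B -> exists B', nuclear (bopM T S) B'.
Proof.
move=> [L LT]; have [M [M0 SM]] := bop_bnd S.
by exists (M * B); eexists; exact: nuclear_rep_rmap SM LT.
Qed.

(** Composing a nuclear representation of T with S on the left or on the right gives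
    two representations with term by term equal traces. *)
Lemma op_trace_cyclic V W (T : bop V W) (S : bop W V) B : nuclear T B ->
  op_trace (bopM S T) = op_trace (bopM T S).
Proof.
move=> [L LT]; have [M [M0 SM]] := bop_bnd S.
apply: (op_traceE (nuclear_rep_lmap M0 SM LT)).
have [H _] := nuclear_op_trace (nuclear_rep_rmap M0 SM LT).
rewrite (_ : (fun N => _) = fun N => \sum_(n < N) rep_trace (rmap_rep S (L n)))//.
apply/funext => N; apply: eq_bigr => n _; rewrite /rep_trace !big_map.
by apply: eq_bigr => p _ /=; rewrite adjP.
Qed.

Lemma op_traceZ V (T : bop V V) B (z : R[i]) : nuclear T B ->
  op_trace (z *: T) = z * op_trace T.
Proof.
move=> [L LT]; have zM x : rnorm ((z *: bop1 V) x) <= rnorm z * rnorm x by rewrite /= rnormZ.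
have := nuclear_rep_lmap (rnorm_ge0 z) zM LT.
have -> : bopM (z *: bop1 V) T = z *: T by exact/bopP.
move=> H; apply: (op_traceE H).
have [H' _] := nuclear_op_trace LT; have := cvsM z H'.
rewrite (_ : (fun N => _ * _) = fun N => \sum_(n < N) rep_trace (lmap_rep (z *: bop1 V) (L n)))//.
apply/funext => N; rewrite mulr_sumr; apply: eq_bigr => n _; rewrite /rep_trace big_map mulr_sumr.
by apply: eq_bigr => p _ /=; rewrite innerZl.
Qed.

End Nuclear.

(** * A multiplicative gauge for Schatten operators *)

Section EndomorphismRing.
Variables (R : realType) (V : hilbertType R).
Implicit Types S T U : bop V V.

Fact bop_mulA : associative (@bopM R V V V).
Proof. by move=> S T U; exact/bopP. Qed.
Fact bop_mul1l : left_id (bop1 V) (@bopM R V V V).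
Proof. by move=> S; exact/bopP. Qed.
Fact bop_mul1r : right_id (bop1 V) (@bopM R V V V).
Proof. by move=> S; exact/bopP. Qed.
Fact bop_mulDl : left_distributive (@bopM R V V V) +%R.
Proof. by move=> S T U; exact/bopP. Qed.
Fact bop_mulDr : right_distributive (@bopM R V V V) +%R.
Proof. by move=> S T U; apply/bopP => x /=; rewrite linearD. Qed.
HB.instance Definition _ := GRing.Zmodule_isPzRing.Build (bop V V)
  bop_mulA bop_mul1l bop_mul1r bop_mulDl bop_mulDr.

Lemma bop_mulE S T x : (S * T) x = S (T x). Proof. by []. Qed.
End EndomorphismRing.

Section Gauge.
Variables (R : realType) (p : nat).
Hypothesis p_gt0 : (0 < p)%N.
Implicit Types U V W : hilbertType R.
Implicit Types s c : nat -> R.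

Definition unit_seq s :=
  [/\ forall n, 0 <= s n, forall n, s n.+1 <= s n &
      forall N, \sum_(n < N) s n ^+ p <= 1].

(** A gauge (m, q) of size g presents T as if it were a product of q operators with
    p-summable singular values: the remainders of T decrease like g times a product
    of q sequences in the unit ball of l^p. Gauges multiply, q being additive; q = 0
    is a plain norm bound, q = 1 a Schatten class bound, and q >= p makes T nuclear. *)
Definition gauge V W (m q : nat) (T : bop V W) (g : R) :=
  exists ss : nat -> nat -> R, [/\ 0 < g, forall i, unit_seq (ss i) &
    telescopes T m (fun n => g * \prod_(i < q) ss i n)].

Lemma unit_seq0 : unit_seq (fun=> 0).
Proof.
split=> // N; rewrite big1 ?ler01// => i _; rewrite expr0n.
by case: eqP p_gt0 => // ->.
Qed.

Lemma unit_seq_le1 s n : unit_seq s -> s n <= 1.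
Proof.
move=> [s0 _ s1]; rewrite -(@ler_pXn2r _ p)// ?nnegrE// expr1n.
apply: le_trans (s1 n.+1); rewrite big_ord_recr /= lerDr.
by apply: sumr_ge0 => i _; rewrite exprn_ge0.
Qed.

Lemma prod_unit_ge0 ss q n : (forall i : nat, unit_seq (ss i)) ->
  0 <= \prod_(i < q) ss i n.
Proof. by move=> us; apply: prodr_ge0 => i _; case: (us i). Qed.

Lemma prod_unit_le1 ss q n : (forall i : nat, unit_seq (ss i)) ->
  \prod_(i < q) ss i n <= 1.
Proof.
by move=> us; apply: prodr_ile1 => i _; rewrite unit_seq_le1// andbT; case: (us i).
Qed.

Lemma gauge_gt0 V W m q (T : bop V W) g : gauge m q T g -> 0 < g.
Proof. by case=> ss []. Qed.

Lemma gauge_bound V W (T : bop V W) (M : R) : 0 < M ->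
  (forall x, rnorm (T x) <= M * rnorm x) -> gauge 0 0 T M.
Proof.
move=> M0 TM; exists (fun _ _ => 0); split=> // [_|]; first exact: unit_seq0.
apply: telescopes_cst => [|x]; rewrite big_ord0 mulr1; [exact: ltW|exact: TM].
Qed.

Lemma gauge_mul U V W m q m' q' (S : bop V W) (T : bop U V) g g' :
  gauge m q S g -> gauge m' q' T g' -> gauge (m + m') (q + q') (bopM S T) (g * g').
Proof.
move=> [ss [g0 us tS]] [ss' [g'0 us' tT]].
pose tt i := if (i < q)%N then ss i else ss' (i - q)%N.
exists tt; split=> [|i|]; first exact: mulr_gt0.
  by rewrite /tt; case: ifP.
have -> : (fun n => g * g' * \prod_(i < q + q') tt i n) =
    (fun n => (g * \prod_(i < q) ss i n) * (g' * \prod_(i < q') ss' i n)).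
  apply/funext => n; rewrite big_split_ord /= mulrACA; congr (_ * _ * (_ * _)).
    by apply: eq_bigr => i _; rewrite /tt /= ltn_ord.
  by apply: eq_bigr => i _; rewrite /tt /= ltnNge leq_addr /= addKn.
exact: telescopes_mul.
Qed.

Lemma prod_le_sum_pow n (a : nat -> R) : (0 < n)%N -> (forall i, 0 <= a i) ->
  \prod_(i < n) a i <= \sum_(i < n) a i ^+ n.
Proof.
move=> n0 a0; have [j jP] : exists j : 'I_n, forall i : 'I_n, a i <= a j.
  by case: n n0 => // n _; exists [arg max_(j > ord0) a j]%O; case: arg_maxP => // j _ H i; exact: H.
apply: le_trans (_ : a j ^+ n <= _).
  have -> : a j ^+ n = \prod_(i < n) a j by rewrite prodr_const card_ord.
  apply: ler_prod => i _.
  by rewrite a0 jP.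
by rewrite (bigD1 j)//= lerDl sumr_ge0// => i _; rewrite exprn_ge0.
Qed.

(** The product of p sequences is at most the sum of their p-th powers, a crude form
    of the Hoelder inequality. *)
Lemma gauge_nuclear V W m q (T : bop V W) g : (p <= q)%N ->
  gauge m q T g -> nuclear T (m%:R * (g * p%:R)).
Proof.
move=> pq [ss [g0 us tT]]; apply: (telescopes_nuclear tT) => N.
rewrite -mulr_sumr ler_wpM2l ?(ltW g0)//.
apply: le_trans (_ : \sum_(n < N) \sum_(i < p) ss i n ^+ p <= _).
  apply: ler_sum => n _; apply: (@le_trans _ _ (\prod_(i < p) ss i n)); last first.
    by apply: (@prod_le_sum_pow p (fun i => ss i n)) => // i; case: (us i).
  rewrite -(subnKC pq) big_split_ord /= ler_piMr ?prod_unit_ge0//.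
  by apply: (@prod_unit_le1 (fun i => ss (p + i)%N)) => i; exact: us.
rewrite exchange_big /=; apply: le_trans (_ : \sum_(i < p) 1 <= _).
  by apply: ler_sum => i _; case: (us i) => _ _; apply.
by rewrite sumr_const card_ord.
Qed.

Lemma gauge_le V W m q (T : bop V W) g g' : g <= g' -> gauge m q T g -> gauge m q T g'.
Proof.
move=> gg' [ss [g0 us tT]]; exists ss; split=> //; first exact: lt_le_trans gg'.
apply: telescopes_le tT => n; first by rewrite ler_wpM2r// prod_unit_ge0.
rewrite ler_wpM2l ?(le_trans (ltW g0))//; apply: ler_prod => i _.
by case: (us i) => -> ->.
Qed.

Lemma gauge_widen V W m m' q (T : bop V W) g : (m <= m')%N -> gauge m q T g -> gauge m' q T g.
Proof.
move=> mm' [ss [g0 us [c0 ci [Q [L [Q0 Qc QL Lc]]]]]]; exists ss; split=> //.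
split=> //; exists Q, L; split=> // n.
by rewrite (le_trans (Lc n))// ler_wpM2r// ler_nat.
Qed.

Lemma gaugeN V W m q (T : bop V W) g : gauge m q T g -> gauge m q (- T) g.
Proof.
have H : gauge 0 0 (- bop1 W) 1 by apply: gauge_bound => // x; rewrite mul1r rnormN.
move=> /(gauge_mul H); rewrite mul1r.
by have -> : bopM (- bop1 W) T = - T by exact/bopP.
Qed.

(** ((a+b)/2)^p <= a^p + b^p, hence the factor 2. The multiplicity m grows under
    sums, which is why it is part of the gauge. *)
Lemma gauge1_add V W m m' (S T : bop V W) g g' :
  gauge m 1 S g -> gauge m' 1 T g' -> gauge (m + m') 1 (S + T) (2 * (g + g')).
Proof.
move=> [ss [g0 us tS]] [ss' [g'0 us' tT]].
pose a n := g * ss 0%N n; pose b n := g' * ss' 0%N n.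
have gg0 : 0 < g + g' by rewrite addr_gt0.
have [s0 sd s1] := us 0%N; have [s'0 s'd s'1] := us' 0%N.
have a0 n : 0 <= a n by rewrite mulr_ge0 ?(ltW g0).
have b0 n : 0 <= b n by rewrite mulr_ge0 ?(ltW g'0).
pose u n := (a n + b n) / (2 * (g + g')).
have g2 : 0 < 2 * (g + g') by rewrite mulr_gt0.
exists (fun=> u); split=> // [_|]; last first.
  have -> : (fun n => 2 * (g + g') * \prod_(i < 1) u n) =
     (fun n => g * (\prod_(i < 1) ss i n) + g' * (\prod_(i < 1) ss' i n)).
    by apply/funext => n; rewrite !big_ord1 /u mulrC divfK// gt_eqF.
  exact: telescopes_add.
split=> [n|n|N].
- by rewrite divr_ge0 ?addr_ge0 ?(ltW g2).
- by rewrite ler_pM2r ?invr_gt0// lerD// ler_pM2l.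
have gp0 : 0 < (g + g') ^+ p by rewrite exprn_gt0.
apply: le_trans (_ : \sum_(n < N) (a n ^+ p + b n ^+ p) / (g + g') ^+ p <= _).
  apply: ler_sum => n _; rewrite /u exprMn exprVn exprMn invfM mulrA.
  rewrite ler_pM2r ?invr_gt0// ler_pdivrMr ?exprn_gt0//.
  move: (a n) (b n) (a0 n) (b0 n) => x y x0 y0.
  wlog xy : x y x0 y0 / x <= y => [hw|].
    by case/orP: (le_total x y) => h; [|rewrite addrC [in leRHS]addrC]; apply: hw.
  apply: le_trans (_ : (y *+ 2) ^+ p <= _).
    by rewrite ler_pXn2r ?nnegrE ?mulrn_wge0 ?addr_ge0// mulr2n lerD2r.
  by rewrite -mulr_natr exprMn ler_wpM2r ?exprn_ge0// lerDr exprn_ge0.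
rewrite -mulr_suml ler_pdivrMr// mul1r big_split /=.
apply: le_trans (_ : g ^+ p + g' ^+ p <= _).
  have scaled (h : R) (z : nat -> R) : 0 < h -> (forall N, \sum_(n < N) z n ^+ p <= 1) ->
      \sum_(n < N) (h * z n) ^+ p <= h ^+ p.
    move=> h0 z1; under eq_bigr do rewrite exprMn.
    rewrite -mulr_sumr; apply: ler_piMr (z1 N); exact/exprn_ge0/ltW.
  by rewrite lerD ?scaled.
case: p p_gt0 => // k _; rewrite !exprS [leRHS]mulrDl lerD// ler_wpM2l ?(ltW g0) ?(ltW g'0)//.
  by rewrite lerXn2r ?nnegrE ?(ltW g0) ?(ltW gg0)// lerDl ltW.
by rewrite lerXn2r ?nnegrE ?(ltW g'0) ?(ltW gg0)// lerDr ltW.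
Qed.

Lemma gauge1_sub V W m m' (S T : bop V W) g g' :
  gauge m 1 S g -> gauge m' 1 T g' -> gauge (m + m') 1 (S - T) (2 * (g + g')).
Proof. by move=> gS /gaugeN; exact: gauge1_add. Qed.

Lemma gauge_prod V n (T : nat -> bop V V) (m q : nat -> nat) (g : nat -> R) :
  (forall i, (i < n)%N -> gauge (m i) (q i) (T i) (g i)) ->
  gauge (\sum_(i < n) m i) (\sum_(i < n) q i) (\prod_(i < n) T i) (\prod_(i < n) g i).
Proof.
elim: n => [|n IHn] gT.
  rewrite !big_ord0; apply: gauge_bound => // x; by rewrite mul1r.
rewrite !big_ord_recr /=; apply: gauge_mul; last exact: gT.
by apply: IHn => i ni; apply: gT; rewrite ltnS ltnW.
Qed.

Lemma telescopes_gauge V W (T : bop V W) s (r : R) : 0 < r ->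
  telescopes T 1 s -> (forall N, \sum_(n < N) s n ^+ p <= r ^+ p) -> gauge 1 1 T r.
Proof.
move=> r0 tT sr; have [s0 sd _] := tT.
exists (fun _ n => s n / r); split=> // [_|]; last first.
  have -> : (fun n => r * \prod_(i < 1) (s n / r)) = s; last by [].
  by apply/funext => n; rewrite big_ord1 mulrC divfK// gt_eqF.
split=> [n|n|N]; first by rewrite divr_ge0// ltW.
  by rewrite ler_pM2r ?invr_gt0.
under eq_bigr do rewrite exprMn exprVn.
by rewrite -mulr_suml ler_pdivrMr ?exprn_gt0// mul1r.
Qed.

End Gauge.

(** * Singular values of compact operators *)

Lemma seq_recursion (T : Type) (step : seq T -> T) :
  exists f : nat -> T, forall n, f n = step (mkseq f n).
Proof.
pose stage := fix stage n := if n is m.+1 then rcons (stage m) (step (stage m)) else [::].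
exists (fun n => step (stage n)) => n; congr step.
by elim: n => // n IHn; rewrite mkseqS -IHn.
Qed.

Section CompactOperators.
Variables (R : realType) (V W : hilbertType R).
Implicit Types S T : bop V W.

Lemma compact_opB S T : compact_op S -> compact_op T -> compact_op (S - T).
Proof.
rewrite /compact_op !precompactE => cS cT.
pose f (p : W * W) := p.1 - p.2.
have cf : continuous f by move=> p; apply: cvgB; [exact: cvg_fst|exact: cvg_snd].
have cK : compact (f @` (closure (S @` [set x | rnorm x <= 1]) `*`
    closure (T @` [set x | rnorm x <= 1]))).
  apply: continuous_compact; last exact: compact_setX.
  exact: continuous_subspaceT.
rewrite -precompactE; apply: precompact_subset (compact_precompact (@norm_hausdorff _ _) cK).
move=> _ [x x1 <-]; exists (S x, T x) => //=.
by split=> /=; apply: subset_closure; exists x.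
Qed.

Lemma compact_op_cluster T (x : nat -> V) : compact_op T -> (forall k, rnorm (x k) <= 1) ->
  exists y, forall (e : R) N, 0 < e -> exists2 k, (N <= k)%N & rnorm (T (x k) - y) < e.
Proof.
rewrite /compact_op precompactE => cT x1.
have [|y [_ Fy]] := cT ((T (x k)) @[k --> \oo]) _.
  by exists 0%N => // k _; apply: subset_closure; exists (x k) => //; exact: x1.
exists y => e N e0.
have [||z [[k /= Nk <-] ke]] := Fy [set T (x k) | k in [set k | (N <= k)%N]] [set z | rnorm (z - y) < e].
- by exists N => // k /= Nk; exists k.
- by apply/nbhs_rnormP; exists e.
- by exists k.
Qed.

End CompactOperators.

Section SingularValues.
Variables (R : realType) (V W : hilbertType R) (T : bop V W).

Let A : bop V V := bopM (adj T) T.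

Let AE x y : inner (A x) y = inner (T x) (T y).
Proof. by rewrite /= adjPl. Qed.

Let Asym x y : inner (A x) y = inner x (A y).
Proof. by rewrite AE innerC -AE -innerC. Qed.

(** The number s is the maximum of |T x| over the unit vectors x orthogonal to l, and
    v attains it; when s = 0 the vector v is 0. *)
Definition maximizer (l : seq V) (sv : R * V) :=
  [/\ 0 <= sv.1,
      forall x, {in l, forall w, inner x w = 0} -> rnorm (T x) <= sv.1 * rnorm x,
      A sv.2 = (sv.1 ^+ 2)%:C%C *: sv.2 /\ rnorm (T sv.2) = sv.1,
      {in l, forall w, inner sv.2 w = 0} &
      rnorm sv.2 = (sv.1 != 0)%:R].

Lemma cvs_rnorm (U : normedZmodType R[i]) (u : nat -> U) l (r : R) (d : nat -> R) :
  cvs u l -> (forall n, `|rnorm (u n) - r| <= d n) -> d n @[n --> \oo] --> (0 : R) ->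
  rnorm l = r.
Proof.
move=> ul ud d0; apply/eqP; rewrite -subr_eq0 -normr_le0.
apply/ler_addgt0Pr => e e0; rewrite add0r.
have e20 : 0 < e / 2 by rewrite divr_gt0.
have [N /(_ (maxn N _) (leq_maxl _ _)) H] := (cvsP u l).1 ul _ e20.
have dn0 n : 0 <= d n := le_trans (normr_ge0 _) (ud n).
have [M /(_ (maxn _ M) (leq_maxr _ _)) K] := (cvg0P dn0).1 d0 _ e20.
have {}H := H M; have {}K := K N; set n := maxn N M in H K.
rewrite -(subrKA (rnorm (u n))) (le_trans (ler_normD _ _))// [leRHS]splitr lerD//.
  apply: le_trans (ltW H); rewrite ler_norml; apply/andP; split.
    by rewrite lerNl opprB lerBlDr -lerBlDl lerBlDl -lerBlDr; have := rnorm_triB l (u n) 0; rewrite !subr0; lra.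
  by have := rnorm_triB (u n) l 0; rewrite !subr0 rnormBC; lra.
exact: le_trans (ud n) (ltW K).
Qed.

(** Rayleigh quotients: a maximizing sequence u_j of unit vectors is an approximate
    eigenvector, |A u_j - s^2 u_j| -> 0 for A = T^* T, and by compactness T u_j, hence
    A u_j and then u_j, converges along a subsequence. The orthogonal of l is stable
    under A because l consists of eigenvectors. *)
Lemma maximizer_exists (l : seq V) : compact_op T ->
  {in l, forall w, exists c : R[i], A w = c *: w} -> exists sv, maximizer l sv.
Proof.
move=> cT lA; pose orth x := {in l, forall w, inner x w = 0}.
pose E := [set r : R | exists x, [/\ rnorm x <= 1, orth x & rnorm (T x) = r]].
have [M [M0 TM]] := bop_bnd T.
have E0 : E 0 by exists 0; split; rewrite ?rnorm0 ?linear0 ?rnorm0// => w _; rewrite inner0l.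
have supE : has_sup E.
  split; first by exists 0.
  exists M => _ [x [x1 _ <-]]; apply: le_trans (TM x) _.
  by rewrite -[leRHS]mulr1 ler_wpM2l.
pose s := sup E.
have s0 : 0 <= s by apply: ub_le_sup => //; case: supE.
have sT x : orth x -> rnorm (T x) <= s * rnorm x.
  move=> xo; have [->|x0] := eqVneq x 0; first by rewrite linear0 !rnorm0 mulr0.
  have nx : 0 < rnorm x by rewrite lt_def rnorm_eq0 x0 rnorm_ge0.
  rewrite -ler_pdivrMr//; apply: ub_le_sup; first by case: supE.
  exists ((rnorm x)^-1%:C%C *: x); split.
  - by rewrite rnormZ rnormR ger0_norm ?invr_ge0 ?rnorm_ge0// mulVf// gt_eqF.
  - by move=> w wl; rewrite innerZl xo ?mulr0.
  - by rewrite linearZ /= rnormZ rnormR ger0_norm ?invr_ge0 ?rnorm_ge0// mulrC.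
have [s_eq0|s_neq0] := eqVneq s 0.
  exists (0, 0); split=> //=; [by rewrite -s_eq0| |by move=> w _; rewrite inner0l|by rewrite rnorm0 eqxx].
  by rewrite !linear0 rnorm0.
have {s_neq0}sp : 0 < s by rewrite lt_def s_neq0.
have xk (k : nat) : exists x, [/\ rnorm x <= 1, orth x & s - k.+1%:R^-1 < rnorm (T x)].
  have k0 : 0 < k.+1%:R^-1 :> R by rewrite invr_gt0.
  by have [_ [x [x1 xo <-]] xk] := sup_adherent k0 supE; exists x.
have {xk} [x xP] := choice xk.
have [y yP] := compact_op_cluster cT (fun k => let: And3 x1 _ _ := xP k in x1).
have fk (j : nat) : exists k, (j <= k)%N /\ rnorm (T (x k) - y) < j.+1%:R^-1.
  by have [|k jk ky] := yP (j.+1%:R^-1) j; [rewrite invr_gt0|exists k].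
have {fk} [f fP] := choice fk.
pose u j := x (f j).
have u1 j : rnorm (u j) <= 1 by case: (xP (f j)).
have uo j : orth (u j) by case: (xP (f j)).
have us j : s - j.+1%:R^-1 <= rnorm (T (u j)).
  have [_ _ /ltW] := xP (f j); apply: le_trans; rewrite lerD2l lerN2.
  by rewrite lef_pV2 ?posrE// ler_nat ltnS; case: (fP j).
have uT j : rnorm (T (u j)) <= s.
  by rewrite (le_trans (sT _ (uo j)))// ler_piMr.
have Tuy : cvs (fun j => T (u j)) y.
  apply: (@cvs_le _ _ _ _ (fun j => j.+1%:R^-1)); last exact: cvg_harmonic.
  by move=> j; case: (fP j) => _ /ltW.
have Ao z : orth z -> orth (A z).
  by move=> zo w wl; have [c cE] := lA w wl; rewrite Asym cE innerZr zo ?mulr0.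
have As z : orth z -> rnorm (A z) <= s * rnorm (T z).
  move=> zo; have [z0|Az0] := eqVneq (A z) 0.
    by rewrite z0 rnorm0 mulr_ge0 ?rnorm_ge0.
  have nA : 0 < rnorm (A z) by rewrite lt_def rnorm_eq0 Az0 rnorm_ge0.
  rewrite -(ler_pM2r nA) -expr2 -Re_inner_sq AE.
  apply: le_trans (ler_norm _) _; apply: le_trans (ler_Re_rnorm _) _.
  apply: le_trans (cauchy_schwarz _ _) _.
  by rewrite mulrAC mulrC ler_wpM2r ?rnorm_ge0// sT//; exact: Ao.
(* |A u - s^2 u|^2 = |A u|^2 + s^4 |u|^2 - 2 s^2 |T u|^2, where |A u| <= s |T u| *)
have defect j : rnorm (A (u j) - (s ^+ 2)%:C%C *: u j) ^+ 2 <= 2 * s ^+ 3 * j.+1%:R^-1.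
  rewrite rnorm_sqBZ conjCR ReMr rnormR AE Re_inner_sq ger0_norm ?sqr_ge0//.
  have A1 : rnorm (A (u j)) ^+ 2 <= s ^+ 2 * rnorm (T (u j)) ^+ 2.
    by rewrite -exprMn lerXn2r ?nnegrE ?rnorm_ge0 ?mulr_ge0 ?rnorm_ge0// As.
  have A2 : (s ^+ 2) ^+ 2 * rnorm (u j) ^+ 2 <= (s ^+ 2) ^+ 2.
    by rewrite ler_piMr ?sqr_ge0// expr_le1 ?rnorm_ge0.
  have A3 : s ^+ 2 - rnorm (T (u j)) ^+ 2 <= 2 * s * j.+1%:R^-1.
    rewrite subr_sqr mulrC ler_pM ?subr_ge0 ?addr_ge0 ?rnorm_ge0//.
      by rewrite mulr_natl mulr2n lerD2l.
    by rewrite lerBlDr -lerBlDl.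
  have -> : 2 * s ^+ 3 * j.+1%:R^-1 = s ^+ 2 * (2 * s * j.+1%:R^-1) by ring.
  have A4 := ler_wpM2l (sqr_ge0 s) A3.
  apply: le_trans A4. lra.
pose v := ((s ^+ 2)^-1)%:C%C *: adj T y.
have uv : cvs u v.
  have Au : cvs (fun j => A (u j)) (adj T y) by exact: cvs_bop Tuy.
  have D0 : cvs (fun j => A (u j) - (s ^+ 2)%:C%C *: u j) 0.
    apply/cvsP => e e0.
    have c0 : 0 < 2 * s ^+ 3 + 1 by rewrite addr_gt0// mulr_gt0// exprn_gt0.
    have harm0 n : 0 <= n.+1%:R^-1 :> R by rewrite invr_ge0.
    have [N NP] := (cvg0P harm0).1 (@cvg_harmonic R) (e ^+ 2 / (2 * s ^+ 3 + 1)) (divr_gt0 (exprn_gt0 _ e0) c0).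
    exists N => n /NP; rewrite ltr_pdivlMr// => H.
    rewrite subr0 -(@ltr_pXn2r _ 2)// ?nnegrE ?rnorm_ge0 ?(ltW e0)//.
    apply: le_lt_trans (defect n) _; apply: le_lt_trans H.
    by rewrite mulrC ler_wpM2l// lerDl.
  have := cvsB Au D0; under eq_fun do rewrite opprB addrC subrK.
  rewrite subr0 => H.
  have := @cvs_bop _ _ _ (((s ^+ 2)^-1)%:C%C *: bop1 V) _ _ H.
  rewrite /= -/v; congr (cvs _ v); apply/funext => j.
  by rewrite scalerA -rmorphM /= mulVf ?scale1r// gt_eqF// exprn_gt0.
have Tv : T v = y by apply: cvs_unique (cvs_bop T uv) Tuy.
have nTv : rnorm (T v) = s.
  apply: (cvs_rnorm (cvs_bop T uv)) (@cvg_harmonic R) => n /=.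
  have := uT n; rewrite -subr_le0 => /ler0_norm ->.
  by rewrite opprB lerBlDr -lerBlDl; exact: us.
have vo : orth v.
  move=> w wl; apply: cvs_unique (cvs_innerl w uv) _.
  by under eq_fun do rewrite uo//; exact: cvs_cst.
have v1 : rnorm v <= 1 by exact: cvs_bound uv u1.
exists (s, v); split=> //=.
  split=> //; rewrite Tv /v scalerA -rmorphM /= mulfV ?scale1r// gt_eqF// exprn_gt0//.
rewrite (gt_eqF sp); apply/eqP; rewrite eq_le v1 /=.
by have := sT v vo; rewrite nTv -{1}[s]mulr1 ler_pM2l.
Qed.

(** The maximizers are chosen greedily. The values tend to 0, since otherwise the
    images T e_n would be uniformly separated, against compactness. *)
Lemma singular_values_exist : compact_op T -> exists s, singular_values T s.
Proof.
move=> cT; pose step (l : seq (R * V)) := xget (0, 0) [set sv | maximizer [seq x.2 | x <- l] sv].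
have [f fE] := seq_recursion step.
pose s n := (f n).1; pose e n := (f n).2.
have fP n : maximizer [seq x.2 | x <- mkseq f n] (f n).
  elim/ltn_ind: n => n IHn; rewrite fE; apply: (xgetPex (0, 0)).
  apply: maximizer_exists => // _ /mapP[_ /mapP[k + ->] ->].
  rewrite mem_iota => /andP[_ kn]; have [_ _ [-> _] _ _] := IHn k kn.
  by exists ((f k).1 ^+ 2)%:C%C.
have mem_e n (P : V -> Prop) : (forall k, (k < n)%N -> P (e k)) ->
    {in [seq x.2 | x <- mkseq f n], forall w, P w}.
  by move=> H _ /mapP[_ /mapP[k + ->] ->]; rewrite mem_iota => /andP[_ kn]; exact: H.
have e_mem n k : (k < n)%N -> e k \in [seq x.2 | x <- mkseq f n].
  by move=> kn; apply: map_f; apply: map_f; rewrite mem_iota.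
have s0 n : 0 <= s n by case: (fP n).
have smax n x : (forall k, (k < n)%N -> inner x (e k) = 0) -> rnorm (T x) <= s n * rnorm x.
  by move=> xo; have [_ + _ _ _] := fP n; apply; exact: mem_e.
have Ae n : A (e n) = (s n ^+ 2)%:C%C *: e n by case: (fP n) => _ _ [].
have Te n : rnorm (T (e n)) = s n by case: (fP n) => _ _ [].
have eo m n : m != n -> inner (e m) (e n) = 0.
  have H i j : (j < i)%N -> inner (e i) (e j) = 0.
    by move=> ji; have [_ _ _ + _] := fP i; apply; exact: e_mem.
  by rewrite neq_ltn => /orP[] /H // mn; rewrite innerC mn conjC0.
have e1 n : rnorm (e n) <= 1.
  by case: (fP n) => _ _ _ _; rewrite -/(e n) => ->; case: (_ != 0).
have ee n : 0 < s n -> inner (e n) (e n) = 1.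
  move=> sn; rewrite inner_sq; case: (fP n) => _ _ _ _; rewrite -/(e n) -/(s n) => ->.
  by rewrite gt_eqF// expr1n.
have sdec m n : (m <= n)%N -> s n <= s m.
  move=> mn; rewrite -Te; apply: le_trans (_ : s m * rnorm (e n) <= _); last by rewrite ler_piMr.
  by apply: smax => k km; rewrite eo// gtn_eqF// (leq_trans km).
have s_small eps : 0 < eps -> exists n, s n < eps.
  move=> eps0; apply: contrapT => H.
  have {}H n : eps <= s n by rewrite leNgt; apply/negP => sn; apply: H; exists n.
  have [y yP] := compact_op_cluster cT e1.
  have [k _ ky] := yP (eps / 2) 0%N (divr_gt0 eps0 (ltr0Sn _ _)).
  have [l kl ly] := yP (eps / 2) k.+1 (divr_gt0 eps0 (ltr0Sn _ _)).
  have kl' : rnorm (T (e k) - T (e l)) < eps.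
    apply: le_lt_trans (rnorm_triB y _ _) _.
    by rewrite [ltRHS]splitr ltrD// rnormBC.
  have := ltW kl'; rewrite leNgt => /negP; apply.
  rewrite -(@ltr_pXn2r _ 2) ?nnegrE ?rnorm_ge0 ?(ltW eps0)//.
  rewrite rnorm_sqB -AE Ae innerZl eo ?ltn_eqF// mulr0 mulr0 subr0 !Te.
  apply: lt_le_trans (_ : eps ^+ 2 + eps ^+ 2 <= _); first by rewrite ltrDl exprn_gt0.
  by rewrite lerD// lerXn2r ?nnegrE ?(ltW eps0).
exists s; split=> //; exists (adj T), e; split=> //.
- by move=> x y; rewrite adjP.
- by move=> m n m0 n0; case: eqVneq => [->|mn]; [rewrite ee|rewrite eo].
- move=> n n0; exact: Ae.
move=> x xo; suff -> : T x = 0 by rewrite linear0.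
have xo' n : inner x (e n) = 0.
  have [/xo//|sn] := ltP 0 (s n).
  have : rnorm (e n) = 0.
    case: (fP n) => _ _ _ _; rewrite -/(e n) -/(s n) => ->.
    by rewrite eq_le sn s0.
  by move/eqP; rewrite rnorm_eq0 => /eqP ->; rewrite inner0r.
apply/eqP; rewrite -rnorm_eq0 eq_le rnorm_ge0 andbT; apply/ler_addgt0Pr => eps eps0.
rewrite add0r; have x1 : 0 < rnorm x + 1 by rewrite ltr_wpDl// rnorm_ge0.
have [n sn] := s_small (eps / (rnorm x + 1)) (divr_gt0 eps0 x1).
apply: le_trans (smax n x (fun k _ => xo' k)) _.
apply: le_trans (_ : eps / (rnorm x + 1) * (rnorm x + 1) <= _); last by rewrite divfK// gt_eqF.
by apply: ler_pM => //; rewrite ?rnorm_ge0 ?(ltW sn)// lerDl.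
Qed.

End SingularValues.

(** * Schatten norms bound the gauge *)

Section SchattenGauge.
Variables (R : realType) (V W : hilbertType R).

(** The remainder is T restricted to the orthogonal of the first n vectors f_k. The
    images T f_k are orthogonal of norm s_k, so Pythagoras bounds it by s_n. *)
Lemma singular_values_telescopes (T : bop V W) s : singular_values T s -> telescopes T 1 s.
Proof.
move=> [s0 sdec [S [e [TS eo Se Sx]]]]; split=> // [n|]; first exact: sdec.
pose f n := if 0 < s n then e n else 0.
have fo : orthosys f by exact: (@orthosys_restrict _ _ (fun n => 0 < s n)).
have STf n : S (T (f n)) = (s n ^+ 2)%:C%C *: f n.
  by rewrite /f; case: ifP => [/Se//|_]; rewrite !linear0.
have TTf m n : inner (T (f m)) (T (f n)) = (s n ^+ 2)%:C%C * inner (f m) (f n).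
  by rewrite TS STf innerZr conjCR.
have Tf n : rnorm (T (f n)) <= s n * rnorm (f n).
  rewrite -(@ler_pXn2r _ 2) ?nnegrE ?mulr_ge0 ?rnorm_ge0//.
  by rewrite -Re_inner_sq TTf ReMr Re_inner_sq exprMn.
have T0 x : (forall n, inner x (f n) = 0) -> T x = 0.
  move=> xo; apply/eqP; rewrite -inner_eq0 TS Sx ?inner0r// => n sn.
  by have := xo n; rewrite /f sn.
pose L n : seq (V * W) := [:: (f n, T (f n))].
exists (fun n => T - \sum_(k < n) frop (L k)), L; split=> [|n x|n|n].
- by rewrite big_ord0 subr0.
- have -> : (T - \sum_(k < n) frop (L k)) x = T (x - expand f n x).
    rewrite linearB; congr (_ - _); rewrite bop_sumE /expand linear_sum; apply: eq_bigr => k _.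
    by rewrite fropE big_seq1 linearZ.
  set y := x - expand f n x.
  have yo k : (k < n)%N -> inner y (f k) = 0.
    by move=> kn; rewrite innerBl inner_expand// kn subrr.
  have [l yl lo] := expand_cvg fo y.
  have Tyl : cvs (fun M => T (expand f M y)) (T y).
    have -> : T y = T l.
      by have /eqP := T0 _ lo; rewrite linearB subr_eq0 => /eqP.
    exact: cvs_bop.
  apply: (cvs_bound Tyl) => M.
  apply: le_trans (_ : s n * rnorm (expand f M y) <= _); last first.
    by rewrite ler_wpM2l// (le_trans (expand_le fo M y))// sub_expand_le.
  rewrite -(@ler_pXn2r _ 2) ?nnegrE ?mulr_ge0 ?rnorm_ge0// exprMn.
  rewrite /expand linear_sum /= (@rnorm_sq_sum _ _ (fun k => T (inner y (f k) *: f k))); last first.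
    by move=> i j ij; rewrite !(linearZ_LR T) innerZl innerZr TTf fo (negPf ij) !mulr0.
  rewrite (@rnorm_sq_sum _ _ (fun k => inner y (f k) *: f k)); last exact: orthosys_terms.
  rewrite mulr_sumr; apply: ler_sum => k _.
  rewrite (linearZ_LR T) -exprMn lerXn2r ?nnegrE ?mulr_ge0 ?rnorm_ge0// !rnormZ.
  case: (ltnP k n) => kn; first by rewrite yo// rnorm0 !mul0r mulr0.
  rewrite mulrCA ler_wpM2l ?rnorm_ge0// (le_trans (Tf k))// ler_wpM2r ?rnorm_ge0//.
  exact: sdec.
- by rewrite big_ord_recr /= opprD addrA subrK.
- rewrite /weight big_seq1 mul1r /= -[leRHS]mul1r.
  apply: ler_pM; rewrite ?rnorm_ge0 ?orthosys_norm//.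
  by rewrite (le_trans (Tf n))// ler_piMr// orthosys_norm.
Qed.

(** The singular values chosen in the definition of the Schatten norm exist for a
    compact operator. *)
Lemma schatten_gauge (p : nat) (T : bop V W) (r : R) : (0 < p)%N -> 0 < r ->
  compact_op T -> (schatten_norm p%:R T <= r%:E)%E -> gauge p 1 1 T r.
Proof.
move=> p0 r0 /singular_values_exist sT.
have {}sT : singular_values T (singular_value T) by exact: (xgetPex (fun=> 0)).
move: sT; rewrite /schatten_norm; move: (singular_value T) => s sT sr.
have [s0 _ _] := sT; apply: telescopes_gauge (singular_values_telescopes sT) _ => // N.
have p0' : p%:R != 0 :> R by rewrite pnatr_eq0 -lt0n.
set S := (\sum_(0 <= n <oo) _)%E in sr.
have S0 : (0 <= S)%E by apply: nneseries_ge0 => n _ _; rewrite lee_fin powR_ge0.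
have SN : ((\sum_(n < N) s n ^+ p)%:E <= S)%E.
  apply: le_trans (nneseries_lim_ge N _); last by move=> n _ _; rewrite lee_fin powR_ge0.
  by rewrite big_mkord sumEFin lee_fin; apply: ler_sum => n _; rewrite powR_mulrn.
rewrite -lee_fin (le_trans SN)//.
have : ((S `^ p%:R^-1) `^ p%:R <= r%:E `^ p%:R)%E.
  by apply: gt0_ler_poweR; rewrite ?in_itv /= ?leey ?lee_fin ?(ltW r0) ?poweR_ge0// ler0n.
by rewrite -poweRrM mulVf// poweRe1// poweR_EFin powR_mulrn// ltW.
Qed.

End SchattenGauge.

(** * Uniform boundedness *)

Section UniformBoundedness.
Variables (R : realType) (V W : hilbertType R).

Lemma opnorm_attained (T : bop V W) (c : R) : 0 < c ->
  ~ (forall x, rnorm (T x) <= c * rnorm x) ->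
  exists N, [/\ c <= N, forall x, rnorm (T x) <= N * rnorm x &
    exists x, 2 / 3 * N * rnorm x < rnorm (T x)].
Proof.
move=> c0 Tc; have fT : opnorm T \is a fin_num.
  rewrite ge0_fin_numE ?bop_bounded//.
  apply: le_trans (_ : ((rnorm (T 0))%:E <= _)%E); first by rewrite lee_fin rnorm_ge0.
  by apply: ereal_sup_ubound; exists 0; rewrite //= rnorm0.
pose N := fine (opnorm T).
have cN : c <= N.
  rewrite leNgt; apply/negP => Nc; apply: Tc; apply/(opnorm_leP (@bop_linear _ _ _ T) (ltW c0)).
  by rewrite -(fineK fT) lee_fin ltW.
have N0 : 0 < N := lt_le_trans c0 cN.
exists N; split=> //.
  by apply/(opnorm_leP (@bop_linear _ _ _ T) (ltW N0)); rewrite fineK.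
apply: contrapT => H; have N23 : 0 <= 2 / 3 * N by rewrite mulr_ge0 ?divr_ge0 ?ltW.
have : (opnorm T <= (2 / 3 * N)%:E)%E.
  apply/(opnorm_leP (@bop_linear _ _ _ T) N23) => x; rewrite leNgt; apply/negP => Tx.
  by apply: H; exists x.
by rewrite -(fineK fT) -/N lee_fin; lra.
Qed.

(** One of x0 + y and x0 - y does at least as well as y, by the triangle inequality
    for T(2y). *)
Lemma ball_attained (T : bop V W) (c r : R) (x0 : V) : 0 <= c -> 0 < r ->
  (exists x, c * rnorm x < rnorm (T x)) ->
  exists x, rnorm (x - x0) <= r /\ c * r <= rnorm (T x).
Proof.
move=> c0 r0 [z Tz]; have z0 : 0 < rnorm z.
  rewrite lt_def rnorm_ge0 andbT rnorm_eq0; apply: contraTneq Tz => ->.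
  by rewrite linear0 !rnorm0 mulr0 ltxx.
pose y := (r / rnorm z)%:C%C *: z.
have rz : `|r / rnorm z| = r / rnorm z by rewrite ger0_norm// divr_ge0 ?ltW.
have yr : rnorm y = r by rewrite rnormZ rnormR rz divfK// gt_eqF.
have Ty : c * r <= rnorm (T y).
  rewrite linearZ /= rnormZ rnormR rz mulrAC ler_pdivlMr// mulrAC mulrC ler_wpM2l ?(ltW r0)//.
  exact: ltW.
have : rnorm (T y) *+ 2 <= rnorm (T (x0 + y)) + rnorm (T (x0 - y)).
  rewrite !linearD linearN; have -> : rnorm (T y) *+ 2 = rnorm (T x0 + T y - (T x0 - T y)).
    rewrite opprB [T x0 + _]addrC -addrA [T x0 + _]addrC subrK -mulr2n -[in RHS]scaler_nat rnormZ.
    by rewrite -(rmorph_nat (real_complex R)) rnormR ger0_norm// mulr_natl.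
  exact: rnormB.
have [H _|H H2] := leP (c * r) (rnorm (T (x0 + y))).
  by exists (x0 + y); rewrite addrC addKr yr.
exists (x0 - y); split; first by rewrite addrC addKr rnormN yr.
rewrite mulr2n in H2; lra.
Qed.

(** Gliding hump, without the Baire theorem: choose T_n of norm at least 4^n and move
    the point by at most 3^-n so that T_n x_(n+1) stays above 2/3 |T_n| 3^-n. The
    later moves add up to at most half of 3^-n, so the limit point still has
    |T_n y| >= (4/3)^n / 6. *)
Lemma uniform_boundedness (I : Type) (T : I -> bop V W) :
  (forall x, exists M, forall i, rnorm (T i x) <= M) ->
  exists2 M, 0 < M & forall i x, rnorm (T i x) <= M * rnorm x.
Proof.
move=> Tpt; apply: contrapT => Tub.
have Tn (n : nat) : exists iN : I * R, [/\ 4 ^+ n <= iN.2,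
    forall x, rnorm (T iN.1 x) <= iN.2 * rnorm x &
    exists x, 2 / 3 * iN.2 * rnorm x < rnorm (T iN.1 x)].
  have n4 : 0 < 4 ^+ n :> R by rewrite exprn_gt0.
  have [i Ti] : exists i, ~ (forall x, rnorm (T i x) <= 4 ^+ n * rnorm x).
    apply: contrapT => H; apply: Tub; exists (4 ^+ n) => // i.
    by apply: contrapT => Hi; apply: H; exists i.
  by have [N NP] := opnorm_attained n4 Ti; exists (i, N).
have {Tn} [iN iNP] := choice Tn.
have N0 n : 0 < (iN n).2 by case: (iNP n) => n4 _ _; rewrite (lt_le_trans _ n4)// exprn_gt0.
pose r n : R := 3^-1 ^+ n.
have r0 n : 0 < r n by rewrite exprn_gt0// invr_gt0.
have xn (nx : nat * V) : exists x, rnorm (x - nx.2) <= r nx.1 /\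
    2 / 3 * (iN nx.1).2 * r nx.1 <= rnorm (T (iN nx.1).1 x).
  apply: ball_attained => //; last by case: (iNP nx.1).
  by rewrite mulr_ge0 ?divr_ge0 ?(ltW (N0 _)).
have {xn} [next nextP] := choice xn.
pose x := fix x n := if n is m.+1 then next (m, x m) else 0.
have xr n : rnorm (x n.+1 - x n) <= r n by case: (nextP (n, x n)).
have xT n : 2 / 3 * (iN n).2 * r n <= rnorm (T (iN n).1 (x n.+1)) by case: (nextP (n, x n)).
have xd n k : rnorm (x (n + k)%N - x n) <= 3 / 2 * (r n - r (n + k)%N).
  elim: k => [|k IHk]; first by rewrite addn0 !subrr rnorm0 mulr0.
  rewrite addnS; apply: le_trans (rnorm_triB (x (n + k)%N) _ _) _.
  apply: le_trans (lerD (xr _) IHk) _.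
  have -> : r (n + k).+1 = 3^-1 * r (n + k)%N by rewrite /r exprS.
  by lra.
have xd' n k : rnorm (x (n + k)%N - x n) <= 3 / 2 * r n.
  by apply: le_trans (xd n k) _; have := r0 (n + k)%N; lra.
have rcvg : r n @[n --> \oo] --> (0 : R) by apply: cvg_expr; rewrite ger0_norm// ?invf_lt1// ?ltr1n// invr_ge0.
have [y xy] : exists y, cvs x y.
  apply: cvs_complete => e e0.
  have [N NP] := (cvg0P (fun n => ltW (r0 n))).1 rcvg (e / 3) (divr_gt0 e0 (ltr0Sn _ _)).
  exists N => m n Nm Nn; have := NP N (leqnn N) => rN.
  have := rnorm_triB (x N) (x m) (x n); have := xd' N (m - N)%N; have := xd' N (n - N)%N.
  rewrite !subnKC// [rnorm (x N - x n)]rnormBC; lra.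
have yx n : rnorm (y - x n) <= 3 / 2 * r n.
  have H : cvs (fun k => x (n + k)%N - x n) (y - x n).
    apply: cvsB (cvs_cst _); apply/cvsP => e /((cvsP _ _).1 xy) [N NP].
    by exists N => k Nk; apply: NP; rewrite (leq_trans Nk)// leq_addl.
  by apply: (cvs_bound H) => k; exact: xd'.
have [M TM] := Tpt y.
have big n : 6^-1 * (4 / 3) ^+ n <= M.
  apply: le_trans (TM (iN n).1).
  have [n4 iNn _] := iNP n.
  have A1 := xT n; have := iNn (y - x n.+1); rewrite linearB => A2.
  have A3 := ler_wpM2l (ltW (N0 n)) (yx n.+1).
  have A4 := rnormB (T (iN n).1 y) (T (iN n).1 y - T (iN n).1 (x n.+1)).
  rewrite subKr in A4.
  have rS : r n.+1 = 3^-1 * r n by rewrite /r exprS.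
  have A5 : 4 ^+ n * r n <= (iN n).2 * r n by rewrite ler_wpM2r ?(ltW (r0 n)).
  have A6 : (4 / 3) ^+ n = 4 ^+ n * r n by rewrite exprMn.
  rewrite A6; rewrite rS in A3.
  have {}A1 : 2 / 3 * ((iN n).2 * r n) <= rnorm (T (iN n).1 (x n.+1)) by rewrite mulrA.
  have {}A3 : (iN n).2 * rnorm (y - x n.+1) <= 2^-1 * ((iN n).2 * r n).
    by apply: le_trans A3 _; rewrite le_eqVlt; apply/orP; left; apply/eqP; field.
  by move: ((iN n).2 * r n) (4 ^+ n * r n) ((iN n).2 * rnorm (y - x n.+1)) A1 A2 A3 A4 A5 => *; lra.
have M0 : 0 < 6 * M + 1 by have := big 0%N; rewrite expr0; lra.
have : (3 / 4) ^+ n @[n --> \oo] --> (0 : R).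
  by apply: cvg_expr; rewrite ger0_norm; lra.
have q0 n : 0 <= (3 / 4 : R) ^+ n by rewrite exprn_ge0//; lra.
move=> /(cvg0P q0)/(_ (6 * M + 1)^-1); rewrite invr_gt0 => /(_ M0) [n /(_ n (leqnn n))].
apply/negP; rewrite -leNgt -[leLHS]mul1r ler_pdivrMr//.
have := ler_wpM2r (q0 n) (big n); rewrite -mulrA -exprMn.
rewrite (_ : 4 / 3 * (3 / 4) = 1 :> R) ?expr1n; last by field.
have := q0 n; move: ((3 / 4) ^+ n) => q; nra.
Qed.

End UniformBoundedness.

(** * Strongly C^1 paths are Lipschitz in operator norm *)

Section SegmentBounds.
Variable R : realType.

(** Compactness of the segment for a property that is monotone in a bound M. *)
Lemma segment_bound (a b : R) (P : R -> R -> Prop) :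
  (forall t M M', 0 < M -> M <= M' -> P M t -> P M' t) ->
  (forall t, a <= t <= b -> exists M d, [/\ 0 < M, 0 < d &
     forall u, a <= u <= b -> `|u - t| < d -> P M u]) ->
  exists2 M, 0 < M & forall t, a <= t <= b -> P M t.
Proof.
move=> Pmono Ploc.
have /compact_near_coveringP/near_covering_withinP cab := @segment_compact R a b.
have := cab R (pinfty_nbhs R) (fun M t => 0 < M /\ P M t) _.
case=> [t /=|M0 [_ MP]].
  rewrite in_itv /= => /Ploc [M [d [M0 d0 PM]]].
  exists ([set u | `|u - t| < d], [set N | M < N]).
    split=> /=; last by exists M; rewrite num_real.
    by apply/nbhs_ballP; exists d => // u /=; rewrite /ball /= distrC.
  move=> [u N] /= [ut MN]; rewrite in_itv /= => uab.
  by split; [exact: lt_trans MN|apply: Pmono (ltW MN) _ => //; exact: PM].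
exists (`|M0| + 1); first by rewrite ltr_wpDl.
have M0l : M0 < `|M0| + 1 by rewrite (le_lt_trans (ler_norm _))// ltrDl.
by move=> t tab; case: (MP _ M0l t) => //=; rewrite in_itv.
Qed.

Definition lip_on (V : normedZmodType R[i]) (f : R -> V) (a b M : R) :=
  forall u v, a <= u -> u <= v -> v <= b -> rnorm (f v - f u) <= M * (v - u).

(** Vector-valued mean value inequality, by the supremum of the points up to which
    the bound holds. *)
Lemma local_lip (V : normedZmodType R[i]) (f : R -> V) (a b M : R) : 0 <= M ->
  (forall t, a <= t <= b -> exists2 d, 0 < d &
     forall u, a <= u <= b -> `|u - t| < d -> rnorm (f u - f t) <= M * `|u - t|) ->
  lip_on f a b M.
Proof.
move=> M0 floc u v au uv vb.
pose S := [set x | u <= x <= v /\ rnorm (f x - f u) <= M * (x - u)].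
have Su : S u by rewrite /S /= lexx uv !subrr rnorm0 mulr0.
have supS : has_sup S by split; [exists u|exists v => x [/andP[]]].
have su : u <= sup S by apply: ub_le_sup => //; case: supS.
have sv : sup S <= v by apply: ge_sup; [exists u|move=> x [/andP[]]].
have [|d d0 fd] := floc (sup S); first by rewrite (le_trans au su) (le_trans sv vb).
have Ss : S (sup S).
  split; first by rewrite su sv.
  have [x [/andP[ux xv] Sx] xs] := sup_adherent d0 supS.
  have xs' : x <= sup S by apply: ub_le_sup => //; [case: supS|split; rewrite ?ux].
  have xd : `|x - sup S| < d by rewrite ltr_distlC; lra.
  have := fd x; rewrite (le_trans au ux) (le_trans xv vb) => /(_ isT xd).
  rewrite rnormBC ler0_norm ?subr_le0// opprB.
  have := rnorm_triB (f x) (f (sup S)) (f u); nra.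
have [E|nE] := eqVneq (sup S) v; first by rewrite -E; case: Ss.
have sv' : sup S < v by rewrite lt_neqAle nE.
pose x := Num.min v (sup S + d / 2).
have d20 : 0 < d / 2 by rewrite divr_gt0.
have sx : sup S < x by rewrite lt_min sv' ltrDl.
have xv : x <= v by rewrite ge_min lexx.
have xd : x <= sup S + d / 2 by rewrite ge_min lexx orbT.
suff : S x by move/(ub_le_sup supS.2); rewrite leNgt sx.
split; first by rewrite xv (le_trans su (ltW sx)).
have := fd x; rewrite (le_trans au (le_trans su (ltW sx))) (le_trans xv vb) => /(_ isT).
have xsd : x - sup S < d by apply: le_lt_trans (_ : d / 2 < d); lra.
rewrite gtr0_norm ?subr_gt0// => /(_ xsd) H.
have [_ Ss2] := Ss; have := rnorm_triB (f (sup S)) (f x) (f u).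
have -> : M * (x - u) = M * (x - sup S) + M * (sup S - u) by ring.
by move=> /le_trans; apply; exact: lerD.
Qed.

Lemma C1_on_lip (V : normedModType R[i]) (f : R -> V) (a b : R) :
  C1_on a b f -> exists2 M, 0 < M & lip_on f a b M.
Proof.
move=> [f' /subspace_continuousP f'c ff'].
have [||M M0 f'M] := @segment_bound a b (fun M t => rnorm (f' t) <= M).
- by move=> t M M' _ MM' /le_trans; apply.
- move=> t tab; have := f'c t; rewrite /= in_itv => /(_ tab).
  move=> /(_ [set y | rnorm (y - f' t) < 1]); case.
    by apply/nbhs_rnormP; exists 1.
  move=> d /= d0 dP; exists (rnorm (f' t) + 1), d; split=> //.
    by rewrite ltr_wpDl ?rnorm_ge0.
  move=> u uab ut; have := dP u; rewrite /ball /= distrC in_itv => /(_ ut uab) H.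
  have := rnorm_triB (f' t) (f' u) 0; rewrite !subr0; lra.
exists (M + 1); first by rewrite addr_gt0.
apply: local_lip => [|t tab]; first by rewrite addr_ge0 ?ltW.
have := ff' t; rewrite in_itv => /(_ tab).
move=> /(_ [set y | rnorm (y - f' t) < 1]); case.
  by apply/nbhs_rnormP; exists 1.
move=> d /= d0 dP; exists d => // u uab ut.
have [->|ut'] := eqVneq u t; first by rewrite !subrr rnorm0 normr0 mulr0.
have := dP u; rewrite /ball /= distrC in_itv => /(_ ut ut' uab) H.
have := rnorm_triB (f' t) ((((u - t)^-1)%:C)%C *: (f u - f t)) 0; rewrite !subr0.
rewrite rnormZ rnormR normfV => H2.
have nut : 0 < `|u - t| by rewrite normr_gt0 subr_eq0.
rewrite -ler_pdivrMr// mulrC; have := f'M t tab; lra.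
Qed.

Lemma lip_on_cat (V : normedZmodType R[i]) (f : R -> V) (a b c M N : R) :
  a <= b <= c -> lip_on f a b M -> lip_on f b c N -> lip_on f a c (Num.max M N).
Proof.
move=> /andP[ab bc] fM fN u v au uv vc.
have MM : M <= Num.max M N by rewrite le_max lexx.
have NN : N <= Num.max M N by rewrite le_max lexx orbT.
have [vb|bv] := leP v b.
  by apply: le_trans (fM _ _ au uv vb) _; rewrite ler_wpM2r// subr_ge0.
have [bu|ub] := leP b u.
  by apply: le_trans (fN _ _ bu uv vc) _; rewrite ler_wpM2r// subr_ge0.
apply: le_trans (rnorm_triB (f b) _ _) _.
have := fM _ _ au (ltW ub) (lexx _); have := fN _ _ (lexx _) (ltW bv) vc.
have -> : v - u = (v - b) + (b - u) by ring.
rewrite [Num.max M N * _]mulrDr => H1 H2; apply: lerD; [apply: le_trans H1 _|apply: le_trans H2 _].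
  by rewrite ler_wpM2r// subr_ge0 ltW.
by rewrite ler_wpM2r// subr_ge0 ltW.
Qed.

Lemma lip_on_partition (V : normedZmodType R[i]) (f : R -> V) (a : R) (r : seq R) :
  path <%R a r ->
  (forall j, (j < size r)%N ->
     exists M, lip_on f (nth 0 (a :: r) j) (nth 0 (a :: r) j.+1) M) ->
  exists M, lip_on f a (last a r) M.
Proof.
elim: r a => [|b r IHr] a /=.
  move=> _ _; exists 0 => u v au uv va; have uv' : u = v by apply/eqP; rewrite eq_le uv (le_trans va).
  by rewrite uv' subrr rnorm0 subrr mulr0.
move=> /andP[ab br] fj; have [M fM] := fj 0%N isT.
have [|N fN] := IHr b br; first by move=> j jr; exact: (fj j.+1).
have bl : b <= last b r.
  move: br; clear; case: r => //= c r /andP[bc cr].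
  have := order_path_min lt_trans cr; move=> /allP H.
  apply: ltW; apply: lt_le_trans bc _; case: (lastP r) H => [//|r' z H].
  by rewrite last_rcons ltW// H// mem_rcons mem_head.
by exists (Num.max M N); apply: lip_on_cat fM fN; rewrite (ltW ab).
Qed.

End SegmentBounds.

(** The difference quotients form a pointwise bounded family of operators. *)
Lemma strong_lip_uniform (R : realType) (V W : hilbertType R) (s : R -> bop V W) :
  (forall h, exists M, lip_on (fun t => s t h) 0 1 M) ->
  exists2 M, 0 < M & forall u v, 0 <= u <= 1 -> 0 <= v <= 1 ->
    forall x, rnorm ((s u - s v) x) <= M * `|u - v| * rnorm x.
Proof.
move=> slip.
pose I := {uv : R * R | [&& 0 <= uv.1, uv.1 < uv.2 & uv.2 <= 1]}.
pose T (i : I) := (((sval i).2 - (sval i).1)^-1)%:C%C *: (s (sval i).2 - s (sval i).1).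
have [|M M0 TM] := @uniform_boundedness R V W I T.
  move=> x; have [M sM] := slip x; exists M => -[[u v] /= /and3P[u0 uv v1]].
  rewrite /T /= rnormZ rnormR ger0_norm ?invr_ge0 ?subr_ge0 ?(ltW uv)//.
  by rewrite mulrC ler_pdivrMr ?subr_gt0// sM// ltW.
exists M => //.
have H u v : 0 <= u -> u < v -> v <= 1 -> forall x, rnorm ((s v - s u) x) <= M * `|v - u| * rnorm x.
  move=> u0 uv v1 x; have uvP : [&& 0 <= u, u < v & v <= 1] by rewrite u0 uv.
  have := TM (exist _ (u, v) uvP) x; rewrite /T /= rnormZ rnormR normfV mulrC.
  by rewrite ler_pdivrMr ?normr_gt0 ?subr_eq0 ?gt_eqF// mulrAC.
move=> u v /andP[u0 u1] /andP[v0 v1] x; case: (ltgtP u v) => [uv|vu|->].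
- by rewrite -opprB /= rnormN distrC H.
- exact: H.
- by rewrite !subrr /= rnorm0 normr0 mulr0 mul0r.
Qed.

Lemma piecewise_C1_lip (R : realType) (X : rigidCstarTensorCat R) (H K : hilbX X)
    (s : R -> hilbX_hom H K) (c : X) : piecewise_strongly_C1 s ->
  exists2 M, 0 < M & forall u v, 0 <= u <= 1 -> 0 <= v <= 1 ->
    forall x, rnorm ((s u c - s v c) x) <= M * `|u - v| * rnorm x.
Proof.
move=> [_ [r [rpath /eqP rlast] rC1]]; apply: (strong_lip_uniform (s := fun t => s t c)) => h.
rewrite -rlast; apply: lip_on_partition => // j jr.
by have [M _ sM] := C1_on_lip (rC1 j jr c h); exists M.
Qed.

(** * Traces of words of operators *)

Section Words.
Variables (R : realType) (V : hilbertType R) (p : nat).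
Hypothesis p_gt0 : (0 < p)%N.
Implicit Types (w d : nat -> bop V V) (b c : bop V V).

Definition word N w : bop V V := \prod_(j < N) w j.

Definition upd w i b : nat -> bop V V := fun j => if j == i then b else w j.

Arguments upd : simpl never.

Definition merge N w i b : bop V V :=
  word N.+1 (fun j => if (j < i)%N then w j else if j == i then b else w j.+1).

Lemma upd_same w i b : upd w i b i = b. Proof. by rewrite /upd eqxx. Qed.
Lemma upd_other w i j b : j != i -> upd w i b j = w j.
Proof. by rewrite /upd => /negPf ->. Qed.

Lemma updC w i j b c : i != j -> upd (upd w i b) j c =1 upd (upd w j c) i b.
Proof. by move=> ij k; rewrite /upd; case: eqVneq => // ->; rewrite eq_sym (negPf ij). Qed.

Lemma eq_word N w d : (forall j, (j < N)%N -> w j = d j) -> word N w = word N d.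
Proof. by move=> wd; apply: eq_bigr => j _; exact: wd. Qed.

Lemma word_upd N w i b : (i < N)%N ->
  word N (upd w i b) = \prod_(0 <= j < i) w j * b * \prod_(i.+1 <= j < N) w j.
Proof.
move=> iN; rewrite /word -(big_mkord xpredT) (@big_cat_nat _ _ _ i 0%N N)//=; last exact: ltnW.
rewrite [X in _ * X]big_ltn// upd_same -mulrA; congr (_ * (_ * _)).
  by apply: eq_big_nat => j /andP[_ ji]; rewrite upd_other// ltn_eqF.
by apply: eq_big_nat => j /andP[ij _]; rewrite upd_other// gtn_eqF.
Qed.

Lemma word_upd0 N w b : word N.+1 (upd w 0%N b) = b * \prod_(1 <= j < N.+1) w j.
Proof. by rewrite word_upd// big_geq// mul1r. Qed.

Lemma word_upd_last N w b : word N.+1 (upd w N b) = word N w * b.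
Proof. by rewrite word_upd// [X in _ * _ * X]big_geq// mulr1 /word big_mkord. Qed.

Lemma word_upd2 N w i b c : (i.+1 < N)%N ->
  word N (upd (upd w i b) i.+1 c) =
  \prod_(0 <= j < i) w j * (b * c) * \prod_(i.+2 <= j < N) w j.
Proof.
move=> iN; rewrite word_upd// big_nat_recr//= upd_same !mulrA; congr (_ * _ * _ * _).
  by apply: eq_big_nat => j /andP[_ ji]; rewrite upd_other// ltn_eqF.
by apply: eq_big_nat => j /andP[ij _]; rewrite upd_other// gtn_eqF// ltnW.
Qed.

Lemma mergeE N w i b : (i <= N)%N ->
  merge N w i b = \prod_(0 <= j < i) w j * b * \prod_(i.+2 <= j < N.+2) w j.
Proof.
move=> iN; rewrite /merge /word.
rewrite -(big_mkord xpredT (fun j => if (j < i)%N then w j else if j == i then b else w j.+1)).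
rewrite (@big_cat_nat _ _ _ i 0%N N.+1)//=; last exact: leqW.
rewrite [X in _ * X]big_ltn// ltnn eqxx -mulrA; congr (_ * (_ * _)).
  by apply: eq_big_nat => j /andP[_ ->].
rewrite [RHS]big_add1; apply: eq_big_nat => j /andP[ij _].
by rewrite ltnNge ltnW//= gtn_eqF.
Qed.

Lemma merge_mul N w i b c : (i <= N)%N ->
  merge N w i (b * c) = word N.+2 (upd (upd w i b) i.+1 c).
Proof. by move=> iN; rewrite mergeE// word_upd2// !ltnS. Qed.

Lemma mergeD N w i b c : (i <= N)%N -> merge N w i (b + c) = merge N w i b + merge N w i c.
Proof. by move=> iN; rewrite !mergeE// mulrDr mulrDl. Qed.

Lemma word_updD N w i b c : (i < N)%N ->
  word N (upd w i (b + c)) = word N (upd w i b) + word N (upd w i c).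
Proof. by move=> iN; rewrite !word_upd// mulrDr mulrDl. Qed.

Lemma bop_scalerAl (z : R[i]) b c : (z *: b) * c = z *: (b * c).
Proof. exact/bopP. Qed.
Lemma bop_scalerAr (z : R[i]) b c : b * (z *: c) = z *: (b * c).
Proof. by apply/bopP => x; rewrite bop_mulE /= linearZ. Qed.

Lemma word_updZ N w i z b : (i < N)%N ->
  word N (upd w i (z *: b)) = z *: word N (upd w i b).
Proof. by move=> iN; rewrite !word_upd// bop_scalerAr bop_scalerAl. Qed.

Definition nuc b := exists B, nuclear b B.

Definition sch b := exists m g, gauge p m 1 b g.

Lemma nucD b c : nuc b -> nuc c -> nuc (b + c).
Proof. by move=> [B bB] [C cC]; exists (B + C); exact: nuclearD. Qed.

Lemma nuc_traceD b c : nuc b -> nuc c -> op_trace (b + c) = op_trace b + op_trace c.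
Proof. by move=> [B bB] [C cC]; exact: op_traceD bB cC. Qed.

Lemma nuc_traceZ z b : nuc b -> op_trace (z *: b) = z * op_trace b.
Proof. by move=> [B bB]; exact: op_traceZ bB. Qed.

Lemma nuc_traceC b c : nuc b -> op_trace (c * b) = op_trace (b * c).
Proof. by move=> [B bB]; exact: op_trace_cyclic bB. Qed.

Lemma bop_pos_bound w j : exists2 M, 0 < M & forall x, rnorm (w j x) <= M * rnorm x.
Proof.
have [M [M0 wM]] := bop_bnd (w j); exists (M + 1); first by rewrite ltr_wpDl.
by move=> x; apply: le_trans (wM x) _; rewrite ler_wpM2r ?rnorm_ge0// lerDl.
Qed.

Lemma sum_mem_le (s : seq nat) N : (\sum_(j < N) (val j \in s) <= size s)%N.
Proof.
rewrite -(big_mkord xpredT (fun j => nat_of_bool (j \in s))) -big_mkcond /= sum1_count.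
rewrite -size_filter; apply: uniq_leq_size; first exact/filter_uniq/iota_uniq.
by move=> j; rewrite mem_filter => /andP[].
Qed.

(** The letters of index in s are only bounded; p Schatten letters remain, enough for
    a nuclear operator. *)
Lemma word_nuclear N w (s : seq nat) m (g : nat -> R) : (p + size s <= N)%N ->
  (forall j, (j < N)%N -> j \notin s -> gauge p m 1 (w j) (g j)) ->
  (forall j, (j < N)%N -> j \in s -> 0 < g j /\ forall x, rnorm (w j x) <= g j * rnorm x) ->
  nuclear (word N w) ((N * m)%:R * (\prod_(j < N) g j * p%:R)).
Proof.
move=> pN good bad; apply: (@gauge_nuclear _ _ p_gt0 _ _ _ (\sum_(j < N) (val j \notin s))).
  rewrite -(leq_add2r (size s)) (leq_trans pN)//.
  apply: leq_trans (leq_add (leqnn _) (sum_mem_le s N)); rewrite -big_split /=.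
  rewrite (eq_bigr (fun=> 1%N)) ?sum1_card ?card_ord// => j _; by case: (_ \in _).
apply: (@gauge_widen _ _ _ _ (\sum_(j < N) (val j \notin s) * m)).
  rewrite -[X in (_ <= X * _)%N]card_ord -sum_nat_const; apply: leq_sum => j _.
  by case: (~~ _); rewrite ?mul1n ?mul0n.
apply: (@gauge_prod _ _ p_gt0 _ _ w (fun j => (j \notin s) * m)%N (fun j => j \notin s) g).
move=> j jN; have [js|js] := boolP (j \in s); last by rewrite mul1n; exact: good.
by rewrite mul0n; have [g0 wg] := bad j jN js; exact: gauge_bound.
Qed.

Lemma word_trace_le N w (s : seq nat) m (g : nat -> R) : (p + size s <= N)%N ->
  (forall j, (j < N)%N -> j \notin s -> gauge p m 1 (w j) (g j)) ->
  (forall j, (j < N)%N -> j \in s -> 0 < g j /\ forall x, rnorm (w j x) <= g j * rnorm x) ->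
  rnorm (op_trace (word N w)) <= (N * m)%:R * (\prod_(j < N) g j * p%:R).
Proof. by move=> pN good bad; apply: op_trace_le; exact: word_nuclear bad. Qed.

Lemma word_nuc N w (s : seq nat) : (p + size s <= N)%N ->
  (forall j, (j < N)%N -> j \notin s -> sch (w j)) -> nuc (word N w).
Proof.
move=> pN good.
have mg j : exists mg : nat * R, ((j < N)%N -> j \notin s -> gauge p mg.1 1 (w j) mg.2) /\
    (j \in s -> 0 < mg.2 /\ forall x, rnorm (w j x) <= mg.2 * rnorm x).
  have [js|js] := boolP (j \in s).
    by have [M M0 wM] := bop_pos_bound w j; exists (0%N, M).
  have [jN|jN] := boolP (j < N)%N; last by exists (0%N, 0).
  by have [m [g mg]] := good j jN js; exists (m, g).
have {mg} [mg mgP] := choice mg.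
exists ((N * \max_(j < N) (mg j).1)%:R * (\prod_(j < N) (mg j).2 * p%:R)).
apply: (@word_nuclear _ _ s _ (fun j => (mg j).2)) => // j jN js; last exact: (mgP j).2.
apply: gauge_widen ((mgP j).1 jN js).
exact: (@leq_bigmax _ (fun j : 'I_N => (mg j).1) (Ordinal jN)).
Qed.

Lemma word_trace_shift N w (s : seq nat) : (p + size s <= N)%N ->
  (forall j, (j <= N)%N -> j \notin s -> sch (w j)) ->
  op_trace (word N (fun j => w j.+1) * w 0%N) = op_trace (word N.+1 w).
Proof.
move=> pN good; rewrite -nuc_traceC; first by rewrite [in RHS]/word big_ord_recl.
apply: (@word_nuc _ _ [seq j.-1 | j <- s]); first by rewrite size_map.
move=> j jN js; apply: good => //; apply: contra js => js.
by apply/mapP; exists j.+1.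
Qed.

Lemma word_trace_rot N v w (s : seq nat) : (p + size s <= N)%N ->
  (forall j, (j <= N)%N -> j \notin s -> sch (w j)) ->
  (forall j, (j < N)%N -> v j = w j.+1) -> v N = w 0%N ->
  op_trace (word N.+1 v) = op_trace (word N.+1 w).
Proof.
move=> pN good vw vN; rewrite -(word_trace_shift pN good).
suff -> : word N.+1 v = word N (fun j => w j.+1) * w 0%N by [].
rewrite {1}/word big_ord_recr /= vN; congr (_ * _).
by apply: eq_bigr => j _; exact: vw.
Qed.

End Words.

(** * Alternating sums over the faces of a cyclic word *)

Section AlternatingSums.
Variable C : comPzRingType.
Implicit Types (u : nat -> C).

Lemma alternating_telescope u a b : (a <= b)%N ->
  \sum_(a <= i < b) (-1) ^+ i * (u i + u i.+1) = (-1) ^+ a * u a - (-1) ^+ b * u b.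
Proof.
move=> ab; rewrite -(subnKC ab); elim: (b - a)%N => [|k IHk].
  by rewrite addn0 big_geq// subrr.
by rewrite addnS big_nat_recr ?leq_addr//= IHk exprS; ring.
Qed.

(** In a cyclic word of n+1 letters, n even, whose letter l is marked, the merges of
    two neighbours away from l telescope to boundary terms; these cancel against the
    merges that involve l, up to the defects e. *)
Lemma marked_merges (n l : nat) u (e : C) : ~~ odd n -> (l <= n)%N -> (0 < n)%N ->
  (-1) ^+ l * (\sum_(i < n) (-1) ^+ i * ((l < i)%:R - (i.+1 < l)%:R) * (u i + u i.+1))
  + (l < n)%:R * (u l.+1 + e) + (0 < l)%:R * (u l.-1 + e)
  + (if l == 0%N then u n + e else if l == n then u 0%N + e
     else (-1) ^+ l * (u n + u 0%N)) = 2 * e.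
Proof.
move=> n_even ln n0.
have en : (-1) ^+ n = 1 :> C by rewrite -signr_odd (negPf n_even).
have ll : (-1) ^+ l * (-1) ^+ l = 1 :> C by rewrite -expr2 sqrr_sign.
have S1 : \sum_(i < n) (-1) ^+ i * (l < i)%:R * (u i + u i.+1) =
    if (l < n)%N then (-1) ^+ l.+1 * u l.+1 - u n else 0.
  rewrite -(big_mkord xpredT (fun i => (-1) ^+ i * (l < i)%:R * (u i + u i.+1))).
  have [ln'|ln'] := ltnP l n; last first.
    rewrite big_nat big1// => i /andP[_ i_n].
    by rewrite ltnNge (leq_trans (ltnW i_n))// mulr0 mul0r.
  rewrite (@big_cat_nat _ _ _ l.+1 0%N n)//= [X in X + _]big_nat big1 ?add0r.
    have := alternating_telescope u ln'; rewrite en mul1r => <-.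
    by apply: eq_big_nat => i /andP[-> _]; rewrite mulr1.
  by move=> i /andP[_]; rewrite ltnS ltnNge => ->; rewrite mulr0 mul0r.
have S2 : \sum_(i < n) (-1) ^+ i * (i.+1 < l)%:R * (u i + u i.+1) =
    if (0 < l)%N then u 0%N - (-1) ^+ l.-1 * u l.-1 else 0.
  rewrite -(big_mkord xpredT (fun i => (-1) ^+ i * (i.+1 < l)%:R * (u i + u i.+1))).
  case: l ln {ll S1} => [|l] ln /=.
    by rewrite big1// => i _; rewrite mulr0 mul0r.
  rewrite (@big_cat_nat _ _ _ l 0%N n)//=; last exact: ltnW.
  rewrite [X in _ + X]big_nat [X in _ + X]big1 ?addr0.
    have := alternating_telescope u (leq0n l); rewrite expr0 mul1r => <-.
    by apply: eq_big_nat => i /andP[_ il]; rewrite ltnS il mulr1.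
  by move=> i /andP[li _]; rewrite ltnS ltnNge li mulr0 mul0r.
under eq_bigr do rewrite mulrBr mulrBl; rewrite sumrB S1 S2.
move: ln; rewrite leq_eqVlt => /orP[/eqP lE|ln].
  rewrite lE ltnn n0 eqxx (gtn_eqF n0) en.
  have -> : (-1) ^+ n.-1 = -1 :> C.
    by have := en; rewrite -[in X in X -> _](prednK n0) exprS mulN1r => /eqP; rewrite eqr_oppLR => /eqP.
  rewrite -[false%:R]/(0 : C) -[true%:R]/(1 : C); ring.
rewrite ln (ltn_eqF ln); case: l ln ll {S1 S2} => [|l] ln ll /=.
  rewrite -[false%:R]/(0 : C) -[true%:R]/(1 : C); ring.
rewrite -[true%:R]/(1 : C).
rewrite !exprS in ll *; move: ((-1) ^+ l) ll => s ss.
transitivity (2 * e + (1 - -1 * s * (-1 * s)) * (u l.+2 + u l)); first ring.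
by rewrite ss; ring.
Qed.

(** The coboundary of the transgression, in scalar form: j is the position of the
    marked letter after the face i has been taken, u l i stands for a trace with the
    letter l marked, and e l for the defect when the face merges the marked letter
    with a neighbour. Summing [marked_merges] over l leaves only the defects. *)
Lemma marked_merges_sum (n : nat) (u : nat -> nat -> C) (e : nat -> C) : ~~ odd n -> (0 < n)%N ->
  let h l i := u l i + u l i.+1 in
  \sum_(i < n) (-1) ^+ i * (\sum_(j < n) (-1) ^+ j *
    (if (j < i)%N then h j i else if (i < j)%N then h j.+1 i
     else (u i i.+1 + e i) + (u i.+1 i + e i.+1)))
  + \sum_(j < n) (-1) ^+ j * (if val j == 0%N then (u n 0%N + e n) + (u 0%N n + e 0%N)
                             else u j n + u j 0%N) = 2 * \sum_(l < n.+1) e l.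
Proof.
move=> n_even n0 h.
have en : (-1) ^+ n = 1 :> C by rewrite -signr_odd (negPf n_even).
rewrite mulr_sumr; under [RHS]eq_bigr => l _.
  rewrite -(@marked_merges n l (u l) (e l) n_even (ltn_ord l) n0).
  over.
rewrite !big_split /=.
(* the merges of the marked letter with a neighbour *)
have D1 : \sum_(l < n.+1) (l < n)%:R * (u l l.+1 + e l) = \sum_(i < n) (u i i.+1 + e i).
  rewrite big_ord_recr /= ltnn mul0r addr0; apply: eq_bigr => i _.
  by rewrite ltn_ord mul1r.
have D2 : \sum_(l < n.+1) (0 < l)%:R * (u l l.-1 + e l) = \sum_(i < n) (u i.+1 i + e i.+1).
  by rewrite big_ord_recl /= mul0r add0r; apply: eq_bigr => i _; rewrite mul1r.
have D3 : \sum_(l < n.+1) (if val l == 0%N then u l n + e l else if val l == n then u l 0%N + e l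
     else (-1) ^+ l * (u l n + u l 0%N)) =
   \sum_(j < n) (-1) ^+ j * (if val j == 0%N then (u n 0%N + e n) + (u 0%N n + e 0%N)
                             else u j n + u j 0%N).
  rewrite big_ord_recr /= eqxx (gtn_eqF n0); case: n n0 {n_even en h D1 D2} => // n _.
  rewrite !big_ord_recl /= expr0 mul1r addrAC; congr (_ + _); first by rewrite addrC.
  by apply: eq_bigr => i _ /=; rewrite /bump /= !add1n eqSS (ltn_eqF (ltn_ord i)).
rewrite D1 D2 D3; congr (_ + _).
transitivity (\sum_(i < n) ((-1) ^+ i * (\sum_(j < n) (-1) ^+ j * ((j < i)%:R * h j i)) +
   (-1) ^+ i * (\sum_(j < n) (-1) ^+ j * ((i < j)%:R * h j.+1 i)) +
   ((u i i.+1 + e i) + (u i.+1 i + e i.+1)))).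
  apply: eq_bigr => i _; rewrite -mulrDr -big_split /=.
  rewrite -[X in _ = _ + X]mul1r -[X in _ = _ + X * _](sqrr_sign _ i) expr2 -mulrA -mulrDr.
  congr (_ * _); rewrite (bigD1 i)//= [in RHS](bigD1 i)//= ltnn !mul0r !mulr0 !add0r addrC.
  congr (_ + _); apply: eq_bigr => j ji; rewrite -mulrDr; congr (_ * _).
  case: (ltngtP j i) => [||E]; rewrite ?mul1r ?mul0r ?addr0 ?add0r//.
  by move/eqP: ji; case; exact: val_inj.
rewrite !big_split /= [LHS]addrA; congr (_ + _ + _).
have -> : \sum_(i < n) (-1) ^+ i * (\sum_(j < n) (-1) ^+ j * ((i < j)%:R * h j.+1 i)) =
    - \sum_(i < n) (-1) ^+ i * (\sum_(l < n.+1) (-1) ^+ l * ((i.+1 < l)%:R * h l i)).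
  rewrite -sumrN; apply: eq_bigr => i _; rewrite -mulrN; congr (_ * _).
  rewrite big_ord_recl /= mul0r mulr0 add0r -sumrN; apply: eq_bigr => j _.
  by rewrite /bump /= add1n ltnS exprS mulN1r mulNr opprK.
have -> : \sum_(i < n) (-1) ^+ i * (\sum_(j < n) (-1) ^+ j * ((j < i)%:R * h j i)) =
    \sum_(i < n) (-1) ^+ i * (\sum_(l < n.+1) (-1) ^+ l * ((l < i)%:R * h l i)).
  apply: eq_bigr => i _; congr (_ * _); rewrite big_ord_recr /= ltnNge ltnW ?ltn_ord//=.
  by rewrite mul0r mulr0 addr0.
rewrite -sumrB; under [LHS]eq_bigr => i _ do rewrite -mulrBr -sumrB mulr_sumr.
rewrite exchange_big /=; apply: eq_bigr => l _; rewrite mulr_sumr; apply: eq_bigr => i _.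
by rewrite /h; ring.
Qed.

End AlternatingSums.

(** * Coboundaries for a pair of representations *)

Section Faces.
Variables (R : realType) (A : assocAlgType R[i]).
Implicit Types (y : nat -> A).

(** Faces of sequences indexed by nat, so that the dimension does not enter the type
    of a word. *)
Definition inner_face i y : nat -> A :=
  fun j => if (j < i)%N then y j else if j == i then amul (y i) (y i.+1) else y j.+1.

Definition outer_face k y : nat -> A :=
  fun j => if j == 0%N then amul (y k.+1) (y 0%N) else y j.

Definition natseq k (x : 'I_k.+1 -> A) : nat -> A := fun j => x (inord j).

Lemma natseqE k (x : 'I_k.+1 -> A) (j : 'I_k.+1) : natseq x j = x j.
Proof. by rewrite /natseq inord_val. Qed.

Lemma natseq_face k (i : 'I_k.+1) (x : 'I_k.+2 -> A) j : (j < k.+1)%N ->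
  natseq (face i x) j = inner_face i (natseq x) j.
Proof.
move=> jk; rewrite /natseq /face /inner_face inordK//.
have E1 (l : 'I_k.+1) : x (widen_ord (leqnSn k.+1) l) = x (inord l).
  by congr x; apply: val_inj; rewrite /= inordK// leqW.
have E2 (l : 'I_k.+1) : x (lift ord0 l) = x (inord l.+1).
  by congr x; apply: val_inj; rewrite /= /bump /= add1n inordK// ltnS.
rewrite E1 E2 inordK//; case: ifP => // _; rewrite -val_eqE /= inordK//.
by case: eqP => // ->.
Qed.

Lemma natseq_last_face k (x : 'I_k.+2 -> A) j : (j < k.+1)%N ->
  natseq (last_face x) j = outer_face k (natseq x) j.
Proof.
move=> jk; rewrite /natseq /last_face /outer_face -val_eqE /= inordK//; case: ifP => _.
  by congr (amul (x _) (x _)); apply: val_inj; rewrite /= ?inordK.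
by congr x; apply: val_inj; rewrite /= !inordK// leqW.
Qed.

End Faces.

Section CyclicWords.
Variables (R : realType) (V : hilbertType R) (p : nat) (A : assocAlgType R[i]).
Hypothesis p_gt0 : (0 < p)%N.
Variables sigma tau : A -> bop V V.
Hypothesis sigmaM : forall a b, sigma (amul a b) = sigma a * sigma b.
Hypothesis tauM : forall a b, tau (amul a b) = tau a * tau b.

Definition hdiff a := sigma a - tau a.

Hypothesis delta_sch : forall a, sch p (hdiff a).

Implicit Types (y : nat -> A) (D : A -> bop V V).

Definition diff_word y : nat -> bop V V := fun j => hdiff (y j).

Definition trace_cochain N y : R[i] := op_trace (word N (diff_word y)).

Definition transgression N D y : R[i] :=
  \sum_(j < N) (-1) ^+ j * op_trace (word N (upd (diff_word y) j (D (y j)))).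

Lemma deltaM a b : hdiff (amul a b) = sigma a * hdiff b + hdiff a * tau b.
Proof.
by rewrite /hdiff sigmaM tauM mulrBr mulrBl addrA subrK.
Qed.

Lemma upd_sch y l b j : j != l -> sch p (upd (diff_word y) l b j).
Proof. by move=> jl; rewrite upd_other//; exact: delta_sch. Qed.

Lemma upd2_sch y l b i c j : j != l -> j != i -> sch p (upd (upd (diff_word y) l b) i c j).
Proof. by move=> jl ji; rewrite upd_other//; exact: upd_sch. Qed.

Lemma nuc_upd N y l b : (p < N)%N -> nuc (word N (upd (diff_word y) l b)).
Proof.
move=> pN; apply: (@word_nuc _ _ _ p_gt0 _ _ [:: l]); first by rewrite /= addn1.
by move=> j _; rewrite inE => jl; exact: upd_sch.
Qed.

Lemma nuc_upd2 N y l b i c : (p.+1 < N)%N -> nuc (word N (upd (upd (diff_word y) l b) i c)).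
Proof.
move=> pN; apply: (@word_nuc _ _ _ p_gt0 _ _ [:: l; i]); first by rewrite /= addn2.
by move=> j _; rewrite !inE negb_or => /andP[jl ji]; exact: upd2_sch.
Qed.

Lemma upd_id (w : nat -> bop V V) i : upd w i (w i) =1 w.
Proof. by move=> j; rewrite /upd; case: eqP => [->|]. Qed.

Lemma eq_word1 N (w w' : nat -> bop V V) : w =1 w' -> word N w = word N w'.
Proof. by move=> ww; apply: eq_word => j _. Qed.

Lemma outer_trace N y l b s c : (p.+1 < N.+1)%N -> (l != 0)%N ->
  op_trace (word N.+1 (upd (upd (diff_word y) l b) 0%N (s * c))) =
  op_trace (word N.+2 (upd (upd (upd (diff_word y) l b) 0%N c) N.+1 s)).
Proof.
move=> pN l0; set w := upd (diff_word y) l b.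
have -> : word N.+1 (upd w 0%N (s * c)) = s * word N.+1 (upd w 0%N c).
  by rewrite !word_upd0 mulrA.
have -> : word N.+2 (upd (upd w 0%N c) N.+1 s) = word N.+1 (upd w 0%N c) * s.
  by rewrite word_upd_last.
by apply: nuc_traceC; exact: nuc_upd2.
Qed.

Lemma outer_trace1 N y s c : (p < N.+1)%N ->
  op_trace (word N.+1 (upd (diff_word y) 0%N (s * c))) =
  op_trace (word N.+2 (upd (upd (diff_word y) 0%N c) N.+1 s)).
Proof.
move=> pN.
have -> : word N.+1 (upd (diff_word y) 0%N (s * c)) = s * word N.+1 (upd (diff_word y) 0%N c).
  by rewrite !word_upd0 mulrA.
have -> : word N.+2 (upd (upd (diff_word y) 0%N c) N.+1 s) = word N.+1 (upd (diff_word y) 0%N c) * s.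
  by rewrite word_upd_last.
by apply: nuc_traceC; exact: nuc_upd.
Qed.

(** By sigma(a)sigma(b) - tau(a)tau(b) = sigma(a) delta(b) + delta(a) tau(b), the face
    i is f_i + g_(i+1), where f_i and g_i are the traces of the word of all delta's
    with the letter i replaced by sigma and tau. As f_i - g_i is the trace E of the
    whole word, the face is u_i + u_(i+1) with u_i = f_i - E/2, the last face is
    u_(k+1) + u_0 by cyclicity, and the alternating sum telescopes. *)
Lemma trace_cochain_cocycle k y : ~~ odd k -> (p < k.+1)%N ->
  \sum_(i < k.+1) (-1) ^+ i * trace_cochain k.+1 (inner_face i y) +
  (-1) ^+ k.+1 * trace_cochain k.+1 (outer_face k y) = 0.
Proof.
move=> k_even pk.
have ek : (-1) ^+ k = 1 :> R[i] by rewrite -signr_odd (negPf k_even).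
pose f i := op_trace (word k.+2 (upd (diff_word y) i (sigma (y i)))).
pose g i := op_trace (word k.+2 (upd (diff_word y) i (tau (y i)))).
pose E := op_trace (word k.+2 (diff_word y)).
have fE i : (i < k.+2)%N -> f i = g i + E.
  move=> ik; rewrite /f /g /E -(eq_word1 _ (upd_id (diff_word y) i)) /diff_word /hdiff.
  rewrite -nuc_traceD; [|exact: nuc_upd (leqW pk)|exact: nuc_upd (leqW pk)].
  by rewrite -word_updD// addrC subrK.
pose u i := f i - 2^-1 * E.
have T i : (i < k.+1)%N -> trace_cochain k.+1 (inner_face i y) = u i + u i.+1.
  move=> ik; rewrite /trace_cochain.
  have -> : word k.+1 (diff_word (inner_face i y)) =
      merge k (diff_word y) i (hdiff (amul (y i) (y i.+1))).
    by apply: eq_word => j _; rewrite /diff_word /inner_face; case: ifP => // _; case: eqP.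
  rewrite deltaM mergeD// !merge_mul// nuc_traceD; [|exact: nuc_upd2|exact: nuc_upd2].
  have -> : word k.+2 (upd (upd (diff_word y) i (sigma (y i))) i.+1 (hdiff (y i.+1))) =
      word k.+2 (upd (diff_word y) i (sigma (y i))).
    apply: eq_word1 => j; rewrite /upd; case: eqP => [->|//].
    by rewrite gtn_eqF.
  have -> : word k.+2 (upd (upd (diff_word y) i (hdiff (y i))) i.+1 (tau (y i.+1))) =
      word k.+2 (upd (diff_word y) i.+1 (tau (y i.+1))).
    by apply: eq_word1 => j; rewrite /upd; case: eqP => // _; case: eqP => [->|].
  by rewrite -/(f i) -/(g i.+1) /u [f i.+1]fE//; field; rewrite ?pnatr_eq0.
have L : trace_cochain k.+1 (outer_face k y) = u k.+1 + u 0%N.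
  rewrite /trace_cochain.
  have -> : word k.+1 (diff_word (outer_face k y)) =
      word k.+1 (upd (diff_word y) 0%N (hdiff (amul (y k.+1) (y 0%N)))).
    by apply: eq_word1 => j; rewrite /diff_word /outer_face /upd; case: eqP.
  rewrite deltaM word_updD// nuc_traceD; [|exact: nuc_upd|exact: nuc_upd].
  rewrite !outer_trace1//.
  have -> : word k.+2 (upd (upd (diff_word y) 0%N (hdiff (y 0%N))) k.+1 (sigma (y k.+1))) =
      word k.+2 (upd (diff_word y) k.+1 (sigma (y k.+1))).
    by apply: eq_word1 => j; rewrite /upd; case: eqP => // _; case: eqP => [->|].
  have -> : word k.+2 (upd (upd (diff_word y) 0%N (tau (y 0%N))) k.+1 (hdiff (y k.+1))) =
      word k.+2 (upd (diff_word y) 0%N (tau (y 0%N))).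
    by apply: eq_word1 => j; rewrite /upd; case: eqP => [->|//].
  by rewrite -/(f k.+1) -/(g 0%N) /u [f 0%N]fE//; field; rewrite ?pnatr_eq0.
under eq_bigr => i _ do rewrite T//.
have := alternating_telescope u (leq0n k.+1); rewrite big_mkord => ->.
by rewrite L exprS ek; ring.
Qed.

(** With a marked letter D the faces away from it telescope as before. A face through
    the mark produces kappa next to D instead of the mean of sigma and tau, and
    kappa = mean + e delta with e = 1/2 or -1/2; these defects are what remains. For
    kappa = sigma and kappa = tau they have opposite signs, so that D = sigma' and
    D = tau' together give the words with one letter sigma' - tau'. *)
Section Transgression.
Variables (D kappa : A -> bop V V) (Er : A -> A -> bop V V) (e : R[i]).
Hypothesis D_leibniz : forall a b, D (amul a b) = D a * kappa b + kappa a * D b + Er a b.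
Hypothesis kappaE : (e = 2^-1 /\ kappa = sigma) \/ (e = - 2^-1 /\ kappa = tau).

Local Notation mark y l := (upd (diff_word y) l (D (y l))).

Definition transgression_error k y : R[i] :=
  \sum_(i < k.+1) op_trace (merge k (diff_word y) i (Er (y i) (y i.+1))) +
  op_trace (word k.+1 (upd (diff_word y) 0%N (Er (y k.+1) (y 0%N)))).

Lemma transgression_coboundary k y : odd k -> (p < k)%N ->
  \sum_(i < k.+1) (-1) ^+ i * transgression k.+1 D (inner_face i y) +
  (-1) ^+ k.+1 * transgression k.+1 D (outer_face k y) =
  2 * e * \sum_(l < k.+2) op_trace (word k.+2 (mark y l)) +
  transgression_error k y.
Proof.
move=> k_odd pk; set n := k.+1.
have n_even : ~~ odd n by rewrite /= k_odd.
have en : (-1) ^+ n = 1 :> R[i] by rewrite -signr_odd (negPf n_even).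
pose W l i b := op_trace (word n.+1 (upd (mark y l) i b)).
pose f l i := W l i (sigma (y i)); pose g l i := W l i (tau (y i)).
pose E l := op_trace (word n.+1 (mark y l)).
have pn2 : (p.+1 < n.+1)%N by rewrite !ltnS ltnW.
have fE l i : (i < n.+1)%N -> i != l -> f l i = g l i + E l.
  move=> ik il; rewrite /f /g /E /W.
  have := eq_word1 n.+1 (upd_id (mark y l) i); rewrite upd_other// => <-.
  rewrite -nuc_traceD; [|exact: nuc_upd2|exact: nuc_upd2].
  by rewrite -word_updD// /diff_word /hdiff addrC subrK.
pose u l i := f l i - 2^-1 * E l.
have kE l i : (i < n.+1)%N -> i != l -> W l i (kappa (y i)) = u l i + e * E l.
  move=> ik il; rewrite /u; case: kappaE => [[-> ->]|[-> ->]]; rewrite -/(f l i) -/(g l i).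
    by rewrite subrK.
  by rewrite fE//; field; rewrite ?pnatr_eq0.
pose err i := op_trace (merge k (diff_word y) i (Er (y i) (y i.+1))).
pose h l i := u l i + u l i.+1.
(* the faces away from the marked letter *)
have away l i : (i <= k)%N -> i != l -> i.+1 != l ->
    op_trace (merge k (mark y l) i (hdiff (amul (y i) (y i.+1)))) = h l i.
  move=> ik il i1l.
  have W1 : word n.+1 (upd (upd (mark y l) i (sigma (y i))) i.+1 (hdiff (y i.+1))) =
      word n.+1 (upd (mark y l) i (sigma (y i))).
    apply: eq_word1 => j; rewrite /upd; case: eqP => [->|//].
    by rewrite gtn_eqF// (negPf i1l).
  have W2 : word n.+1 (upd (upd (mark y l) i (hdiff (y i))) i.+1 (tau (y i.+1))) =
      word n.+1 (upd (mark y l) i.+1 (tau (y i.+1))).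
    apply: eq_word1 => j; rewrite /upd; case: eqP => // _; case: eqP => [->|//].
    by rewrite (negPf il).
  rewrite deltaM mergeD// !merge_mul// W1 W2 nuc_traceD; [|exact: nuc_upd2|exact: nuc_upd2].
  by rewrite -/(W l i _) -/(f l i) -/(W l i.+1 _) -/(g l i.+1) /h /u [f l i.+1]fE//; field; rewrite ?pnatr_eq0.
have inner i j : (i < n)%N -> (j < n)%N ->
    op_trace (word n (upd (diff_word (inner_face i y)) j (D (inner_face i y j)))) =
    (if (j < i)%N then h j i else if (i < j)%N then h j.+1 i
     else (u i i.+1 + e * E i) + (u i.+1 i + e * E i.+1)) + (if j == i then err i else 0).
  move=> i_n j_n; have [ji|ij|->] := ltngtP j i.
  - rewrite addr0 -away//; [|by rewrite gtn_eqF|by rewrite gtn_eqF// ltnW].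
    congr op_trace; apply: eq_word => l _; rewrite /diff_word /inner_face /upd ji.
    case: (ltngtP l i) => li //.
    + by rewrite (gtn_eqF (ltn_trans ji li)) (gtn_eqF (leqW (ltn_trans ji li))).
    + by rewrite li gtn_eqF.
  - rewrite addr0 -away//; [|by rewrite ltn_eqF// ltnW|by rewrite eqSS ltn_eqF].
    congr op_trace; apply: eq_word => l _; rewrite /diff_word /inner_face /upd.
    rewrite (ltnNge j) (ltnW ij) (gtn_eqF ij) eqSS /=.
    case: (ltngtP l i) => li //.
    + by rewrite (ltn_eqF (ltn_trans li ij)) (ltn_eqF (leqW (ltn_trans li ij))).
    + by rewrite li ltn_eqF.
  - have -> : word n (upd (diff_word (inner_face i y)) i (D (inner_face i y i))) =
        merge k (diff_word y) i (D (amul (y i) (y i.+1))).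
      apply: eq_word => l _; rewrite /upd /diff_word /inner_face ltnn eqxx.
      by case: ltngtP.
    rewrite D_leibniz !mergeD// !merge_mul//.
    have mn b : nuc (merge k (diff_word y) i b).
      rewrite -[b]mulr1 merge_mul//; exact: nuc_upd2.
    rewrite nuc_traceD; [|apply: nucD; exact: nuc_upd2|exact: mn].
    rewrite nuc_traceD; [|exact: nuc_upd2|exact: nuc_upd2]; congr (_ + _ + _).
      by rewrite -kE// gtn_eqF.
    rewrite -kE ?ltn_eqF// 1?ltnW//; congr op_trace; apply: eq_word1.
    by apply: updC; rewrite ltn_eqF.
have outer j : (j < n)%N ->
    op_trace (word n (upd (diff_word (outer_face k y)) j (D (outer_face k y j)))) =
    (if j == 0%N then (u n 0%N + e * E n) + (u 0%N n + e * E 0%N) else u j n + u j 0%N) +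
    (if j == 0%N then op_trace (word n (upd (diff_word y) 0%N (Er (y n) (y 0%N)))) else 0).
  move=> jn; have [->|j0] := eqVneq j 0%N.
    have -> : word n (upd (diff_word (outer_face k y)) 0%N (D (outer_face k y 0%N))) =
        word n (upd (diff_word y) 0%N (D (amul (y n) (y 0%N)))).
      by apply: eq_word1 => l; rewrite /upd /diff_word /outer_face; case: eqP.
    rewrite D_leibniz !word_updD//.
    rewrite nuc_traceD; [|apply: nucD; apply: nuc_upd; exact: leqW|apply: nuc_upd; exact: leqW].
    rewrite nuc_traceD; [|apply: nuc_upd; exact: leqW|apply: nuc_upd; exact: leqW]; congr (_ + _ + _).
      rewrite outer_trace1 ?leqW// -kE//; congr op_trace; apply: eq_word1.
      exact: updC.
    by rewrite outer_trace1 ?leqW// -kE.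
  have -> : word n (upd (diff_word (outer_face k y)) j (D (outer_face k y j))) =
      word n (upd (mark y j) 0%N (hdiff (amul (y n) (y 0%N)))).
    apply: eq_word1 => l; rewrite /upd /diff_word /outer_face (negPf j0).
    by case: (eqVneq l 0%N) => // ->; rewrite eq_sym (negPf j0).
  have U b : word n.+1 (upd (upd (mark y j) 0%N (hdiff (y 0%N))) n b) =
      word n.+1 (upd (mark y j) n b).
    apply: eq_word1 => l; rewrite /upd; case: eqP => // _; case: (eqVneq l 0%N) => // ->.
    by rewrite eq_sym (negPf j0).
  have U' b : word n.+1 (upd (upd (mark y j) 0%N b) n (hdiff (y n))) =
      word n.+1 (upd (mark y j) 0%N b).
    apply: eq_word1 => l; rewrite /upd; case: eqP => // ->.
    by rewrite (gtn_eqF jn).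
  rewrite addr0 deltaM word_updD// nuc_traceD; [|exact: nuc_upd2|exact: nuc_upd2].
  rewrite !outer_trace// U U' -/(W j n _) -/(W j 0%N _) -/(f j n) -/(g j 0%N) /u.
  by rewrite [f j 0%N]fE ?[0%N == _]eq_sym//; field; rewrite ?pnatr_eq0.
have := marked_merges_sum u (fun l => e * E l) n_even isT; rewrite -/n => M.
rewrite -mulr_sumr mulrA in M; rewrite -M en mul1r /transgression /transgression_error.
have -> : \sum_(i < n) (-1) ^+ i * (\sum_(j < n) (-1) ^+ j *
     op_trace (word n (upd (diff_word (inner_face i y)) j (D (inner_face i y j))))) =
   \sum_(i < n) (-1) ^+ i * (\sum_(j < n) (-1) ^+ j * (if (j < i)%N then h j i else if (i < j)%N then h j.+1 i
     else (u i i.+1 + e * E i) + (u i.+1 i + e * E i.+1))) + \sum_(i < n) err i.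
  rewrite -big_split /=; apply: eq_bigr => i _.
  under eq_bigr => j _ do rewrite inner// mulrDr.
  rewrite big_split /= mulrDr; congr (_ + _); rewrite (bigD1 i)//= eqxx big1 ?addr0.
    by rewrite mulrA -expr2 sqrr_sign mul1r.
  by move=> j ji; rewrite val_eqE (negPf ji) mulr0.
have -> : \sum_(j < n) (-1) ^+ j *
     op_trace (word n (upd (diff_word (outer_face k y)) j (D (outer_face k y j)))) =
   \sum_(j < n) (-1) ^+ j * (if val j == 0%N then (u n 0%N + e * E n) + (u 0%N n + e * E 0%N)
     else u j n + u j 0%N) + op_trace (word n (upd (diff_word y) 0%N (Er (y n) (y 0%N)))).
  under eq_bigr => j _ do rewrite outer// mulrDr.
  rewrite big_split /=; congr (_ + _); rewrite big_ord_recl /= mul1r big1 ?addr0//.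
  by move=> j _; rewrite mulr0.
rewrite -/n; ring.
Qed.

End Transgression.
End CyclicWords.

(** * Multilinearity and cyclicity *)

Section CyclicCochains.
Variables (R : realType) (V : hilbertType R) (p : nat) (A : assocAlgType R[i]).
Hypothesis p_gt0 : (0 < p)%N.
Variables sigma tau : A -> bop V V.
Hypothesis sigma_lin : linear sigma.
Hypothesis tau_lin : linear tau.
Hypothesis delta_sch : forall a, sch p (hdiff sigma tau a).

Implicit Types (y : nat -> A) (D : A -> bop V V).
Local Notation phi := (trace_cochain sigma tau).
Local Notation psi := (transgression sigma tau).
Local Notation dword := (diff_word sigma tau).
Local Notation delta := (hdiff sigma tau).

Lemma eq_trace_cochain N y y' : (forall j, (j < N)%N -> y j = y' j) -> phi N y = phi N y'.
Proof.
by move=> yy; rewrite /trace_cochain; congr op_trace; apply: eq_word => j jN; rewrite /diff_word yy.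
Qed.

Lemma eq_transgression N D y y' : (forall j, (j < N)%N -> y j = y' j) -> psi N D y = psi N D y'.
Proof.
move=> yy; apply: eq_bigr => j _; congr (_ * op_trace _); apply: eq_word => l lN.
by rewrite /upd /dword !yy.
Qed.

Lemma hochschild_trace_cochain k (x : 'I_k.+2 -> A) :
  hochschild (fun x : 'I_k.+1 -> A => phi k.+1 (natseq x)) x =
  \sum_(i < k.+1) (-1) ^+ i * phi k.+1 (inner_face i (natseq x)) +
  (-1) ^+ k.+1 * phi k.+1 (outer_face k (natseq x)).
Proof.
have inner i : phi k.+1 (natseq (face i x)) = phi k.+1 (inner_face i (natseq x)).
  by apply: eq_trace_cochain => j jk; exact: natseq_face.
have outer : phi k.+1 (natseq (last_face x)) = phi k.+1 (outer_face k (natseq x)).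
  by apply: eq_trace_cochain => j jk; exact: natseq_last_face.
by rewrite /hochschild outer; under eq_bigr do rewrite inner.
Qed.

Lemma hochschild_transgression k D (x : 'I_k.+2 -> A) :
  hochschild (fun x : 'I_k.+1 -> A => psi k.+1 D (natseq x)) x =
  \sum_(i < k.+1) (-1) ^+ i * psi k.+1 D (inner_face i (natseq x)) +
  (-1) ^+ k.+1 * psi k.+1 D (outer_face k (natseq x)).
Proof.
have inner i : psi k.+1 D (natseq (face i x)) = psi k.+1 D (inner_face i (natseq x)).
  by apply: eq_transgression => j jk; exact: natseq_face.
have outer : psi k.+1 D (natseq (last_face x)) = psi k.+1 D (outer_face k (natseq x)).
  by apply: eq_transgression => j jk; exact: natseq_last_face.
by rewrite /hochschild outer; under eq_bigr do rewrite inner.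
Qed.

Lemma natseq_ordS k (x : 'I_k.+1 -> A) j : (j < k.+1)%N ->
  natseq (fun j => x (ordS j)) j = if (j < k)%N then natseq x j.+1 else natseq x 0%N.
Proof.
move=> jk; rewrite /natseq; case: ifPn => jk'; congr x; apply: val_inj => /=.
  by rewrite !inordK// modn_small.
have -> : j = k by apply/eqP; rewrite eqn_leq -ltnS jk leqNgt.
by rewrite !inordK// modnn.
Qed.

Lemma trace_cochain_rot k (x : 'I_k.+1 -> A) : (p <= k)%N ->
  phi k.+1 (natseq (fun j => x (ordS j))) = phi k.+1 (natseq x).
Proof.
move=> pk; apply: (@word_trace_rot _ _ _ p_gt0 k _ _ [::]); rewrite ?addn0//.
- by move=> j _ _; exact: delta_sch.
- by move=> j jk; rewrite /diff_word natseq_ordS ?jk// ltnS ltnW.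
by rewrite /diff_word natseq_ordS// ltnn.
Qed.

Lemma transgression_rot k D (x : 'I_k.+1 -> A) : odd k -> (p < k)%N ->
  psi k.+1 D (natseq (fun j => x (ordS j))) = - psi k.+1 D (natseq x).
Proof.
move=> k_odd pk; set y := natseq x; set z := natseq _.
pose t j := op_trace (word k.+1 (upd (dword y) j (D (y j)))).
have rot v l : (forall j, (j < k)%N -> v j = upd (dword y) l (D (y l)) j.+1) ->
    v k = upd (dword y) l (D (y l)) 0%N -> op_trace (word k.+1 v) = t l.
  apply: (@word_trace_rot _ _ _ p_gt0 k v _ [:: l]); first by rewrite /= addn1.
  by move=> j _; rewrite inE => jl; exact: upd_sch.
have zS j : (j < k)%N -> z j = y j.+1 by move=> jk; rewrite /z natseq_ordS ?jk// ltnS ltnW.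
have zk : z k = y 0%N by rewrite /z natseq_ordS// ltnn.
have tz (j : 'I_k) : op_trace (word k.+1 (upd (dword z) j (D (z j)))) = t j.+1.
  apply: rot => [l lk|]; rewrite /upd.
    by rewrite eqSS zS// /diff_word zS.
  by rewrite gtn_eqF// /diff_word zk.
have tzk : op_trace (word k.+1 (upd (dword z) k (D (z k)))) = t 0%N.
  apply: rot => [l lk|]; rewrite /upd; last by rewrite !eqxx zk.
  by rewrite ltn_eqF// /diff_word zS.
rewrite /transgression big_ord_recr [in RHS]big_ord_recl opprD -sumrN [RHS]addrC.
rewrite tzk -[X in _ = _ - _ * X]/(t 0%N) -signr_odd k_odd expr1 expr0 mulN1r mul1r; congr (_ - _).
apply: eq_bigr => j _; rewrite tz.
by rewrite -[lift ord0 j : nat]/j.+1 exprS mulN1r mulNr opprK.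
Qed.

(** The counterpart of [dfwith] for sequences indexed by nat. *)
Definition seqwith y i (a : A) : nat -> A := fun j => if j == i then a else y j.

Lemma natseq_dfwith k (x : 'I_k.+1 -> A) (i : 'I_k.+1) a j : (j < k.+1)%N ->
  natseq (@dfwith _ (fun=> A) x i a) j = seqwith (natseq x) i a j.
Proof.
move=> jk; rewrite /natseq /seqwith; case: eqP => [->|/eqP ji].
  by rewrite inord_val dfwithin.
by rewrite dfwithout// -val_eqE /= inordK// eq_sym.
Qed.

Lemma delta_lin : linear delta.
Proof.
by move=> z a b; rewrite /hdiff sigma_lin tau_lin scalerBr opprD addrACA.
Qed.

Lemma word_linear N (w : nat -> bop V V) i z (b c : bop V V) : (i < N)%N ->
  nuc (word N (upd w i b)) -> nuc (word N (upd w i c)) ->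
  op_trace (word N (upd w i (z *: b + c))) =
  z * op_trace (word N (upd w i b)) + op_trace (word N (upd w i c)).
Proof.
move=> iN nb nc; have nz : nuc (word N (upd w i (z *: b))).
  by case: nb => B nb; rewrite word_updZ//; have [B' ?] := nuclear_lmap (z *: bop1 V) nb; exists B';
  rewrite (_ : z *: _ = bopM (z *: bop1 V) (word N (upd w i b)))//; apply/bopP.
by rewrite word_updD// nuc_traceD// word_updZ// nuc_traceZ.
Qed.

Lemma trace_cochain_multilinear k : (p <= k)%N ->
  multilinear (fun x : 'I_k.+1 -> A => phi k.+1 (natseq x)).
Proof.
move=> pk i x z a b.
have E c : phi k.+1 (natseq (@dfwith _ (fun=> A) x i c)) =
    op_trace (word k.+1 (upd (dword (natseq x)) i (delta c))).
  rewrite /trace_cochain; congr op_trace; apply: eq_word => j jk.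
  by rewrite /diff_word natseq_dfwith// /seqwith /upd; case: eqP.
by rewrite !E delta_lin word_linear//; apply: (nuc_upd p_gt0 delta_sch); rewrite ltnS.
Qed.

Lemma transgression_multilinear k D : linear D -> (p < k)%N ->
  multilinear (fun x : 'I_k.+1 -> A => psi k.+1 D (natseq x)).
Proof.
move=> D_lin pk i x z a b; set y := natseq x.
have E c : psi k.+1 D (natseq (@dfwith _ (fun=> A) x i c)) = psi k.+1 D (seqwith y i c).
  by apply: eq_transgression => j jk; exact: natseq_dfwith.
rewrite !E /psi mulr_sumr -big_split /=; apply: eq_bigr => j _.
rewrite mulrCA -mulrDr; congr (_ * _).
have [ij|ji] := eqVneq (val j) (val i).
  have H c : word k.+1 (upd (dword (seqwith y i c)) j (D (seqwith y i c j))) =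
      word k.+1 (upd (dword y) i (D c)).
    apply: eq_word1 => l; rewrite /upd /dword /seqwith /= ij eqxx.
    by case: eqP.
  by rewrite !H D_lin word_linear//; apply: (nuc_upd p_gt0 delta_sch); exact: leqW.
have H c : word k.+1 (upd (dword (seqwith y i c)) j (D (seqwith y i c j))) =
    word k.+1 (upd (upd (dword y) j (D (y j))) i (delta c)).
  apply: eq_word1 => l; rewrite /upd /dword /seqwith (negPf ji).
  by case: eqVneq => [->|_]; [rewrite (negPf ji)|case: eqP].
by rewrite !H delta_lin word_linear//; exact: (nuc_upd2 p_gt0 delta_sch).
Qed.

Hypothesis sigmaM : forall a b, sigma (amul a b) = sigma a * sigma b.
Hypothesis tauM : forall a b, tau (amul a b) = tau a * tau b.

Lemma trace_cochain_cyclic_cocycle k : ~~ odd k -> (p <= k)%N ->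
  cyclic_cocycle (fun x : 'I_k.+1 -> A => phi k.+1 (natseq x)).
Proof.
move=> k_even pk; split; first split.
- exact: trace_cochain_multilinear.
- by move=> x; rewrite trace_cochain_rot// -signr_odd (negPf k_even) expr0 mul1r.
- by move=> x; rewrite hochschild_trace_cochain (trace_cochain_cocycle p_gt0 sigmaM tauM delta_sch).
Qed.

Lemma transgression_cyclic k D : odd k -> (p < k)%N -> linear D ->
  cyclic_cochain (fun x : 'I_k.+1 -> A => psi k.+1 D (natseq x)).
Proof.
move=> k_odd pk D_lin; split; first exact: transgression_multilinear.
by move=> x; rewrite transgression_rot// -signr_odd k_odd expr1 mulN1r opprK.
Qed.

End CyclicCochains.

(** * Ultralimits *)

Section Ultralimit.
Variable R : realType.
Implicit Types (u v : nat -> R[i]) (z l : R[i]).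

Definition bounded_seq u := exists M : R, forall n, rnorm (u n) <= M.

(** Bounded sets of complex numbers are compact, so bounded sequences converge along
    an ultrafilter that contains the cofinite sets. *)
Lemma ultralimit_exists : exists L : (nat -> R[i]) -> R[i],
  [/\ forall u v, bounded_seq u -> bounded_seq v -> L (fun n => u n + v n) = L u + L v,
      forall z u, bounded_seq u -> L (fun n => z * u n) = z * L u &
      forall u l, cvs u l -> L u = l].
Proof.
have [U [Uu sub]] := ultraFilterLemma eventually_filter.
have Up : ProperFilter U by case: Uu.
pose ulim u l := forall e : R, 0 < e -> U [set n | rnorm (u n - l) < e].
have ulim_real (r : nat -> R) (M : R) : (forall n, `|r n| <= M) ->
    exists a, forall e : R, 0 < e -> U [set n | `|r n - a| < e].
  move=> rM; have rU : (r @ U) `[- M, M]%classic.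
    by apply: sub; exists 0%N => // n _ /=; rewrite in_itv /= -ler_norml.
  have [a [_ ra]] := @segment_compact R (- M) M (r @ U) _ rU.
  exists a => e e0; have [//|H] := in_ultra_setVsetC [set n | `|r n - a| < e] Uu.
  have [||x [/= xe xa]] := ra [set x | ~ (`|x - a| < e)] [set x | `|x - a| < e].
  - exact: H.
  - by apply/nbhs_ballP; exists e => // x; rewrite /ball /= distrC.
  - by case: xe.
have ulim_ex u : bounded_seq u -> exists l, ulim u l.
  move=> [M uM].
  have [|a ua] := ulim_real (fun n => Re (u n)) M; first by move=> n; rewrite (le_trans (ler_Re_rnorm _)).
  have [|b ub] := ulim_real (fun n => complex.Im (u n)) M; first by move=> n; rewrite (le_trans (ler_Im_rnorm _)).
  exists (Complex a b) => e e0; have e20 : 0 < e / 2 by rewrite divr_gt0.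
  apply: filterS (filterI (ua _ e20) (ub _ e20)) => n /= [A B].
  apply: le_lt_trans (rnorm_ReIm _) _; rewrite [ltRHS]splitr.
  by move: A B; case: (u n) => c d /= A B; exact: ltrD.
have ulim_unique u l l' : ulim u l -> ulim u l' -> l = l'.
  move=> ul ul'; apply/eqP; rewrite -subr_eq0 -rnorm_eq0 eq_le rnorm_ge0 andbT.
  apply/ler_addgt0Pr => e e0; rewrite add0r; have e20 : 0 < e / 2 by rewrite divr_gt0.
  have [n /= [A B]] := filter_ex (filterI (ul _ e20) (ul' _ e20)).
  apply: le_trans (rnorm_triB (u n) _ _) _; rewrite [leRHS]splitr lerD ?(ltW B)//.
  by rewrite rnormBC ltW.
pose L u := xget 0 [set l | ulim u l].
have LE u l : ulim u l -> L u = l.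
  move=> ul; have H : [set l | ulim u l] (L u) by apply: (xgetPex 0); exists l.
  exact: ulim_unique H ul.
exists L; split=> [u v bu bv|z u bu|u l /cvsP ul].
- have [[a ua] [b vb]] := (ulim_ex u bu, ulim_ex v bv).
  rewrite (LE _ _ ua) (LE _ _ vb); apply: LE => e e0.
  have e20 : 0 < e / 2 by rewrite divr_gt0.
  apply: filterS (filterI (ua _ e20) (vb _ e20)) => n /= [A B].
  by rewrite opprD addrACA (le_lt_trans (rnormD _ _))// [ltRHS]splitr ltrD.
- have [a ua] := ulim_ex u bu; rewrite (LE _ _ ua); apply: LE => e e0.
  have z1 : 0 < rnorm z + 1 by rewrite ltr_wpDl ?rnorm_ge0.
  apply: filterS (ua _ (divr_gt0 e0 z1)) => n /=; rewrite ltr_pdivlMr// => A.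
  rewrite -mulrBr rnormM; apply: le_lt_trans A; rewrite mulrC ler_wpM2l ?rnorm_ge0//.
  by rewrite lerDl.
- by apply: LE => e /ul [N uN]; apply: sub; exists N.
Qed.

End Ultralimit.

(** * Second order expansion of a word *)

Section WordExpansion.
Variables (R : realType) (V : hilbertType R).
Implicit Types (d w : nat -> bop V V).

(** The l-th term of the telescoping sum for word N w - word N d. *)
Definition mix w d l : nat -> bop V V :=
  fun j => if (j < l)%N then w j else if j == l then w j - d j else d j.

Lemma word_sub N w d : word N w - word N d = \sum_(l < N) word N (mix w d l).
Proof.
elim: N => [|N IHN]; first by rewrite big_ord0 /word !big_ord0 subrr.
rewrite big_ord_recr /= {1 2 4}/word !big_ord_recr /= -/(word N w) -/(word N d).
have -> : \prod_(i < N) mix w d N i = word N w.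
  by apply: eq_bigr => j _; rewrite /mix ltn_ord.
have -> : mix w d N N = w N - d N by rewrite /mix ltnn eqxx.
have -> : \sum_(i < N) word N.+1 (mix w d i) = (word N w - word N d) * d N.
  rewrite IHN mulr_suml; apply: eq_bigr => i _; rewrite {1}/word big_ord_recr /=.
  by congr (_ * _); rewrite /mix ltnNge ltnW//= gtn_eqF.
by rewrite mulrBl mulrBr [RHS]addrC subrKA.
Qed.

(** For i < l, the words of the second order part of word N w - word N d: expanding
    the prefix w_0 .. w_(l-1) of the l-th first order term around d_0 .. d_(l-1)
    produces a second difference at i. *)
Definition mix2 w d i l : nat -> bop V V :=
  upd (fun j => if (j < l)%N then mix w d i j else d j) l (w l - d l).

Lemma word_sub_second_order N w d :
  word N w - word N d - \sum_(l < N) word N (upd d l (w l - d l)) =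
  \sum_(l < N) \sum_(i < l) word N (mix2 w d i l).
Proof.
rewrite word_sub -sumrB; apply: eq_bigr => l _.
have -> : word N (mix w d l) = word N (upd (fun j => if (j < l)%N then w j else d j) l (w l - d l)).
  by apply: eq_word1 => j; rewrite /mix /upd; case: ltngtP => // ->.
have P (v : nat -> bop V V) : word N (upd (fun j => if (j < l)%N then v j else d j) l (w l - d l)) =
    word l v * (w l - d l) * \prod_(l.+1 <= j < N) d j.
  rewrite word_upd//; congr (_ * _ * _).
    rewrite /word -(big_mkord xpredT); apply: eq_big_nat => j /andP[_ ->//].
  by apply: eq_big_nat => j /andP[lj _]; rewrite ltnNge ltnW.
have -> : word N (upd d l (w l - d l)) = word N (upd (fun j => if (j < l)%N then d j else d j) l (w l - d l)).
  by apply: eq_word1 => j; rewrite /upd if_same.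
by rewrite !P -!mulrBl word_sub !mulr_suml; apply: eq_bigr => i _; rewrite P.
Qed.

Variable p : nat.
Hypothesis p_gt0 : (0 < p)%N.

Lemma prod_two_le N (i l : nat) (a b G : R) : (i < N)%N -> (l < N)%N -> i != l ->
  0 <= a -> 0 <= b -> 1 <= G ->
  \prod_(j < N) (if val j == i then a else if val j == l then b else G) <= a * b * G ^+ N.
Proof.
move=> iN lN il a0 b0 G1; have G0 : 0 <= G := le_trans ler01 G1.
rewrite (bigD1 (Ordinal iN))//= eqxx (bigD1 (Ordinal lN))/=; last by rewrite -val_eqE /= eq_sym.
rewrite eq_sym (negPf il) eqxx -mulrA !ler_wpM2l//.
apply: le_trans (_ : \prod_(j < N) G <= _); last by rewrite prodr_const card_ord.
rewrite big_mkcond; apply: ler_prod => j _.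
case: ifP => [/andP[ji jl]|_]; last by rewrite ler01 G1.
rewrite -val_eqE /= in ji; rewrite -val_eqE /= in jl.
by rewrite (negPf ji) (negPf jl) G0 lexx.
Qed.

Lemma prod_one_le N (i : nat) (a G : R) : (i < N)%N -> 0 <= a -> 1 <= G ->
  \prod_(j < N) (if val j == i then a else G) <= a * G ^+ N.
Proof.
move=> iN a0 G1; have G0 : 0 <= G := le_trans ler01 G1.
rewrite (bigD1 (Ordinal iN))//= eqxx ler_wpM2l//.
apply: le_trans (_ : \prod_(j < N) G <= _); last by rewrite prodr_const card_ord.
rewrite big_mkcond; apply: ler_prod => j _.
case: ifP => [ji|_]; last by rewrite ler01 G1.
by rewrite -val_eqE /= in ji; rewrite (negPf ji) G0 lexx.
Qed.

(** Bound for the trace of a word of N letters of gauge G; the multiplicity 2 is that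
    of a difference of two Schatten operators. *)
Definition word_cst N (G : R) : R := (N * 2)%:R * (G ^+ N * p%:R).

Lemma word_cst_ge0 N G : 0 <= G -> 0 <= word_cst N G.
Proof. by move=> G0; rewrite !mulr_ge0// exprn_ge0. Qed.

Lemma trace_one_bad N (w : nat -> bop V V) i (a G : R) : (p < N)%N -> (i < N)%N ->
  0 < a -> 1 <= G -> (forall j, (j < N)%N -> j != i -> gauge p 2 1 (w j) G) ->
  (forall x, rnorm (w i x) <= a * rnorm x) ->
  rnorm (op_trace (word N w)) <= a * word_cst N G.
Proof.
move=> pN iN a0 G1 wG wa.
have -> : a * word_cst N G = (N * 2)%:R * (a * G ^+ N * p%:R) by rewrite /word_cst; ring.
apply: le_trans (_ : (N * 2)%:R * (\prod_(j < N) (if val j == i then a else G) * p%:R) <= _).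
  apply: (@word_trace_le _ _ _ p_gt0 _ _ [:: i] 2 (fun j => if j == i then a else G)).
  - by rewrite /= addn1.
  - by move=> j jN; rewrite inE => ji; rewrite (negPf ji); exact: wG.
  - by move=> j _; rewrite inE => /eqP ->; rewrite eqxx.
by rewrite ler_wpM2l// ler_wpM2r// prod_one_le// ltW.
Qed.

Lemma trace_two_bad N (w : nat -> bop V V) i l (a b G : R) : (p < N)%N -> (i < N)%N ->
  (l < N)%N -> i != l -> 0 < a -> 1 <= G ->
  (forall j, (j < N)%N -> j != i -> j != l -> gauge p 2 1 (w j) G) ->
  gauge p 2 1 (w l) b -> (forall x, rnorm (w i x) <= a * rnorm x) ->
  rnorm (op_trace (word N w)) <= a * b * word_cst N G.
Proof.
move=> pN iN lN il a0 G1 wG wl wa; have b0 := gauge_gt0 wl.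
have -> : a * b * word_cst N G = (N * 2)%:R * (a * b * G ^+ N * p%:R) by rewrite /word_cst; ring.
apply: le_trans (_ : (N * 2)%:R * (\prod_(j < N) (if val j == i then a else if val j == l then b else G) * p%:R) <= _).
  apply: (@word_trace_le _ _ _ p_gt0 _ _ [:: i] 2 (fun j => if j == i then a else if j == l then b else G)).
  - by rewrite /= addn1.
  - move=> j jN; rewrite inE => ji; rewrite (negPf ji).
    by case: eqVneq => [->//|jl]; exact: wG.
  - by move=> j _; rewrite inE => /eqP ->; rewrite eqxx.
by rewrite ler_wpM2l// ler_wpM2r// prod_two_le// ltW.
Qed.

End WordExpansion.

(** * Linear operations and limits of cyclic cochains *)

Section HochschildLinear.
Variables (R : realType) (A : assocAlgType R[i]) (k : nat).
Implicit Types (f g : cochain A k).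

Lemma hochschildD f g x :
  hochschild (fun y => f y + g y) x = hochschild f x + hochschild g x.
Proof.
rewrite /hochschild mulrDr addrACA -big_split /=; congr (_ + _).
by apply: eq_bigr => i _; rewrite mulrDr.
Qed.

Lemma hochschildZ z f x : hochschild (fun y => z * f y) x = z * hochschild f x.
Proof.
rewrite /hochschild mulrDr mulr_sumr mulrCA; congr (_ + _).
by apply: eq_bigr => i _; rewrite mulrCA.
Qed.

Lemma hochschild0 x : hochschild (fun _ : 'I_k.+1 -> A => 0) x = 0.
Proof. by rewrite /hochschild mulr0 addr0 big1// => i _; rewrite mulr0. Qed.

Lemma hochschild_sum I (s : seq I) (f : I -> cochain A k) x :
  hochschild (fun y => \sum_(i <- s) f i y) x = \sum_(i <- s) hochschild (f i) x.
Proof.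
elim: s => [|i s IHs].
  rewrite big_nil -[RHS](hochschild0 x); congr (hochschild _ x).
  by apply/funext => y; rewrite big_nil.
rewrite big_cons -IHs -hochschildD; congr (hochschild _ x).
by apply/funext => y; rewrite big_cons.
Qed.

Lemma cyclic_cochain0 : cyclic_cochain (fun _ : 'I_k.+1 -> A => 0).
Proof.
split; first by move=> i x z a b; rewrite mulr0 addr0.
by move=> x; rewrite mulr0.
Qed.

Lemma cyclic_cochainD f g : cyclic_cochain f -> cyclic_cochain g ->
  cyclic_cochain (fun y => f y + g y).
Proof.
move=> [fl fc] [gl gc]; split=> [i x z a b|x].
  by rewrite fl gl mulrDr addrACA.
by rewrite fc gc -mulrDr.
Qed.

Lemma cyclic_cochainZ z f : cyclic_cochain f -> cyclic_cochain (fun y => z * f y).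
Proof.
move=> [fl fc]; split=> [i x w a b|x]; last by rewrite fc mulrCA.
by rewrite fl mulrDr [z * (w * _)]mulrCA.
Qed.

Lemma cyclic_cochain_sum I (s : seq I) (f : I -> cochain A k) :
  (forall i, cyclic_cochain (f i)) -> cyclic_cochain (fun y => \sum_(i <- s) f i y).
Proof.
move=> fc; elim: s => [|i s IHs].
  by under eq_fun do rewrite big_nil; exact: cyclic_cochain0.
by under eq_fun do rewrite big_cons; exact: cyclic_cochainD.
Qed.

(** Every condition on a cyclic cochain, and every value of its coboundary, is a finite
    linear relation between values, so it survives a pointwise ultralimit. *)
Lemma cyclic_cochain_ultralimit (F : nat -> cochain A k) :
  (forall n, cyclic_cochain (F n)) -> (forall x, bounded_seq (fun n => F n x)) ->
  exists2 f, cyclic_cochain f & forall (x : 'I_k.+2 -> A) l,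
    cvs (fun n => hochschild (F n) x) l -> hochschild f x = l.
Proof.
move=> Fc Fb; have [L [LD LZ Lcvs]] := ultralimit_exists R.
pose f : cochain A k := fun x => L (fun n => F n x).
have bZ (z : R[i]) (u : nat -> R[i]) : bounded_seq u -> bounded_seq (fun n => z * u n).
  by move=> [M uM]; exists (rnorm z * M) => n; rewrite rnormM ler_wpM2l ?rnorm_ge0.
have bD (u v : nat -> R[i]) : bounded_seq u -> bounded_seq v -> bounded_seq (fun n => u n + v n).
  move=> [M uM] [N vN]; exists (M + N) => n.
  by rewrite (le_trans (rnormD _ _))// lerD.
have bS I (s : seq I) (u : I -> nat -> R[i]) : (forall i, bounded_seq (u i)) ->
    bounded_seq (fun n => \sum_(i <- s) u i n) /\
    L (fun n => \sum_(i <- s) u i n) = \sum_(i <- s) L (u i).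
  move=> ub; elim: s => [|i s [IHb IHs]].
    have E : (fun n => \sum_(i <- [::]) u i n) = fun=> 0 by apply/funext => n; rewrite big_nil.
    rewrite E big_nil; split; first by exists 0 => n; rewrite rnorm0.
    exact/Lcvs/cvs_cst.
  have E : (fun n => \sum_(j <- i :: s) u j n) = fun n => u i n + \sum_(j <- s) u j n.
    by apply/funext => n; rewrite big_cons.
  by rewrite E big_cons LD// IHs; split=> //; exact: bD.
exists f.
  split=> [i x z a b|x].
    rewrite /f -LZ// -LD//; last exact: bZ.
    by congr L; apply/funext => n; case: (Fc n) => ->.
  rewrite /f -LZ//; congr L; apply/funext => n; by case: (Fc n) => _ ->.
move=> x l Fl; rewrite -(Lcvs _ _ Fl) /hochschild LD; last by exact: bZ.
  have [_ ->] := bS _ (index_enum 'I_k.+1) (fun i n => (-1) ^+ i * F n (face i x)) (fun i => bZ _ _ (Fb _)).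
  by rewrite LZ//; congr (_ + _); apply: eq_bigr => i _; rewrite LZ.
by have [] := bS _ (index_enum 'I_k.+1) (fun i n => (-1) ^+ i * F n (face i x)) (fun i => bZ _ _ (Fb _)).
Qed.

End HochschildLinear.

(** * Homotopy invariance on one Hilbert space *)

Section Homotopy.
Variables (R : realType) (V : hilbertType R) (p : nat) (A : assocAlgType R[i]).
Hypothesis p_gt0 : (0 < p)%N.
Hypothesis p_even : ~~ odd p.
Variables sigma tau : R -> A -> bop V V.
Implicit Types (t u v e h : R) (D : A -> bop V V).

Local Notation I01 t := (0 <= t <= 1).
Local Notation delta t := (hdiff (sigma t) (tau t)).
Local Notation dword t := (diff_word (sigma t) (tau t)).

Definition norm_lipschitz (s : R -> A -> bop V V) := forall a, exists2 M, 0 < M &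
  forall u v, I01 u -> I01 v -> forall x, rnorm ((s u a - s v a) x) <= M * `|u - v| * rnorm x.

Hypothesis sigma_lin : forall t, I01 t -> linear (sigma t).
Hypothesis tau_lin : forall t, I01 t -> linear (tau t).
Hypothesis sigmaM : forall t, I01 t -> forall a b, sigma t (amul a b) = sigma t a * sigma t b.
Hypothesis tauM : forall t, I01 t -> forall a b, tau t (amul a b) = tau t a * tau t b.
Hypothesis sigma_lip : norm_lipschitz sigma.
Hypothesis tau_lip : norm_lipschitz tau.
Hypothesis delta_gauge : forall a t, I01 t -> exists g, gauge p 1 1 (delta t a) g.
Hypothesis delta_cont : forall a t e, I01 t -> 0 < e -> exists2 d, 0 < d &
  forall u, I01 u -> `|u - t| < d -> gauge p 1 1 (delta u a - delta t a) e.

(** Continuity in the Schatten norm bounds the gauge near each point, at the price of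
    m = 2, and compactness bounds it on [0,1]. *)
Lemma delta_gauge_bounded a : exists2 G, 0 < G &
  forall t, I01 t -> gauge p 2 1 (delta t a) G.
Proof.
apply: (@segment_bound _ 0 1 (fun G t => gauge p 2 1 (delta t a) G)).
  by move=> t M M' _ MM'; exact: gauge_le.
move=> t t01; have [g gt] := delta_gauge a t01.
have [d d0 dt] := delta_cont a t01 ltr01.
exists (2 * (1 + g)), d; split=> //.
  by rewrite mulr_gt0// addr_gt0// (gauge_gt0 gt).
by move=> u u01 /(dt u u01) H; have := gauge1_add p_gt0 H gt; rewrite subrK.
Qed.

Lemma delta_unif_cont a e : 0 < e -> exists2 M, 0 < M &
  forall t u, I01 t -> I01 u -> `|u - t| < M^-1 -> gauge p 2 1 (delta u a - delta t a) e.
Proof.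
move=> e0; pose P M t := forall u, I01 u -> `|u - t| < M^-1 -> gauge p 2 1 (delta u a - delta t a) e.
have [||M M0 H] := @segment_bound _ 0 1 P; last by exists M => // t u t01; exact: H.
  move=> t M M' M0 MM' H u u01 ut; apply: H => //; apply: lt_le_trans ut _.
  by rewrite lef_pV2 ?posrE// (lt_le_trans M0).
move=> t t01; have e40 : 0 < e / 4 by rewrite divr_gt0.
have [d d0 dt] := delta_cont a t01 e40.
exists (2 / d), (d / 2); split; rewrite ?divr_gt0// => s s01 st u u01 us.
rewrite invf_div in us.
have gs := dt s s01; have gu := dt u.
have -> : delta u a - delta s a = (delta u a - delta t a) - (delta s a - delta t a).
  by rewrite (opprB (delta s a)) subrKA.
have -> : e = 2 * (e / 4 + e / 4) by field.
have ut' : `|u - t| < d by have := ler_distD s u t; lra.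
have st' : `|s - t| < d by lra.
exact: (gauge1_sub p_gt0 (gu u01 ut') (gs st')).
Qed.

(** The increment of the transgression from t to u; it plays the role of the
    derivative psi_t times u - t. *)
Definition step t u (y : nat -> A) : R[i] :=
  transgression (sigma t) (tau t) p.+2 (fun a => sigma u a - sigma t a) y +
  transgression (sigma t) (tau t) p.+2 (fun a => tau u a - tau t a) y.

Lemma delta_sch t : I01 t -> forall a, sch p (delta t a).
Proof. by move=> t01 a; have [g] := delta_gauge a t01; exists 1%N, g. Qed.

Lemma diff_lin (s : R -> A -> bop V V) t u : linear (s t) -> linear (s u) ->
  linear (fun a => s u a - s t a).
Proof. by move=> st su z a b; rewrite st su scalerBr opprD addrACA. Qed.

Lemma step_cyclic t u : I01 t -> I01 u ->
  cyclic_cochain (fun x : 'I_p.+2 -> A => step t u (natseq x)).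
Proof.
move=> t01 u01; have op : odd p.+1 by [].
have H D : linear D -> cyclic_cochain (fun x : 'I_p.+2 -> A =>
    transgression (sigma t) (tau t) p.+2 D (natseq x)).
  by move=> D_lin; apply: (transgression_cyclic p_gt0 (sigma_lin t01) (tau_lin t01) (delta_sch t01)).
by apply: cyclic_cochainD; apply/H/diff_lin;
  [exact: sigma_lin|exact: sigma_lin|exact: tau_lin|exact: tau_lin].
Qed.

Definition step_error t u y : R[i] :=
  transgression_error (sigma t) (tau t)
    (fun a b => (sigma u a - sigma t a) * (sigma u b - sigma t b)) p.+1 y +
  transgression_error (sigma t) (tau t)
    (fun a b => (tau u a - tau t a) * (tau u b - tau t b)) p.+1 y.

(** (sigma_u - sigma_t)(ab) follows the Leibniz rule along sigma_t up to the product
    of two increments, and likewise for tau. *)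
Lemma step_hochschild t u (x : 'I_p.+3 -> A) : I01 t -> I01 u ->
  hochschild (fun x : 'I_p.+2 -> A => step t u (natseq x)) x =
  \sum_(l < p.+3) op_trace (word p.+3 (upd (dword t (natseq x)) l
     (delta u (natseq x l) - delta t (natseq x l)))) + step_error t u (natseq x).
Proof.
move=> t01 u01; rewrite hochschildD !hochschild_transgression; set y := natseq x.
have leib (s : R -> A -> bop V V) : (forall t, I01 t -> forall a b, s t (amul a b) = s t a * s t b) ->
    forall a b, s u (amul a b) - s t (amul a b) = (s u a - s t a) * s t b +
      s t a * (s u b - s t b) + (s u a - s t a) * (s u b - s t b).
  move=> sM a b; rewrite !sM//.
  by rewrite addrAC -mulrDr subrKC mulrBl mulrBr subrKA.
rewrite (@transgression_coboundary _ _ _ _ p_gt0 _ _ (sigmaM t01) (tauM t01) (delta_sch t01) _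
  (sigma t) _ 2^-1 (leib _ sigmaM))//; last by left.
rewrite (@transgression_coboundary _ _ _ _ p_gt0 _ _ (sigmaM t01) (tauM t01) (delta_sch t01) _
  (tau t) _ (- 2^-1) (leib _ tauM))//; last by right.
rewrite addrACA; congr (_ + _).
rewrite mulrN mulfV ?pnatr_eq0// mulN1r mul1r -sumrB; apply: eq_bigr => l _.
have -> : delta u (y l) - delta t (y l) =
    -1 *: (tau u (y l) - tau t (y l)) + (sigma u (y l) - sigma t (y l)).
  rewrite scaleN1r /hdiff [RHS]addrC !opprB addrACA [RHS]addrACA; congr (_ + _); exact: addrC.
rewrite word_linear//; [by rewrite mulN1r addrC| |].
  by apply: (nuc_upd p_gt0 (delta_sch t01)); rewrite ltnS ltnW.
by apply: (nuc_upd p_gt0 (delta_sch t01)); rewrite ltnS ltnW.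
Qed.

Lemma finite_bound N (P : R -> nat -> Prop) :
  (forall M M' j, 0 < M -> M <= M' -> P M j -> P M' j) ->
  (forall j, exists2 M, 0 < M & P M j) ->
  exists2 M, 0 < M & forall j, (j < N)%N -> P M j.
Proof.
move=> Pmono Pj; elim: N => [|N [M M0 IH]]; first by exists 1.
have [M' M'0 PM'] := Pj N; exists (M + M') => [|j]; first exact: addr_gt0.
rewrite ltnS leq_eqVlt => /orP[/eqP ->|jN].
  by apply: Pmono PM' => //; rewrite lerDr ltW.
by apply: Pmono (IH j jN) => //; rewrite lerDl ltW.
Qed.

Lemma nuc_trace_sum I (r : seq I) (T : I -> bop V V) : (forall i, nuc (T i)) ->
  nuc (\sum_(i <- r) T i) /\ op_trace (\sum_(i <- r) T i) = \sum_(i <- r) op_trace (T i).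
Proof.
move=> nT; have n0 : nuc (0 : bop V V).
  exists 0, (fun=> [::]); split=> [N|x].
    by rewrite big1// => i _; rewrite /weight big_nil.
  have -> : (fun N => \sum_(n < N) frop ([::] : seq (V * V)) x) = fun=> 0.
    by apply/funext => N; rewrite big1// => i _; rewrite fropE big_nil.
  exact: cvs_cst.
have tr0 : op_trace (0 : bop V V) = 0.
  by have := nuc_traceD n0 n0; rewrite addr0 => /eqP; rewrite -subr_eq0 opprD addrA subrr sub0r oppr_eq0 => /eqP.
elim: r => [|i r [nr IH]]; first by rewrite !big_nil.
by rewrite !big_cons nuc_traceD// IH; split=> //; exact: nucD.
Qed.

Lemma rnorm_sign n (z : R[i]) : rnorm ((-1) ^+ n * z) = rnorm z.
Proof. by rewrite rnormM rnormX rnormN rnorm1 expr1n mul1r. Qed.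

Section Estimates.
Variables (y : nat -> A) (G L : R).
Hypothesis G1 : 1 <= G.
Hypothesis L0 : 0 < L.
Hypothesis yG : forall t j, I01 t -> (j < p.+3)%N -> gauge p 2 1 (delta t (y j)) G.
Hypothesis sigmaL : forall t u j, I01 t -> I01 u -> (j < p.+3)%N ->
  forall x, rnorm ((sigma u (y j) - sigma t (y j)) x) <= L * `|u - t| * rnorm x.
Hypothesis tauL : forall t u j, I01 t -> I01 u -> (j < p.+3)%N ->
  forall x, rnorm ((tau u (y j) - tau t (y j)) x) <= L * `|u - t| * rnorm x.

Variables (t u h : R).
Hypothesis t01 : I01 t.
Hypothesis u01 : I01 u.
Hypothesis h0 : 0 < h.
Hypothesis tuh : `|u - t| <= h.

Let sL j : (j < p.+3)%N -> forall x, rnorm ((sigma u (y j) - sigma t (y j)) x) <= L * h * rnorm x.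
Proof.
move=> jp x; apply: le_trans (sigmaL t01 u01 jp x) _.
by rewrite ler_wpM2r ?rnorm_ge0// ler_wpM2l// ltW.
Qed.

Let tL j : (j < p.+3)%N -> forall x, rnorm ((tau u (y j) - tau t (y j)) x) <= L * h * rnorm x.
Proof.
move=> jp x; apply: le_trans (tauL t01 u01 jp x) _.
by rewrite ler_wpM2r ?rnorm_ge0// ler_wpM2l// ltW.
Qed.

Let Lh0 : 0 < L * h. Proof. exact: mulr_gt0. Qed.

Lemma transgression_bound D : (forall j x, (j < p.+2)%N -> rnorm (D (y j) x) <= L * h * rnorm x) ->
  rnorm (transgression (sigma t) (tau t) p.+2 D y) <= p.+2%:R * (L * word_cst p p.+2 G) * h.
Proof.
move=> DL; apply: le_trans (rnorm_sum _ _ _) _.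
have -> : p.+2%:R * (L * word_cst p p.+2 G) * h = \sum_(j < p.+2) L * h * word_cst p p.+2 G.
  by rewrite sumr_const card_ord -[X in _ = X]mulr_natl; ring.
apply: ler_sum => j _; rewrite rnorm_sign.
apply: (@trace_one_bad _ _ _ p_gt0 _ _ j) => //; last by move=> x; rewrite upd_same DL.
by move=> l lp lj; rewrite upd_other//; apply: yG => //; exact: ltnW.
Qed.

Lemma step_bound : rnorm (step t u y) <= 2 * (p.+2%:R * (L * word_cst p p.+2 G)) * h.
Proof.
rewrite -mulrA mulr_natl mulr2n; apply: le_trans (rnormD _ _) _.
by apply: lerD; apply: transgression_bound => j x jp; [apply: sL|apply: tL]; exact: ltnW.
Qed.

Lemma error_bound D : (forall j x, (j < p.+3)%N -> rnorm (D (y j) x) <= L * h * rnorm x) ->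
  rnorm (transgression_error (sigma t) (tau t) (fun a b => D a * D b) p.+1 y) <=
  p.+3%:R * (L ^+ 2 * word_cst p p.+2 G) * h ^+ 2.
Proof.
move=> DL; have DD i j : (i < p.+3)%N -> (j < p.+3)%N -> forall x,
    rnorm ((D (y i) * D (y j)) x) <= L * h * (L * h) * rnorm x.
  by move=> ip jp; apply: opbound_bopM => [|x|x]; [exact: ltW|exact: DL|exact: DL].
have c0 : 0 < L * h * (L * h) by exact: mulr_gt0.
apply: le_trans (rnormD _ _) _.
have -> : p.+3%:R * (L ^+ 2 * word_cst p p.+2 G) * h ^+ 2 =
    \sum_(j < p.+2) L * h * (L * h) * word_cst p p.+2 G + L * h * (L * h) * word_cst p p.+2 G.
  by rewrite sumr_const card_ord -[X in _ = X + _]mulr_natl -natr1; ring.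
apply: lerD.
  apply: le_trans (rnorm_sum _ _ _) _; apply: ler_sum => j _.
  apply: (@trace_one_bad _ _ _ p_gt0 _ _ j) => //; last first.
    by rewrite ltnn eqxx; apply: DD; [exact: leqW (ltn_ord j)|rewrite ltnS ltn_ord].
  move=> l lp lj; case: ifP => _; first by apply: yG => //; exact: ltnW.
  by rewrite (negPf lj); apply: yG.
apply: (@trace_one_bad _ _ _ p_gt0 _ _ 0%N) => //.
  by move=> l lp l0; rewrite upd_other//; apply: yG => //; exact: ltnW.
by rewrite upd_same; apply: DD.
Qed.

Lemma step_error_bound :
  rnorm (step_error t u y) <= 2 * (p.+3%:R * (L ^+ 2 * word_cst p p.+2 G)) * h ^+ 2.
Proof.
rewrite -mulrA mulr_natl mulr2n; apply: le_trans (rnormD _ _) _.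
by apply: lerD; apply: error_bound => j x jp; [apply: sL|apply: tL].
Qed.

(** In each second order word one difference is estimated in operator norm by 2Lh and
    the other by its gauge e. *)
Lemma second_order_bound (e : R) :
  (forall j, (j < p.+3)%N -> gauge p 2 1 (delta u (y j) - delta t (y j)) e) ->
  rnorm (trace_cochain (sigma u) (tau u) p.+3 y - trace_cochain (sigma t) (tau t) p.+3 y -
    \sum_(l < p.+3) op_trace (word p.+3 (upd (dword t y) l (delta u (y l) - delta t (y l))))) <=
  p.+3%:R ^+ 2 * (2 * L * word_cst p p.+3 G) * h * e.
Proof.
move=> ye; have pp : (p < p.+3)%N by rewrite ltnW.
have e0 : 0 < e := gauge_gt0 (ye 0%N isT).
pose T (l i : nat) := word p.+3 (if (i < l)%N && (l < p.+3)%N then mix2 (dword u y) (dword t y) i l else dword t y).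
have letter s j : I01 s -> (j < p.+3)%N -> gauge p 2 1 (dword s y j) G by move=> *; exact: yG.
have mixP l i j : (j < p.+3)%N -> j != i -> j != l -> gauge p 2 1 (mix2 (dword u y) (dword t y) i l j) G.
  move=> jp ji jl; rewrite /mix2 upd_other//; case: ifP => _; last exact: letter.
  by rewrite /mix (negPf ji); case: ifP => _; exact: letter.
have mixi l i : (i < l)%N -> (l < p.+3)%N -> forall x,
    rnorm (mix2 (dword u y) (dword t y) i l i x) <= 2 * L * h * rnorm x.
  move=> il lp x; rewrite /mix2 upd_other ?ltn_eqF// il /mix ltnn eqxx.
  have -> : (dword u y i - dword t y i) x =
      (sigma u (y i) - sigma t (y i)) x - (tau u (y i) - tau t (y i)) x.
    suff -> : dword u y i - dword t y i =
      (sigma u (y i) - sigma t (y i)) - (tau u (y i) - tau t (y i)) by [].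
    by rewrite /diff_word /hdiff !opprB addrACA [RHS]addrACA; congr (_ + _); exact: addrC.
  apply: le_trans (rnormB _ _) _.
  have ip : (i < p.+3)%N by apply: ltn_trans lp.
  have -> : 2 * L * h * rnorm x = L * h * rnorm x + L * h * rnorm x by ring.
  exact: lerD (sL ip x) (tL ip x).
have TP l i : nuc (T l i) /\ ((i < l)%N -> (l < p.+3)%N ->
    rnorm (op_trace (T l i)) <= 2 * L * h * e * word_cst p p.+3 G).
  rewrite /T; case: ifP => [/andP[il lp]|ilp]; last first.
    split; last by move=> il lp; rewrite il lp in ilp.
    apply: (@word_nuc _ _ _ p_gt0 _ _ [::]); first by rewrite addn0 ltnW.
    by move=> j jp _; exists 2, G; exact: letter.
  have mixl : mix2 (dword u y) (dword t y) i l l = delta u (y l) - delta t (y l).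
    by rewrite /mix2 upd_same.
  split; last first.
    move=> _ _; apply: (@trace_two_bad _ _ _ p_gt0 _ _ i l) => //.
    - exact: ltn_trans lp.
    - by rewrite ltn_eqF.
    - by rewrite !mulr_gt0.
    - by move=> j jp ji jl; exact: mixP.
    - by rewrite mixl; exact: ye.
    - exact: mixi.
  apply: (@word_nuc _ _ _ p_gt0 _ _ [:: i]); first by rewrite /= addn1 ltnW.
  move=> j jp; rewrite inE => ji; have [->|jl] := eqVneq j l.
    by exists 2, e; rewrite mixl; exact: ye.
  by exists 2, G; exact: mixP.
have nW s : I01 s -> nuc (word p.+3 (dword s y)).
  move=> s01; apply: (@word_nuc _ _ _ p_gt0 _ _ [::]); first by rewrite addn0 ltnW.
  by move=> j jp _; exists 2, G; exact: letter.
have nU l : nuc (word p.+3 (upd (dword t y) l (delta u (y l) - delta t (y l)))).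
  exact: (nuc_upd p_gt0 (delta_sch t01)).
have E : word p.+3 (dword u y) = word p.+3 (dword t y) +
    \sum_(l < p.+3) word p.+3 (upd (dword t y) l (delta u (y l) - delta t (y l))) +
    \sum_(l < p.+3) \sum_(i < l) T l i.
  have := word_sub_second_order p.+3 (dword u y) (dword t y).
  move/(canRL (subrK _))/(canRL (subrK _)) => ->; rewrite addrC addrA addrAC -addrA addrC.
  rewrite addrC -!addrA; congr (_ + (_ + _)).
  apply: eq_bigr => l _; apply: eq_bigr => i _; by rewrite /T !ltn_ord.
have nT1 l : nuc (\sum_(i < l) T l i) by apply: (nuc_trace_sum _ (fun i : 'I_l => (TP l i).1)).1.
have [nS1 S1] := nuc_trace_sum (index_enum 'I_p.+3) (fun l : 'I_p.+3 => nU l).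
have [nS2 S2] := nuc_trace_sum (index_enum 'I_p.+3) (fun l : 'I_p.+3 => nT1 l).
rewrite /trace_cochain E nuc_traceD; [|by apply: nucD => //; exact: nW|by []].
rewrite nuc_traceD; [|exact: nW|by []]; rewrite S1 S2.
have cancel3 (a b c : R[i]) : a + b + c - a - b = c by ring.
rewrite cancel3; apply: le_trans (rnorm_sum _ _ _) _.
have -> : p.+3%:R ^+ 2 * (2 * L * word_cst p p.+3 G) * h * e =
    \sum_(l < p.+3) p.+3%:R * (2 * L * h * e * word_cst p p.+3 G).
  by rewrite sumr_const card_ord -[X in _ = X]mulr_natl; ring.
have c0 : 0 <= 2 * L * h * e * word_cst p p.+3 G.
  by rewrite mulr_ge0 ?word_cst_ge0 ?(le_trans ler01 G1)// !mulr_ge0// ltW.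
apply: ler_sum => l _.
have [_ ->] := nuc_trace_sum (index_enum 'I_l) (fun i : 'I_l => (TP l i).1).
apply: le_trans (rnorm_sum _ _ _) _.
apply: le_trans (_ : \sum_(i < l) 2 * L * h * e * word_cst p p.+3 G <= _).
  by apply: ler_sum => i _; apply: (TP l i).2.
by rewrite sumr_const card_ord -[X in X <= _]mulr_natl ler_wpM2r// ler_nat ltnW.
Qed.

End Estimates.

Lemma uniform_letter_bounds (y : nat -> A) : exists G L, [/\ 1 <= G, 0 < L,
  forall t j, I01 t -> (j < p.+3)%N -> gauge p 2 1 (delta t (y j)) G,
  forall t u j, I01 t -> I01 u -> (j < p.+3)%N ->
    forall x, rnorm ((sigma u (y j) - sigma t (y j)) x) <= L * `|u - t| * rnorm x &
  forall t u j, I01 t -> I01 u -> (j < p.+3)%N ->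
    forall x, rnorm ((tau u (y j) - tau t (y j)) x) <= L * `|u - t| * rnorm x].
Proof.
have [|j|G G0 GP] := @finite_bound p.+3 (fun G j => forall t, I01 t -> gauge p 2 1 (delta t (y j)) G).
- by move=> M M' j _ MM' H t t01; apply: gauge_le MM' (H t t01).
- exact: delta_gauge_bounded.
pose P (s : R -> A -> bop V V) L j := forall t u, I01 t -> I01 u ->
  forall x, rnorm ((s u (y j) - s t (y j)) x) <= L * `|u - t| * rnorm x.
have Pmono s M M' j : 0 < M -> M <= M' -> P s M j -> P s M' j.
  move=> _ MM' H t u t01 u01 x; apply: le_trans (H t u t01 u01 x) _.
  by rewrite ler_wpM2r ?rnorm_ge0// ler_wpM2r.
have [|j|L L0 LP] := @finite_bound p.+3 (P sigma); first exact: Pmono.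
  by have [L L0 LP] := sigma_lip (y j); exists L => // t u t01 u01; exact: LP.
have [|j|L' L'0 LP'] := @finite_bound p.+3 (P tau); first exact: Pmono.
  by have [L' L'0 LP'] := tau_lip (y j); exists L' => // t u t01 u01; exact: LP'.
exists (G + 1), (L + L'); split.
- by rewrite lerDr ltW.
- exact: addr_gt0.
- by move=> t j t01 jp; apply: gauge_le (GP j jp t t01); rewrite lerDl.
- move=> t u j t01 u01 jp; apply: (Pmono sigma L) => //; first by rewrite lerDl ltW.
  exact: LP.
- move=> t u j t01 u01 jp; apply: (Pmono tau L') => //; first by rewrite lerDr ltW.
  exact: LP'.
Qed.

(** The errors are e1 * O(h) from the second order words, e1 being small by uniform
    continuity, and O(h^2) from the Leibniz rule. *)
Lemma step_defect (x : 'I_p.+3 -> A) e : 0 < e -> exists2 d, 0 < d &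
  forall t u h, I01 t -> I01 u -> 0 < h -> h < d -> `|u - t| <= h ->
  rnorm (hochschild (fun x : 'I_p.+2 -> A => step t u (natseq x)) x -
    (trace_cochain (sigma u) (tau u) p.+3 (natseq x) -
     trace_cochain (sigma t) (tau t) p.+3 (natseq x))) <= e * h.
Proof.
move=> e0; set y := natseq x; have [G [L [G1 L0 yG sL tL]]] := uniform_letter_bounds y.
pose K1 := p.+3%:R ^+ 2 * (2 * L * word_cst p p.+3 G).
pose K2 := 2 * (p.+3%:R * (L ^+ 2 * word_cst p p.+2 G)).
have G0 : 0 <= G := le_trans ler01 G1.
have w0 N : 0 <= word_cst p N G by exact: word_cst_ge0.
have K10 : 0 <= K1 := mulr_ge0 (exprn_ge0 2 (ler0n R _)) (mulr_ge0 (mulr_ge0 (ler0n R 2) (ltW L0)) (w0 _)).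
have K20 : 0 <= K2 := mulr_ge0 (ler0n R 2) (mulr_ge0 (ler0n R _) (mulr_ge0 (sqr_ge0 L) (w0 _))).
have K11 : 0 < K1 + 1 by rewrite ltr_wpDl.
have K21 : 0 < K2 + 1 by rewrite ltr_wpDl.
pose e1 := e / 2 / (K1 + 1); have e10 : 0 < e1 by rewrite !divr_gt0.
have [M MM'|j|M M0 MP] := @finite_bound p.+3 (fun M j => forall t u, I01 t -> I01 u ->
    `|u - t| < M^-1 -> gauge p 2 1 (delta u (y j) - delta t (y j)) e1).
- move=> j M0 MMM H t u t01 u01 tu; apply: H => //; apply: lt_le_trans tu _.
  by rewrite lef_pV2 ?posrE// (lt_le_trans M0).
- by have [M M0 MP] := delta_unif_cont (y j) e10; exists M.
have e20 : 0 < e / 2 / (K2 + 1) by rewrite !divr_gt0.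
exists (Num.min M^-1 (e / 2 / (K2 + 1))); first by rewrite lt_min invr_gt0 M0.
move=> t u h t01 u01 h0; rewrite lt_min => /andP[hM hK] tuh.
rewrite step_hochschild// -/y.
have B1 := second_order_bound G1 L0 yG sL tL t01 u01 h0 tuh
  (fun j jp => MP j jp t u t01 u01 (le_lt_trans tuh hM)).
have B2 := step_error_bound G1 L0 yG sL tL t01 u01 h0 tuh.
set S := \sum_(l < p.+3) _; rewrite -/S in B1; set E := step_error t u y; rewrite -/E in B2.
set a := trace_cochain _ _ _ _; set b := trace_cochain _ _ _ _.
have -> : S + E - (a - b) = E - (a - b - S) by ring.
apply: le_trans (rnormB _ _) _; apply: le_trans (lerD B2 B1) _.
rewrite -/K1 -/K2.
have A1 : K1 * h * e1 <= e / 2 * h.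
  rewrite mulrAC ler_wpM2r ?(ltW h0)// /e1 mulrA ler_pdivrMr// mulrC ler_wpM2l ?lerDl//.
  by rewrite divr_ge0 ?(ltW e0).
have A2 : K2 * h ^+ 2 <= e / 2 * h.
  rewrite expr2 mulrA ler_wpM2r ?(ltW h0)//.
  rewrite ltr_pdivlMr// in hK; apply: le_trans (ltW hK).
  by rewrite mulrC ler_wpM2l ?(ltW h0)// lerDl.
have -> : e * h = e / 2 * h + e / 2 * h by field.
exact: lerD.
Qed.

(** The sums F n of the steps along the partition of [0,T] into n + 1 equal parts are
    bounded, and their coboundaries miss the difference of the two traces by n + 1
    errors that are o(1/n); the cochain is an ultralimit of the F n. *)
Theorem homotopy_coboundary T : I01 T -> exists2 f : cochain A p.+1, cyclic_cochain f &
  forall x : 'I_p.+3 -> A, hochschild f x =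
    trace_cochain (sigma T) (tau T) p.+3 (natseq x) -
    trace_cochain (sigma 0) (tau 0) p.+3 (natseq x).
Proof.
move=> /andP[T0 T1].
pose pt n (k : nat) : R := T * k%:R / n.+1%:R.
have pt01 n k : (k <= n.+1)%N -> I01 (pt n k).
  move=> kn; rewrite divr_ge0 ?mulr_ge0// ler_pdivrMr ?ltr0n// mul1r.
  apply: le_trans (_ : 1 * k%:R <= _); first by rewrite ler_wpM2r.
  by rewrite mul1r ler_nat.
have ptS n k : `|pt n k.+1 - pt n k| <= n.+1%:R^-1.
  rewrite -mulrBl -mulrBr -natrB// subSnn mulr1 ger0_norm ?divr_ge0//.
  by rewrite ler_piMl ?invr_ge0.
have h0 n : 0 < n.+1%:R^-1 :> R by rewrite invr_gt0.
pose F n : cochain A p.+1 := fun x => \sum_(k < n.+1) step (pt n k) (pt n k.+1) (natseq x).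
have Fc n : cyclic_cochain (F n).
  apply: cyclic_cochain_sum => k; apply: step_cyclic; apply: pt01 => //.
  exact: ltnW.
have Fb x : bounded_seq (fun n => F n x).
  have [G [L [G1 L0 yG sL tL]]] := uniform_letter_bounds (natseq x).
  exists (2 * (p.+2%:R * (L * word_cst p p.+2 G))) => n.
  apply: le_trans (rnorm_sum _ _ _) _.
  set C := 2 * _; have -> : C = \sum_(k < n.+1) C * n.+1%:R^-1.
    by rewrite sumr_const card_ord -mulrnAr -[X in _ * X]mulr_natl mulfV ?mulr1// pnatr_eq0.
  apply: ler_sum => k _; apply: (step_bound G1 L0 yG sL tL) => //; apply: pt01 => //.
  exact: ltnW.
have [f fc fF] := cyclic_cochain_ultralimit Fc Fb.
exists f => // x; apply: fF; apply/cvsP => e e0.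
have [d d0 dP] := step_defect x (divr_gt0 e0 (ltr0Sn R 1)).
have harm0 n : 0 <= n.+1%:R^-1 :> R by exact: ltW.
have [N NP] := (cvg0P harm0).1 (@cvg_harmonic R) d d0.
exists N => n /NP nd; rewrite hochschild_sum.
pose ph t := trace_cochain (sigma t) (tau t) p.+3 (natseq x).
have tele : ph T - ph 0 = \sum_(k < n.+1) (ph (pt n k.+1) - ph (pt n k)).
  have := @telescope_sumr _ 0%N n.+1 (fun k => ph (pt n k)) (leq0n _).
  rewrite big_mkord => ->; congr (ph _ - ph _); last by rewrite /pt mulr0 mul0r.
  by rewrite /pt mulfK// pnatr_eq0.
rewrite -/(ph T) -/(ph 0) tele -sumrB; apply: le_lt_trans (rnorm_sum _ _ _) _.
apply: (@le_lt_trans _ _ (\sum_(k < n.+1) e / 2 * n.+1%:R^-1)).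
  apply: ler_sum => k _; apply: dP => //; apply: pt01 => //.
  exact: ltnW.
rewrite sumr_const card_ord -mulrnAr -[X in _ * X]mulr_natl mulfV ?pnatr_eq0// mulr1.
by rewrite ltr_pdivrMr// ltr_pMr// ltr1n.
Qed.

End Homotopy.

(** * The algebra of a Fredholm module *)

Section HomAlgebra.
Variables (R : realType) (X : rigidCstarTensorCat R) (H K L M : hilbX X).
Implicit Types (s t : hilbX_hom K L) (u v : hilbX_hom H K) (z : R[i]).

Lemma hxMA (w : hilbX_hom L M) s u : w ⊙ (s ⊙ u) = w ⊙ s ⊙ u.
Proof. by apply: hx_homP => c; exact/bopP. Qed.
Lemma hx1M u : hx1 K ⊙ u = u.
Proof. by apply: hx_homP => c; exact/bopP. Qed.
Lemma hxM1 u : u ⊙ hx1 H = u.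
Proof. by apply: hx_homP => c; exact/bopP. Qed.
Lemma hxMDl s t u : (s + t) ⊙ u = s ⊙ u + t ⊙ u.
Proof. by apply: hx_homP => c; exact/bopP. Qed.
Lemma hxMDr s u v : s ⊙ (u + v) = s ⊙ u + s ⊙ v.
Proof. by apply: hx_homP => c; apply/bopP => x /=; rewrite linearD. Qed.
Lemma hxMNl s u : (- s) ⊙ u = - (s ⊙ u).
Proof. by apply: hx_homP => c; exact/bopP. Qed.
Lemma hxMNr s u : s ⊙ (- u) = - (s ⊙ u).
Proof. by apply: hx_homP => c; apply/bopP => x /=; rewrite linearN. Qed.
Lemma hxMBl s t u : (s - t) ⊙ u = s ⊙ u - t ⊙ u.
Proof. by rewrite hxMDl hxMNl. Qed.
Lemma hxMBr s u v : s ⊙ (u - v) = s ⊙ u - s ⊙ v.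
Proof. by rewrite hxMDr hxMNr. Qed.
Lemma hxMZl z s u : (z *: s) ⊙ u = z *: (s ⊙ u).
Proof. by apply: hx_homP => c; exact/bopP. Qed.
Lemma hxMZr z s u : s ⊙ (z *: u) = z *: (s ⊙ u).
Proof. by apply: hx_homP => c; apply/bopP => x /=; rewrite linearZ. Qed.
Lemma hx0M u : (0 : hilbX_hom K L) ⊙ u = 0.
Proof. by apply: hx_homP => c; exact/bopP. Qed.
Lemma hxM0 s : s ⊙ (0 : hilbX_hom H K) = 0.
Proof. by apply: hx_homP => c; apply/bopP => x /=; rewrite linear0. Qed.

End HomAlgebra.

Section HomRing.
Variables (R : realType) (X : rigidCstarTensorCat R) (H : hilbX X).

HB.instance Definition _ := GRing.Zmodule_isPzRing.Build (hilbX_hom H H)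
  (fun s t u => @hxMA R X H H H H s t u) (@hx1M R X H H) (@hxM1 R X H H)
  (fun s t u => @hxMDl R X H H H s t u) (fun s t u => @hxMDr R X H H H s t u).

Lemma hx_mulE (s t : hilbX_hom H H) : s * t = s ⊙ t. Proof. by []. Qed.

Lemma hx_prod_at N (s : nat -> hilbX_hom H H) c :
  (\prod_(j < N) s j) c = \prod_(j < N) s j c.
Proof.
elim: N => [|N IHN]; first by rewrite !big_ord0.
by rewrite !big_ord_recr /= -IHN.
Qed.

End HomRing.

(** The algebra takes place in a ring: f stands for the operator F, e for the grading
    and c for the imaginary unit. *)
Section FredholmRing.
Variables (B : pzRingType) (e f c : B).
Hypothesis f2 : f * f = 1.
Hypothesis fe : f * e = - (e * f).
Hypothesis cc : c * c = -1.
Hypothesis cC : forall x, c * x = x * c.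
Implicit Types (s x : B) (d r : nat -> B).

(** When F is the flip of two copies of H^+, the operator diag(sigma,tau) has
    conjugated difference diag(sigma - tau, tau - sigma). *)
Definition conj_diff s := s - f * s * f.

Lemma mulff x : f * (f * x) = x.
Proof. by rewrite mulrA f2 mul1r. Qed.

Lemma conj_diff_anti s : f * conj_diff s * f = - conj_diff s.
Proof. by rewrite /conj_diff mulrBr mulrBl -!mulrA mulff f2 mulr1 opprB. Qed.

Lemma conj_diff_commutator s : f * s - s * f = f * conj_diff s.
Proof. by rewrite /conj_diff mulrBr !mulrA f2 mul1r. Qed.

Lemma conj_diff_even s : s * e = e * s -> conj_diff s * e = e * conj_diff s.
Proof.
move=> se; rewrite /conj_diff mulrBl mulrBr se; congr (_ - _).
by rewrite -!mulrA fe mulrN [s * (e * f)]mulrA se mulrN -mulrA mulrA fe mulNr opprK -mulrA.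
Qed.

Lemma prod_differentials k d : (forall j, f * d j * f = - d j) ->
  \prod_(j < k.*2) (c * (f * d j)) = \prod_(j < k.*2) d j.
Proof.
move=> df; elim: k => [|k IHk]; first by rewrite !big_ord0.
rewrite doubleS !big_ord_recr /= IHk -!mulrA; congr (_ * _).
have cCA x y : x * (c * y) = c * (x * y) by rewrite mulrA -cC -mulrA.
rewrite !cCA [c * (c * _)]mulrA cc mulN1r; set u := d _; set v := d _.
have -> : f * (u * (f * v)) = f * u * f * v by rewrite !mulrA.
by rewrite df mulNr opprK.
Qed.

Lemma prod_even N d : (forall j, d j * e = e * d j) ->
  (\prod_(j < N) d j) * e = e * \prod_(j < N) d j.
Proof.
move=> de; elim: N => [|N IHN]; first by rewrite big_ord0 mulr1 mul1r.
by rewrite big_ord_recr /= -mulrA de mulrA IHN mulrA.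
Qed.

Lemma prod_conj N d : (forall j, f * d j * f = - d j) ->
  f * (\prod_(j < N) d j) * f = (-1) ^+ N * \prod_(j < N) d j.
Proof.
move=> df; elim: N => [|N IHN]; first by rewrite big_ord0 mulr1 expr0 mulr1.
rewrite !big_ord_recr /=; set p := \prod_(j < N) d j in IHN *.
have -> : f * (p * d N) * f = f * p * f * (f * d N * f).
  by rewrite -!mulrA mulff.
by rewrite IHN df mulrN exprS !mulNr mul1r mulrA.
Qed.

(** [F,s] = F (s - FsF), and s - FsF anticommutes with F, so the factors F and i of
    two consecutive differentials cancel. In [F, r_0 p] the even product p commutes
    with F, which turns r_0 into one more conjugated difference. *)
Lemma character_integrand k r : (forall j, r j * e = e * r j) ->
  let w := r 0%N * \prod_(j < k.*2) (c * (f * r j.+1 - r j.+1 * f)) in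
  w * e = e * w /\ e * f * (f * w - w * f) = e * \prod_(j < k.*2.+1) conj_diff (r j).
Proof.
move=> re w; set p := \prod_(j < k.*2) conj_diff (r j.+1).
have wE : w = r 0%N * p.
  rewrite /w /p -(prod_differentials k (fun j => conj_diff_anti (r j.+1))).
  by congr (_ * _); apply: eq_bigr => j _; rewrite conj_diff_commutator.
have pe : p * e = e * p.
  by apply: (@prod_even _ (fun j => conj_diff (r j.+1))) => j; exact: conj_diff_even.
have pf : f * p * f = p.
  rewrite /p (@prod_conj _ (fun j => conj_diff (r j.+1))); last by move=> j; exact: conj_diff_anti.
  by rewrite -signr_odd odd_double expr0 mul1r.
rewrite wE -mulrA pe mulrA re mulrA; split=> //.
rewrite -mulrA; congr (_ * _).
rewrite mulrBr mulff big_ord_recl /= -/p /conj_diff mulrBl; congr (_ - _).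
by rewrite -{1}pf -!mulrA f2 mulr1.
Qed.

End FredholmRing.

Section FredholmAlgebra.
Variables (R : realType) (X : rigidCstarTensorCat R) (H : gradedHilbX X).
Variables (P : hilbX_hom (gr_pos H) (gr_neg H)) (Q : hilbX_hom (gr_neg H) (gr_pos H)).
Implicit Types s t : hilbX_hom H H.

Local Notation eps := (grading H).
Local Notation F := (off_diagonal P Q).
Local Notation ip := (inj_pos H).
Local Notation inn := (inj_neg H).
Local Notation pp := (proj_pos H).
Local Notation pn := (proj_neg H).

Lemma grading_inj_pos : eps ⊙ ip = ip.
Proof.
by rewrite /grading hxMBl -!hxMA proj_inj_pos proj_neg_inj_pos hxM1 hxM0 subr0.
Qed.

Lemma grading_inj_neg : eps ⊙ inn = - inn.
Proof.
by rewrite /grading hxMBl -!hxMA proj_inj_neg proj_pos_inj_neg hxM1 hxM0 sub0r.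
Qed.

Lemma proj_neg_grading : pn ⊙ eps = - pn.
Proof.
by rewrite /grading hxMBr !hxMA proj_inj_neg proj_neg_inj_pos hx1M hx0M sub0r.
Qed.

Lemma proj_pos_grading : pp ⊙ eps = pp.
Proof.
by rewrite /grading hxMBr !hxMA proj_inj_pos proj_pos_inj_neg hx1M hx0M subr0.
Qed.

Lemma grading_sqr : eps ⊙ eps = hx1 H.
Proof.
rewrite {2}/grading hxMBr !hxMA grading_inj_pos grading_inj_neg hxMNl opprK.
exact: inj_proj_sum.
Qed.

Lemma off_diagonal_inj_pos : F ⊙ ip = inn ⊙ P.
Proof.
by rewrite /off_diagonal hxMDl -!hxMA proj_inj_pos proj_neg_inj_pos !hxM0 !hxM1 add0r.
Qed.

Lemma off_diagonal_inj_neg : F ⊙ inn = ip ⊙ Q.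
Proof.
by rewrite /off_diagonal hxMDl -!hxMA proj_inj_neg proj_pos_inj_neg !hxM0 !hxM1 addr0.
Qed.

Lemma half_double_hom s : 2^-1 *: (s + s) = s.
Proof. by rewrite -mulr2n -[s *+ 2]scaler_nat scalerA mulVf ?scale1r// pnatr_eq0. Qed.

Hypothesis F2 : F ⊙ F = hx1 H.
Hypothesis Feps : F ⊙ eps = - (eps ⊙ F).

Lemma QP1 : Q ⊙ P = hx1 (gr_pos H).
Proof.
have : pp ⊙ (F ⊙ F ⊙ ip) = hx1 (gr_pos H) by rewrite F2 hx1M proj_inj_pos.
by rewrite -hxMA off_diagonal_inj_pos [off_diagonal P Q ⊙ _]hxMA off_diagonal_inj_neg -!hxMA hxMA proj_inj_pos hx1M.
Qed.

Lemma PQ1 : P ⊙ Q = hx1 (gr_neg H).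
Proof.
have : pn ⊙ (F ⊙ F ⊙ inn) = hx1 (gr_neg H) by rewrite F2 hx1M proj_inj_neg.
by rewrite -hxMA off_diagonal_inj_neg [off_diagonal P Q ⊙ _]hxMA off_diagonal_inj_pos -!hxMA hxMA proj_inj_neg hx1M.
Qed.

Lemma gcomm_even s : s ⊙ eps = eps ⊙ s -> gcomm F s = F ⊙ s - s ⊙ F.
Proof.
move=> se; have E : eps ⊙ s ⊙ eps = s by rewrite -hxMA se hxMA grading_sqr hx1M.
by rewrite /gcomm /even_part /odd_part E half_double_hom subrr scaler0 hxM0 hx0M !addr0.
Qed.

Lemma FF1 : F * F = 1.
Proof. exact: F2. Qed.

Definition hconj_diff s : hilbX_hom H H := s - F ⊙ s ⊙ F.

Lemma supertrace_integrand k (r : nat -> hilbX_hom H H) :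
  (forall j, r j ⊙ eps = eps ⊙ r j) ->
  eps ⊙ F ⊙ gcomm F (r 0%N ⊙ \prod_(j < k.*2) gdiff F (r j.+1)) =
  eps ⊙ \prod_(j < k.*2.+1) hconj_diff (r j).
Proof.
move=> re; pose c : hilbX_hom H H := 'i *: hx1 H.
have cE s : c * s = 'i *: s by rewrite hx_mulE hxMZl hx1M.
have cC s : c * s = s * c by rewrite cE hx_mulE hxMZr hxM1.
have cc : c * c = -1 by rewrite cE scalerA -expr2 sqrCi scaleN1r.
have [we E] := character_integrand FF1 Feps cc cC k re.
have dE j : gdiff F (r j) = c * (F * r j - r j * F).
  by rewrite cE /gdiff gcomm_even.
have -> : \prod_(j < k.*2) gdiff F (r j.+1) = \prod_(j < k.*2) (c * (F * r j.+1 - r j.+1 * F)).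
  by apply: eq_bigr => j _; exact: dE.
rewrite gcomm_even; [exact: E|exact: we].
Qed.

Lemma even_inj_pos s : s ⊙ eps = eps ⊙ s -> s ⊙ ip = ip ⊙ block_pos s.
Proof.
move=> se; have pn0 : pn ⊙ s ⊙ ip = 0.
  have : pn ⊙ (s ⊙ eps) ⊙ ip = - (pn ⊙ s ⊙ ip).
    by rewrite se hxMA proj_neg_grading !hxMNl.
  rewrite hxMA -hxMA grading_inj_pos => /eqP; rewrite -addr_eq0.
  by rewrite -mulr2n -scaler_nat scaler_eq0 pnatr_eq0 /= => /eqP.
by rewrite -[LHS]hx1M -inj_proj_sum hxMDl -!hxMA [pn ⊙ _]hxMA pn0 hxM0 addr0 /block_pos -!hxMA.
Qed.

Lemma even_inj_neg s : s ⊙ eps = eps ⊙ s -> s ⊙ inn = inn ⊙ block_neg s.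
Proof.
move=> se; have pp0 : pp ⊙ s ⊙ inn = 0.
  have : pp ⊙ (s ⊙ eps) ⊙ inn = pp ⊙ s ⊙ inn.
    by rewrite se hxMA proj_pos_grading.
  rewrite hxMA -hxMA grading_inj_neg hxMNr => /eqP; rewrite eq_sym -addr_eq0.
  by rewrite -mulr2n -scaler_nat scaler_eq0 pnatr_eq0 /= => /eqP.
by rewrite -[LHS]hx1M -inj_proj_sum hxMDl -!hxMA [pp ⊙ _]hxMA pp0 hxM0 add0r /block_neg -!hxMA.
Qed.

Definition block_diff s : hilbX_hom (gr_pos H) (gr_pos H) :=
  block_pos s - Q ⊙ block_neg s ⊙ P.

Lemma conj_diff_inj_pos s : s ⊙ eps = eps ⊙ s -> hconj_diff s ⊙ ip = ip ⊙ block_diff s.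
Proof.
move=> se; rewrite /hconj_diff hxMBl even_inj_pos// /block_diff hxMBr; congr (_ - _).
have -> : F ⊙ s ⊙ F ⊙ ip = F ⊙ (s ⊙ inn) ⊙ P by rewrite -hxMA off_diagonal_inj_pos !hxMA.
by rewrite even_inj_neg// hxMA off_diagonal_inj_neg !hxMA.
Qed.

Lemma prod_conj_diff_inj_pos N (r : nat -> hilbX_hom H H) :
  (forall j, r j ⊙ eps = eps ⊙ r j) ->
  (\prod_(j < N) hconj_diff (r j)) ⊙ ip = ip ⊙ \prod_(j < N) block_diff (r j).
Proof.
move=> re; elim: N => [|N IHN]; first by rewrite !big_ord0 [LHS]hx1M [RHS]hxM1.
by rewrite !big_ord_recr /= !hx_mulE -hxMA conj_diff_inj_pos ?re// hxMA IHN hxMA.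
Qed.

(** The product has an odd number of factors and F anticommutes with each of them, so
    on H^- = F(H^+) it is minus the conjugate of its restriction Z to H^+. The grading
    cancels this sign, and both halves contribute the trace of Z. *)
Lemma graded_prod_conj_diff k (r : nat -> hilbX_hom H H) :
  (forall j, r j ⊙ eps = eps ⊙ r j) ->
  let Z := \prod_(j < k.*2.+1) block_diff (r j) in
  eps ⊙ \prod_(j < k.*2.+1) hconj_diff (r j) =
  ip ⊙ (Z ⊙ pp) + (F ⊙ ip) ⊙ (Z ⊙ (Q ⊙ pn)).
Proof.
move=> re Z; set p := \prod_(j < k.*2.+1) _.
have pi : p ⊙ ip = ip ⊙ Z by exact: prod_conj_diff_inj_pos.
have pF : F * p * F = - p.
  rewrite /p (@prod_conj _ _ FF1 _ (fun j => hconj_diff (r j))); last by move=> j; exact: (conj_diff_anti FF1).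
  by rewrite -signr_odd /= odd_double expr1 mulN1r.
have pFi : p ⊙ (F ⊙ ip) = - (F ⊙ ip ⊙ Z).
  have -> : p = - (F ⊙ p ⊙ F) by rewrite -[F ⊙ p ⊙ F]/(F * p * F) pF opprK.
  by rewrite hxMNl -!hxMA [F ⊙ (F ⊙ _)]hxMA F2 hx1M pi.
have iE : inn = F ⊙ ip ⊙ Q by rewrite off_diagonal_inj_pos -hxMA PQ1 hxM1.
have eF : eps ⊙ (F ⊙ ip) = - (F ⊙ ip).
  by rewrite hxMA -[eps ⊙ F]opprK -Feps hxMNl -hxMA grading_inj_pos.
have -> : p = p ⊙ ip ⊙ pp + p ⊙ (F ⊙ ip) ⊙ (Q ⊙ pn).
  by rewrite -{1}[p]hxM1 -inj_proj_sum iE hxMDr !hxMA.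
rewrite hxMDr; congr (_ + _); first by rewrite pi !hxMA grading_inj_pos.
by rewrite pFi hxMNl hxMNr !hxMA -[eps ⊙ F ⊙ ip]hxMA eF !hxMNl opprK.
Qed.

End FredholmAlgebra.

(** * The character as a trace of differences *)

Section CharacterFormula.
Variables (R : realType) (X : rigidCstarTensorCat R) (I : finType) (irr : I -> X).
Variables (A : assocAlgType R[i]) (H : gradedHilbX X).
Variables (P : hilbX_hom (gr_pos H) (gr_neg H)) (Q : hilbX_hom (gr_neg H) (gr_pos H)).
Variable rho : A -> hilbX_hom H H.
Hypothesis rho_lin : linear rho.
Hypothesis rhoM : forall a b, rho (amul a b) = rho a ⊙ rho b.
Hypothesis rho_even : forall a, rho a ⊙ grading H = grading H ⊙ rho a.
Hypothesis F2 : off_diagonal P Q ⊙ off_diagonal P Q = hx1 H.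
Hypothesis Feps : off_diagonal P Q ⊙ grading H = - (grading H ⊙ off_diagonal P Q).

Definition sigma_at c a : bop (gr_pos H c) (gr_pos H c) := block_pos (rho a) c.
Definition tau_at c a : bop (gr_pos H c) (gr_pos H c) := (Q ⊙ block_neg (rho a) ⊙ P) c.

Lemma sigma_at_linear c : linear (sigma_at c).
Proof.
move=> z a b; rewrite /sigma_at /block_pos rho_lin hxMDr hxMDl hxMZr hxMZl.
by [].
Qed.

Lemma tau_at_linear c : linear (tau_at c).
Proof.
move=> z a b; rewrite /tau_at /block_neg rho_lin hxMDr hxMDl hxMZr hxMZl.
by rewrite hxMDr hxMDl hxMZr hxMZl.
Qed.

Lemma sigma_atM c a b : sigma_at c (amul a b) = sigma_at c a * sigma_at c b.
Proof.
suff E : block_pos (rho (amul a b)) = block_pos (rho a) ⊙ block_pos (rho b).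
  by rewrite /sigma_at E.
by rewrite {1}/block_pos rhoM -!hxMA even_inj_pos// /block_pos !hxMA.
Qed.

Lemma tau_atM c a b : tau_at c (amul a b) = tau_at c a * tau_at c b.
Proof.
suff E : Q ⊙ block_neg (rho (amul a b)) ⊙ P =
    (Q ⊙ block_neg (rho a) ⊙ P) ⊙ (Q ⊙ block_neg (rho b) ⊙ P) by rewrite /tau_at E.
have -> : block_neg (rho (amul a b)) = block_neg (rho a) ⊙ block_neg (rho b).
  by rewrite {1}/block_neg rhoM -!hxMA even_inj_neg// /block_neg !hxMA.
have PQ : P ⊙ Q = hx1 (gr_neg H) := PQ1 F2.
by rewrite -!hxMA [P ⊙ (Q ⊙ _)]hxMA PQ hx1M.
Qed.

(** Cyclicity of the trace brings both halves back to V, which removes the 1/2. *)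
Lemma supertrace_formula k (a : nat -> A) :
  (forall i, nuc (word k.*2.+1 (diff_word (sigma_at (irr i)) (tau_at (irr i)) a))) ->
  supertrace irr (off_diagonal P Q) (rho (a 0%N) ⊙
     \prod_(j < k.*2) gdiff (off_diagonal P Q) (rho (a j.+1))) =
  \sum_i trace_cochain (sigma_at (irr i)) (tau_at (irr i)) k.*2.+1 a.
Proof.
move=> nZ; set r := fun j => rho (a j).
have re j : r j ⊙ grading H = grading H ⊙ r j by exact: rho_even.
rewrite /supertrace (supertrace_integrand F2 Feps k re) (graded_prod_conj_diff F2 Feps k re).
rewrite /Trace mulr_sumr; apply: eq_bigr => i _; rewrite /trace_cochain.
set Z := \prod_(j < k.*2.+1) _; set w := word _ _.
have Zw : Z (irr i) = w by rewrite /Z (hx_prod_at _ (fun j => block_diff P Q (r j))).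
have [B nw] := nZ i; rewrite -/w -Zw in nw.
pose c := irr i; set z := Z (irr i) in nw.
have [B1 n1] := nuclear_rmap (proj_pos H c) nw.
have [B2 n2] := nuclear_lmap (inj_pos H c) n1.
have [B3 n3] := nuclear_rmap ((Q ⊙ proj_neg H) c) nw.
have [B4 n4] := nuclear_lmap ((off_diagonal P Q ⊙ inj_pos H) c) n3.
have -> : op_trace ((inj_pos H ⊙ (Z ⊙ proj_pos H) +
    off_diagonal P Q ⊙ inj_pos H ⊙ (Z ⊙ (Q ⊙ proj_neg H))) (irr i)) =
    op_trace (bopM (inj_pos H c) (bopM z (proj_pos H c))) +
    op_trace (bopM ((off_diagonal P Q ⊙ inj_pos H) c) (bopM z ((Q ⊙ proj_neg H) c))).
  exact: op_traceD n2 n4.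
rewrite (op_trace_cyclic _ n1) (op_trace_cyclic _ n3).
have -> : bopM (bopM z (proj_pos H c)) (inj_pos H c) = z.
  have := congr1 (fun s : hilbX_hom (gr_pos H) (gr_pos H) => s c) (proj_inj_pos H) => /= E.
  apply/bopP => x; have := congr1 (fun T : bop _ _ => T x) E => /= E'.
  by rewrite /= E'.
have -> : bopM (bopM z ((Q ⊙ proj_neg H) c)) ((off_diagonal P Q ⊙ inj_pos H) c) = z.
  have QF : (Q ⊙ proj_neg H) ⊙ (off_diagonal P Q ⊙ inj_pos H) = hx1 (gr_pos H).
    by rewrite off_diagonal_inj_pos -!hxMA [proj_neg H ⊙ _]hxMA proj_inj_neg hx1M (QP1 F2).
  apply/bopP => x; have /= := congr1 (fun s : hilbX_hom (gr_pos H) (gr_pos H) => s c x) QF.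
  by move=> E; rewrite /= E.
have half_double (q : R[i]) : 2^-1 * (q + q) = q by field; rewrite ?pnatr_eq0.
by rewrite -Zw half_double.
Qed.

Lemma character_formula n k (x : 'I_n.+1 -> A) : n = k.*2 ->
  (forall i, nuc (word n.+1 (diff_word (sigma_at (irr i)) (tau_at (irr i)) (natseq x)))) ->
  character irr n rho (off_diagonal P Q) x = (2 * 'i * (pi%:C)%C) ^+ k * k`!%:R *
    \sum_i trace_cochain (sigma_at (irr i)) (tau_at (irr i)) n.+1 (natseq x).
Proof.
move=> nk; subst n => nZ; have E := supertrace_formula nZ; rewrite -E; clear E nZ.
rewrite /character doubleK.
have x0 : x ord0 = natseq x 0%N by rewrite -(natseqE x ord0).
rewrite x0.
suff -> : \big[@hxM R X H H H/hx1 H]_(j < k.*2) gdiff (off_diagonal P Q) (rho (x (lift ord0 j))) =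
  \prod_(j < k.*2) gdiff (off_diagonal P Q) (rho (natseq x j.+1)) by [].
by apply: eq_bigr => j _; rewrite -(natseqE x (lift ord0 j)).
Qed.

End CharacterFormula.

(** * Homotopy invariance of the Chern character *)

Section SchattenClassGauge.
Variables (R : realType) (X : rigidCstarTensorCat R) (I : Type) (irr : I -> X).
Variables (p : nat) (H : hilbX X).
Hypothesis p_gt0 : (0 < p)%N.
Implicit Types s : hilbX_hom H H.

Lemma class_norm_gauge s (r : R) i : 0 < r -> compact_op (s (irr i)) ->
  (schatten_class_norm irr p%:R s <= r%:E)%E -> gauge p 1 1 (s (irr i)) r.
Proof.
move=> r0 cs sr; apply: schatten_gauge => //; apply: le_trans sr.
by apply: ereal_sup_ubound; exists i.
Qed.

Lemma schatten_class_gauge s i : schatten_class irr p%:R s ->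
  exists g, gauge p 1 1 (s (irr i)) g.
Proof.
move=> [cs soo]; have [r r0 sr] : exists2 r : R, 0 < r & (schatten_class_norm irr p%:R s <= r%:E)%E.
  case: (schatten_class_norm irr p%:R s) soo => [r _|//|_].
    by exists (`|r| + 1); rewrite ?ltr_wpDl// lee_fin ler_wpDr// ler_norm.
  by exists 1; rewrite ?leNye.
by exists r; exact: class_norm_gauge.
Qed.

Lemma schatten_continuous_gauge (s : R -> hilbX_hom H H) i (t e : R) :
  schatten_continuous irr p%:R s -> 0 <= t <= 1 -> 0 < e ->
  exists2 d, 0 < d & forall u, 0 <= u <= 1 -> `|u - t| < d ->
    gauge p 1 1 (s u (irr i) - s t (irr i)) e.
Proof.
move=> [sS sC] t01 e0; have t01' : t \in `[0, 1] by rewrite in_itv.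
have N : nbhs (0%E : \bar R) [set x : \bar R | (x < e%:E)%E].
  by apply: open_nbhs_nbhs; split; [exact: open_ereal_lt_ereal|rewrite /= lte_fin].
have : nbhs t [set u | [set` `[0, 1]] u -> (schatten_class_norm irr p%:R (s u - s t)%R < e%:E)%E].
  exact: sC t t01' _ N.
move=> /nbhs_ballP[d /= d0 dP].
exists d => // u u01 ut.
have u01' : u \in `[0, 1] by rewrite in_itv.
have ub : ball t d u by rewrite /ball /= distrC.
have lte := dP u ub u01'.
apply: (@class_norm_gauge (s u - s t)) => //; last exact: ltW.
by apply: compact_opB; [exact: (sS u u01').1|exact: (sS t t01').1].
Qed.

End SchattenClassGauge.

Section CocycleClasses.
Variables (R : realType) (A : assocAlgType R[i]) (n : nat).
Implicit Types (f g : cochain A n.+1).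

Lemma cyclic_cocycleZ z f : cyclic_cocycle f -> cyclic_cocycle (fun x => z * f x).
Proof.
move=> [fc f0]; split; first exact: cyclic_cochainZ.
by move=> x; rewrite hochschildZ f0 mulr0.
Qed.

Lemma cyclic_cocycle_sum J (s : seq J) (f : J -> cochain A n.+1) :
  (forall i, cyclic_cocycle (f i)) -> cyclic_cocycle (fun x => \sum_(i <- s) f i x).
Proof.
move=> fc; split; first by apply: cyclic_cochain_sum => i; exact: (fc i).1.
by move=> x; rewrite hochschild_sum big1// => i _; exact: (fc i).2.
Qed.

Lemma cyclic_class_eq f g : cyclic_coboundary (fun x => f x - g x) ->
  cyclic_class f = cyclic_class g.
Proof.
move=> [b bc bE]; apply/seteqP; split=> h [c cc cE].
  exists (fun x => c x + b x); first exact: cyclic_cochainD.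
  apply/funext => x; rewrite hochschildD.
  have /(congr1 (fun q => q x)) -> := cE; have /(congr1 (fun q => q x)) -> := bE.
  by rewrite subrKA.
exists (fun x => c x + -1 * b x); first by apply: cyclic_cochainD => //; exact: cyclic_cochainZ.
apply/funext => x; rewrite hochschildD hochschildZ.
have /(congr1 (fun q => q x)) -> := cE; have /(congr1 (fun q => q x)) -> := bE.
by rewrite mulN1r opprB subrKA.
Qed.

End CocycleClasses.

Theorem theorem6p3 (R : realType) (X : rigidCstarTensorCat R)
  (I : finType) (irr : I -> X) (irrX : irr_representatives irr)
  (p m : nat) (pE : p = (2 * m)%N) (p_ge1 : (1 <= p)%N)
  (A : assocAlgType R[i]) (H : gradedHilbX X)
  (rho : R -> A -> hilbX_hom H H)
  (P : R -> hilbX_hom (gr_pos H) (gr_neg H))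
  (Q : R -> hilbX_hom (gr_neg H) (gr_pos H))
  (F : R -> hilbX_hom H H)
  (FE : forall t : R, t \in `[0, 1] -> F t = off_diagonal (P t) (Q t))
  (Fredholm : forall t : R, t \in `[0, 1] ->
     is_fredholm_module irr p%:R (rho t) (F t))
  (schatten_cont : forall a,
     schatten_continuous irr p%:R (fun t =>
       block_pos (rho t a) - Q t ⊙ block_neg (rho t a) ⊙ P t))
  (C1_pos : forall a, piecewise_strongly_C1 (fun t => block_pos (rho t a)))
  (C1_neg : forall a,
     piecewise_strongly_C1 (fun t => Q t ⊙ block_neg (rho t a) ⊙ P t)) :
  exists2 h, h \in cyclic_cohomology A p.+2 &
    forall t : R, t \in `[0, 1] -> chern_character irr p.+2 (rho t) (F t) = h.
Proof.
have inI (t : R) : 0 <= t <= 1 -> t \in `[0, 1] by rewrite in_itv.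
have p_even : ~~ odd p by rewrite pE mul2n odd_double.
have p2 : p.+2 = m.+1.*2 by rewrite pE mul2n.
pose sigma i t := sigma_at (rho t) (irr i).
pose tau i t := tau_at (P t) (Q t) (rho t) (irr i).
have rho_lin t : 0 <= t <= 1 -> linear (rho t) by move=> /inI /Fredholm [[]].
have rhoM t : 0 <= t <= 1 -> forall a b, rho t (amul a b) = rho t a ⊙ rho t b.
  by move=> /inI /Fredholm [[]].
have even t : 0 <= t <= 1 -> forall a, rho t a ⊙ grading H = grading H ⊙ rho t a.
  by move=> /inI /Fredholm [].
have F2 t : 0 <= t <= 1 -> off_diagonal (P t) (Q t) ⊙ off_diagonal (P t) (Q t) = hx1 H.
  by move=> /inI t01; rewrite -FE//; have [] := Fredholm t t01.
have Feps t : 0 <= t <= 1 ->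
    off_diagonal (P t) (Q t) ⊙ grading H = - (grading H ⊙ off_diagonal (P t) (Q t)).
  by move=> /inI t01; rewrite -FE//; have [] := Fredholm t t01.
have sigma_lin i t : 0 <= t <= 1 -> linear (sigma i t).
  by move=> t01; apply: sigma_at_linear; exact: rho_lin.
have tau_lin i t : 0 <= t <= 1 -> linear (tau i t).
  by move=> t01; apply: tau_at_linear; exact: rho_lin.
have sigmaM i t : 0 <= t <= 1 -> forall a b, sigma i t (amul a b) = sigma i t a * sigma i t b.
  by move=> t01; apply: sigma_atM; [exact: rhoM|exact: even].
have tauM i t : 0 <= t <= 1 -> forall a b, tau i t (amul a b) = tau i t a * tau i t b.
  by move=> t01; apply: tau_atM; [exact: rhoM|exact: even|exact: F2].
have sigma_lip i : norm_lipschitz (sigma i).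
  by move=> a; exact: (piecewise_C1_lip (irr i) (C1_pos a)).
have tau_lip i : norm_lipschitz (tau i).
  by move=> a; exact: (piecewise_C1_lip (irr i) (C1_neg a)).
have delta_gauge i a t : 0 <= t <= 1 -> exists g, gauge p 1 1 (hdiff (sigma i t) (tau i t) a) g.
  by move=> /inI t01; exact: (schatten_class_gauge p_ge1 i ((schatten_cont a).1 t t01)).
have delta_cont i a t e : 0 <= t <= 1 -> 0 < e -> exists2 d, 0 < d &
    forall u, 0 <= u <= 1 -> `|u - t| < d ->
    gauge p 1 1 (hdiff (sigma i u) (tau i u) a - hdiff (sigma i t) (tau i t) a) e.
  by move=> t01 e0; exact: (schatten_continuous_gauge p_ge1 i (schatten_cont a) t01 e0).
have delta_schatten i t : 0 <= t <= 1 -> forall a, sch p (hdiff (sigma i t) (tau i t) a).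
  by move=> t01 a; have [g] := delta_gauge i a t t01; exists 1%N, g.
pose C : R[i] := (2 * 'i * (pi%:C)%C) ^+ m.+1 * (m.+1)`!%:R.
pose phi i t : cochain A p.+2 := fun x => trace_cochain (sigma i t) (tau i t) p.+3 (natseq x).
have chE t : 0 <= t <= 1 ->
    character irr p.+2 (rho t) (F t) = fun x => C * \sum_i phi i t x.
  move=> t01; apply/funext => x; rewrite FE ?inI//.
  apply: (character_formula (even t t01) (F2 t t01) (Feps t t01) p2).
  move=> i; apply: (@word_nuc _ _ _ p_ge1 _ _ [::]); first by rewrite addn0 -addn3 leq_addr.
  by move=> j _ _; exact: delta_schatten.
have t0 : 0 <= (0 : R) <= 1 by rewrite lexx ler01.
exists (chern_character irr p.+2 (rho 0) (F 0)).
  apply/mem_set; exists (character irr p.+2 (rho 0) (F 0)) => //; rewrite chE//.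
  apply: cyclic_cocycleZ; apply: cyclic_cocycle_sum => i.
  apply: (trace_cochain_cyclic_cocycle p_ge1 (sigma_lin i 0 t0) (tau_lin i 0 t0) (delta_schatten i 0 t0)
    (sigmaM i 0 t0) (tauM i 0 t0)); first by rewrite p2 odd_double.
  by rewrite -addn2 leq_addr.
move=> t; rewrite in_itv => /= t01; apply: cyclic_class_eq; rewrite !chE//.
have /choice[f fP] : forall i, exists f : cochain A p.+1, cyclic_cochain f /\
    forall x, hochschild f x = phi i t x - phi i 0 x.
  move=> i; have [f fc fE] := homotopy_coboundary p_ge1 p_even (sigma_lin i) (tau_lin i)
    (sigmaM i) (tauM i) (sigma_lip i) (tau_lip i) (delta_gauge i) (delta_cont i) t01.
  by exists f.
exists (fun x => C * \sum_i f i x).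
  by apply: cyclic_cochainZ; apply: cyclic_cochain_sum => i; exact: (fP i).1.
apply/funext => x; rewrite hochschildZ hochschild_sum -mulrBr -sumrB.
by congr (_ * _); apply: eq_bigr => i _; exact: (fP i).2.
Qed.
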